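(* Let $0<\alpha\le 1$ and let $\delta,\epsilon,p,q$ be real numbers. Consider the fractional order delay differential equation $$D^\alpha x(t)=\delta x(t-\tau)-\epsilon (x(t-\tau))^3-p(x(t))^2+qx(t)$$ and its equilibrium point $x_2^*=\dfrac{-p+\sqrt{p^2+4\epsilon(\delta+q)}}{2\epsilon}$. If $\epsilon<0$, $p<0$ and $\delta+q<0$, then $x_2^*$ is unstable for all $\tau\ge 0$.
   Context: $D^\alpha$ denotes the Caputo fractional derivative: $D^1x=x'$, and for $0<\alpha<1$, $D^\alpha x(t)=\frac{1}{\Gamma(1-\alpha)}\int_0^t (t-s)^{-\alpha}x'(s)\,ds$. Initial data: $x(t)=\phi(t)$ for $-\tau\le t\le 0$, where $\phi:[-\tau,0]\to\mathbb{R}$; the corresponding solution is denoted $x(t,\phi)$, and $\|\phi\|=\sup_{-\tau\le t\le 0}|\phi(t)|$. (For $\tau=0$ the initial datum is just $x(0)$.) An equilibrium point is a steady state (constant) solution. An equilibrium point $x^*$ is stable if for every $\eta>0$ there is $\rho>0$ such that $\|\phi-x^*\|<\rho$ implies $|x(t,\phi)-x^*|<\eta$ for all $t\ge 0$. It is asymptotically stable if it is stable and there is $b_0>0$ such that $\|\phi-x^*\|<b_0$ implies $\lim_{t\to\infty}x(t,\phi)=x^*$. It is unstable if it is not stable. *)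

(* Defs.v *)
From HB Require Import structures.
From mathcomp Require Import all_boot all_order all_algebra.
From mathcomp Require Import all_classical all_reals all_analysis.

Set Implicit Arguments.
Unset Strict Implicit.
Unset Printing Implicit Defensive.

Import Order.TTheory GRing.Theory Num.Theory.
Import numFieldNormedType.Exports.

Local Open Scope classical_set_scope.
Local Open Scope ring_scope.

Definition Gamma (R : realType) (a : R) : R :=
  \int[lebesgue_measure]_(t in `]0, +oo[) (t `^ (a - 1) * expR (- t)).

Definition abs_continuous (R : realType) (a b : R) (f : R -> R) : Prop :=
  forall e : R, 0 < e -> exists2 d : R, 0 < d &
    forall (n : nat) (u v : 'I_n -> R),
      (forall i, a <= u i /\ u i <= v i /\ v i <= b) ->
      trivIset [set: 'I_n] (fun i => `]u i, v i[%classic) ->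
      \sum_(i < n) (v i - u i) < d ->
      \sum_(i < n) `|f (v i) - f (u i)| < e.

Definition caputo (R : realType) (alpha : R) (x : R -> R) (t : R) : R :=
  if alpha == 1 then derive1 x t
  else (Gamma (1 - alpha))^-1 *
       \int[lebesgue_measure]_(s in `]0, t[) ((t - s) `^ (- alpha) * derive1 x s).

(* [derive1] and the integral are total functions: this says that the value of
   [caputo alpha x t] is not a default value.  For [alpha < 1], [derive1 x] only has
   to be meaningful almost everywhere, which is ensured by the absolute
   continuity required in [solution]. *)
Definition caputo_defined (R : realType) (alpha : R) (x : R -> R) (t : R) :
    Prop :=
  if alpha == 1 then derivable x t 1
  else lebesgue_measure.-integrable `]0, t[
         (fun s => ((t - s) `^ (- alpha) * derive1 x s)%:E).

(* [x] solves D^alpha x(t) = f (x(t)) (x(t - tau)) on ]0, T[, where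
   0 < T <= +oo; only the values of [x] on [-tau, T[ matter.
   Pointwise differentiability would be too strong for alpha < 1: even for
   constant initial data, x' may be infinite at t = tau.  Locally absolutely
   continuous functions are the natural domain of the Caputo derivative. *)
Definition solution (R : realType) (alpha tau : R) (f : R -> R -> R)
    (T : \bar R) (x : R -> R) : Prop :=
  [/\ {within [set t : R | - tau <= t /\ (t%:E < T)%E], continuous x},
      (forall b : R, 0 < b -> (b%:E < T)%E -> abs_continuous 0 b x) &
      forall t : R, 0 < t -> (t%:E < T)%E ->
        caputo_defined alpha x t /\ caputo alpha x t = f (x t) (x (t - tau))].

Definition equilibrium (R : realType) (alpha tau : R) (f : R -> R -> R)
    (xs : R) : Prop :=
  solution alpha tau f +oo%E (cst xs).

Definition history_norm (R : realType) (tau : R) (phi : R -> R) : R :=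
  sup [set `|phi t| | t in `[- tau, 0]].

(* Solutions may blow up in finite time, so a solution x(t, phi) is considered
   on any interval [-tau, T[ with 0 < T <= +oo on which it exists; one that
   leaves the eta-neighbourhood violates stability whether or not it is global. *)
Definition stable (R : realType) (alpha tau : R) (f : R -> R -> R)
    (xs : R) : Prop :=
  forall eta : R, 0 < eta -> exists2 rho : R, 0 < rho &
    forall phi : R -> R,
      {within `[- tau, 0], continuous phi} ->
      history_norm tau (fun t => phi t - xs) < rho ->
      forall (T : \bar R) (x : R -> R),
        (0 < T)%E ->
        solution alpha tau f T x ->
        (forall t : R, - tau <= t <= 0 -> x t = phi t) ->
        forall t : R, 0 <= t -> (t%:E < T)%E -> `|x t - xs| < eta.

Definition unstable (R : realType) (alpha tau : R) (f : R -> R -> R)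
    (xs : R) : Prop :=
  ~ stable alpha tau f xs.

(* [x] stands for x(t) and [y] for x(t - tau). *)
Definition cubic_rhs (R : realType) (delta epsilon p q x y : R) : R :=
  delta * y - epsilon * y ^+ 3 - p * x ^+ 2 + q * x.

Definition x2star (R : realType) (delta epsilon p q : R) : R :=
  (- p + Num.sqrt (p ^+ 2 + 4 * epsilon * (delta + q))) / (2 * epsilon).

(* Main.v *)
Require Import Defs.
From mathcomp Require Import all_boot all_order all_algebra.
From mathcomp Require Import all_classical all_reals all_analysis.
From mathcomp Require Import measurable_realfun ring lra.
Import Order.TTheory GRing.Theory Num.Theory.
Import numFieldNormedType.Exports.
From mathcomp.real_closed Require Import complex.
Import Normc.
Local Open Scope classical_set_scope.
Local Open Scope ring_scope.

Set Implicit Arguments.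
Unset Strict Implicit.
Unset Printing Implicit Defensive.

(** Why the equilibrium is unstable. Put u = x - xs with xs the equilibrium,
A = q - 2 p xs and B = delta - 3 epsilon xs^2, so that the linearised equation is
D^alpha u = A u + B u(t - tau). The equation satisfied by xs gives
A + B = - xs (2 epsilon xs + p) = - xs sqrt D with D the discriminant, and this
is positive because xs < 0. Whatever the delay, the characteristic equation
lam^alpha = A + B exp(- lam tau) then has a real root lam > 0
([characteristic_root]). The passage from this root to instability of the
nonlinear equation is a Perron argument on Laplace transforms, uniform in alpha
and tau.

Existence. Instability asserts that some solutions exist, and they are built
here for constant histories xs + c. Outside a small interval [-r, r] the
polynomials are continued by tangent lines, which makes them C^{1,1}. With
k(t) = t^(alpha-1) / Gamma(alpha), the density y of u' solves
y = h0 k + k * (g1'(u) y + g2'(u_tau) y_tau), where u is c plus the primitive of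
y; Picard iteration in exponentially weighted norms gives y
([delayed_existence]). Since the kernels of orders alpha and 1 - alpha convolve
to the unit step theta, u solves the Caputo equation as long as |u| <= r
([state_solution]), and u = c + k * h with h the truncated right hand side.

Contradiction. If the equilibrium were stable, u would stay in [-r, r] for ever
when c is small. On positive times w = theta u satisfies
w = c theta + k * (A w + B w_tau + N), where N consists of a multiple of
c 1_]0, tau] and of a remainder bounded by th (|w| + |w_tau| + c 1_]0, tau]), th
being as small as desired. Hence (1 - K^) w^ = c theta^ + k^ N^ with
K^(s) = (A + B exp(- s tau)) k^(s). At s = lam the left hand side vanishes, so
c (A + B) / lam is, up to sign, the integral of exp(- lam t) against the
remainder ([root_balance]). On a line Re s = sigma < lam on which |1 - K^| is
bounded below, Plancherel's identity bounds the weighted L2 norm of w by C c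
([future_energy]) with C independent of th and c; the remainder therefore
contributes at most th C' c to the first identity, which is absurd for small th
([no_small_solution]).

Such a line exists ([zero_free_line]). Otherwise the zeros of 1 - K^ on nearby
lines accumulate and produce a double zero on every line of the strip. As
t k(t) = alpha (theta * k)(t), the derivative of k^ is a rational multiple of
k^; eliminating the exponential leaves a simpler function of the same kind that
vanishes on every line, and a second round forces tau s = 1 - alpha for all
these s.

Plancherel's identity enters through Abel means: the integral over w > 0 of
exp(- e w) |f^|^2 equals the autocorrelation of f integrated against a Poisson
kernel, hence is at most a fixed multiple of the squared L2 norm of f and tends
to this multiple as e tends to 0 if f is continuous off the origin
([energy_comparison]). *)

(** * Integrals over the real line *)

Section integral_toolkit.
Context {R : realType}.
Local Notation mu := (@lebesgue_measure R).
Implicit Types f g h : R -> R.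

Definition summableR f := mu.-integrable setT (EFin \o f).
Definition itg f : R := \int[mu]_t f t.

Lemma summableR_measurable f : summableR f -> measurable_fun setT f.
Proof. by move=> /measurable_int /measurable_EFinP. Qed.

Lemma summableR_le f g : measurable_fun setT f -> summableR g ->
  (forall t, `|f t| <= `|g t|) -> summableR f.
Proof.
move=> mf ig fg; apply: le_integrable ig => //; first exact/measurable_EFinP.
by move=> t _; rewrite /= lee_fin.
Qed.

Lemma summableR0 : summableR (fun=> 0).
Proof. exact: integrable0. Qed.

Lemma summableRD f g : summableR f -> summableR g -> summableR (fun t => f t + g t).
Proof. by move=> f1 g1; apply: eq_integrable (integrableD measurableT f1 g1). Qed.

Lemma summableRB f g : summableR f -> summableR g -> summableR (fun t => f t - g t).
Proof. by move=> f1 g1; apply: eq_integrable (integrableB measurableT f1 g1). Qed.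

Lemma summableRZ (r : R) f : summableR f -> summableR (fun t => r * f t).
Proof. by move=> f1; apply: eq_integrable (integrableZl measurableT r f1). Qed.

Lemma summableR_norm f : summableR f -> summableR (fun t => `|f t|).
Proof. by move=> /integrable_norm. Qed.

Lemma summableR_bounded (w : R -> R) (M : R) f : measurable_fun setT w ->
  (forall t, `|w t| <= M) -> summableR f -> summableR (fun t => w t * f t).
Proof.
move=> mw wM f1; apply: (summableR_le _ (summableRZ M f1)).
  by apply: measurable_funM => //; exact: summableR_measurable.
move=> t; rewrite !normrM ler_wpM2r// (le_trans (wM t))//.
exact: ler_norm.
Qed.

Lemma itg0 : itg (fun=> 0) = 0.
Proof. by rewrite /itg /Rintegral integral0. Qed.

Lemma itgD f g : summableR f -> summableR g ->
  itg (fun t => f t + g t) = itg f + itg g.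
Proof. by move=> f1 g1; apply: RintegralD. Qed.

Lemma itgB f g : summableR f -> summableR g ->
  itg (fun t => f t - g t) = itg f - itg g.
Proof. by move=> f1 g1; apply: RintegralB. Qed.

Lemma itgZ (r : R) f : summableR f -> itg (fun t => r * f t) = r * itg f.
Proof. by move=> f1; apply: RintegralZl. Qed.

Lemma itg_le f g : summableR f -> summableR g -> (forall t, f t <= g t) ->
  itg f <= itg g.
Proof. by move=> f1 g1 fg; apply: le_Rintegral. Qed.

Lemma itg_ge0 f : (forall t, 0 <= f t) -> 0 <= itg f.
Proof. by move=> f0; apply: Rintegral_ge0. Qed.

Lemma itg_norm f : summableR f -> `|itg f| <= itg (fun t => `|f t|).
Proof. by move=> f1; apply: le_normr_Rintegral. Qed.

Lemma itg_normE f : summableR f ->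
  ((itg (fun t => `|f t|))%:E = \int[mu]_t (`|f t|%:E))%E.
Proof.
move=> f1; rewrite /itg /Rintegral fineK//; apply: integrable_fin_num => //.
exact: summableR_norm.
Qed.

Lemma itgE f : summableR f -> ((itg f)%:E = \int[mu]_t (f t)%:E)%E.
Proof. by move=> f1; rewrite /itg /Rintegral fineK//; exact: integrable_fin_num. Qed.

Lemma summableRP f : measurable_fun setT f ->
  (\int[mu]_t `|f t|%:E < +oo)%E -> summableR f.
Proof. by move=> mf fy; apply/integrableP; split=> //; exact/measurable_EFinP. Qed.

(** * Affine substitutions *)

Lemma measurable_affine (a b : R) : measurable_fun [set: measurableTypeR R]
  (fun x : R => a * x + b : measurableTypeR R).
Proof. by apply: measurable_funD => //; exact: measurable_funM. Qed.

Lemma lebesgue_measure_affine (a b : R) (a0 : 0 < a) (A : set R) : measurable A ->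
  (mu A = a%:E * mu ((fun x => a * x + b)%R @^-1` A))%E.
Proof.
move=> mA.
pose m' (mf : measurable_fun setT (fun x : R => (a * x + b)%R : measurableTypeR R)) :=
  mscale (NngNum (ltW a0))
   (measure_function_pushforward__canonical__measure_function_Measure mu mf).
apply: (@lebesgue_measure_unique _ (m' (measurable_affine a b))) => //=.
move=> _ [[x y] _ <-].
rewrite /m' /mscale /pushforward/=.
rewrite [X in (_ * mu X)%E](_ : _ = `](x - b) / a, (y - b) / a]%classic); last first.
  apply/seteqP; split=> z /=; rewrite !in_itv/= ltr_pdivrMr// ler_pdivlMr//;
   by rewrite ltrBlDr lerBrDr mulrC.
rewrite !lebesgue_measure_itv/= !lte_fin ltr_pM2r ?invr_gt0// ltrD2r.
case: ifPn => xy; last by rewrite mule0.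
rewrite -EFinM; congr (_%:E); field; exact: lt0r_neq0.
Qed.

Lemma ge0_integral_affine (a b : R) (f : R -> \bar R) : 0 < a ->
  measurable_fun setT f -> (forall x, 0 <= f x)%E ->
  (\int[mu]_x f x = a%:E * \int[mu]_x f (a * x + b)%R)%E.
Proof.
move=> a0 mf f0.
have mphi := measurable_affine a b.
pose m' := mscale (NngNum (ltW a0))
   (measure_function_pushforward__canonical__measure_function_Measure mu mphi).
transitivity (\int[m']_x f x)%E.
  apply: (@eq_measure_integral _ _ _ _ m' mu) => A mA _.
  exact: lebesgue_measure_affine.
rewrite ge0_integral_mscale//= ge0_integral_pushforward//.
Qed.

Lemma ge0_integral_opp (f : R -> \bar R) :
  measurable_fun setT f -> (forall x, 0 <= f x)%E ->
  (\int[mu]_x f x = \int[mu]_x f (- x)%R)%E.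
Proof.
move=> mf f0.
have mN : measurable_fun [set: measurableTypeR R] (-%R : R -> measurableTypeR R) by [].
pose m' := measure_function_pushforward__canonical__measure_function_Measure mu mN.
transitivity (\int[m']_x f x)%E.
  apply: (@eq_measure_integral _ _ _ _ m' mu) => A mA _.
  exact/esym/lebesgue_measureN.
by rewrite ge0_integral_pushforward//.
Qed.

Lemma measurable_comp_affine (a b : R) f : measurable_fun setT f ->
  measurable_fun setT (fun x => f (a * x + b)).
Proof. by move=> mf; exact: (measurableT_comp mf (measurable_affine a b)). Qed.

Lemma summableR_affine (a b : R) f : 0 < a -> summableR f ->
  summableR (fun x => f (a * x + b)).
Proof.
move=> a0 f1; have mf := summableR_measurable f1.
apply: summableRP; first exact: measurable_comp_affine.
have : (\int[mu]_x `|f x|%:E < +oo)%E by move/integrableP : f1 => -[].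
rewrite (@ge0_integral_affine a b)//; last first.
  by apply/measurable_EFinP; exact: measurableT_comp.
by move: (\int[mu]_x _)%E => [r| |]//=; rewrite ?ltey// gt0_muley.
Qed.

Lemma itg_affine (a b : R) f : 0 < a -> summableR f ->
  itg (fun x => f (a * x + b)) = a^-1 * itg f.
Proof.
move=> a0 f1; have mf := summableR_measurable f1.
have f2 := summableR_affine b a0 f1.
have pos (g : R -> R) : measurable_fun setT g -> (forall x, 0 <= g x) ->
    itg g = a * itg (fun x => g (a * x + b)).
  move=> mg g0; rewrite /itg /Rintegral (@ge0_integral_affine a b)//; last first.
    exact/measurable_EFinP.
  case: (\int[mu]_x _)%E => [r| |]/=; rewrite ?mulr0//.
    by rewrite gt0_muley.
  by rewrite gt0_muleNy.
have fE x : f x = f^\+ x - f^\- x by rewrite -[in LHS](funrposBneg f).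
apply: (mulfI (lt0r_neq0 a0)); rewrite mulrA divff ?lt0r_neq0// mul1r.
have [fp fn] : summableR f^\+ /\ summableR f^\-.
  by split; [exact: integrable_funrpos|exact: integrable_funrneg].
transitivity (a * itg (fun x => f^\+ (a * x + b) - f^\- (a * x + b))).
  by congr (_ * itg _); apply/funext => x; exact: fE.
rewrite itgB ?(@summableR_affine a b (f^\+))// ?(@summableR_affine a b (f^\-))//.
rewrite mulrBr -!pos//; last 2 first.
  exact: summableR_measurable.
  exact: summableR_measurable.
  by rewrite -itgB//; congr itg; apply/funext => x; rewrite fE.
Qed.

Lemma measurable_opp f : measurable_fun setT f -> measurable_fun setT (fun x : R => f (- x)).
Proof. by move=> mf; exact: (measurableT_comp mf (@oppr_measurable R _)). Qed.

Lemma summableR_opp f : summableR f -> summableR (fun x => f (- x)).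
Proof.
move=> f1; have mf := summableR_measurable f1.
apply: summableRP; first exact: measurable_opp.
have : (\int[mu]_x `|f x|%:E < +oo)%E by move/integrableP : f1 => -[].
by rewrite ge0_integral_opp//; apply/measurable_EFinP; exact: measurableT_comp.
Qed.

Lemma itg_opp f : summableR f -> itg (fun x => f (- x)) = itg f.
Proof.
move=> f1; have mf := summableR_measurable f1.
have pos (g : R -> R) : measurable_fun setT g -> (forall x, 0 <= g x) ->
    itg g = itg (fun x => g (- x)).
  move=> mg g0; rewrite /itg /Rintegral ge0_integral_opp//.
  exact/measurable_EFinP.
have fE x : f x = f^\+ x - f^\- x by rewrite -[in LHS](funrposBneg f).
have [fp fn] : summableR f^\+ /\ summableR f^\-.
  by split; [exact: integrable_funrpos|exact: integrable_funrneg].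
transitivity (itg (fun x => f^\+ (- x) - f^\- (- x))).
  by congr itg; apply/funext => x; exact: fE.
rewrite itgB ?(@summableR_opp (f^\+))// ?(@summableR_opp (f^\-))//.
rewrite -!pos//; last 2 first.
  exact: summableR_measurable.
  exact: summableR_measurable.
by rewrite -itgB//; congr itg; apply/funext => x; rewrite fE.
Qed.

(** * Exchange of integrals *)

Lemma summableR_fine (G : R -> \bar R) : mu.-integrable setT G ->
  summableR (fun x => fine (G x)) /\
  ((itg (fun x => fine (G x)))%:E = \int[mu]_x G x)%E.
Proof.
move=> iG; have mG := measurable_int _ iG.
have mfG : measurable_fun setT (fun x => fine (G x)).
  by apply: measurableT_comp => //; exact: fine_measurable.
have Gfin : ae_eq mu setT G (EFin \o (fun x => fine (G x))).
  apply: filterS (integrable_ae measurableT iG) => x /= Gx _.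
  by rewrite fineK// Gx.
have sG : summableR (fun x => fine (G x)).
  apply: summableRP => //.
  have /integrableP[_] := iG; apply: le_lt_trans.
  apply: ge0_le_integral => //.
  - by apply/measurable_EFinP; exact: measurableT_comp.
  - exact: measurableT_comp.
  - by move=> x _; case: (G x) => [r| |]//=; rewrite ?normr0 ?leey.
split=> //; rewrite itgE//; apply/esym/ae_eq_integral => //.
exact/measurable_EFinP.
Qed.

(** The bound G makes the iterated integral of the norm finite, so that the
function is integrable on the product by Tonelli's theorem. *)
Lemma fubiniR_suff (F : R -> R -> R) :
  measurable_fun [set: measurableTypeR R * measurableTypeR R] (fun z => F z.1 z.2) ->
  (forall x, summableR (F x)) ->
  forall G : R -> R, summableR G -> (forall x, itg (fun y => `|F x y|) <= G x) ->
  [/\ itg (fun x => itg (fun y => F x y)) = itg (fun y => itg (fun x => F x y)),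
      summableR (fun x => itg (fun y => F x y)),
      summableR (fun y => itg (fun x => F x y)) &
      {ae mu, forall y, summableR (fun x => F x y)}].
Proof.
move=> mF F1 G G1 FG.
have mF' : measurable_fun [set: measurableTypeR R * measurableTypeR R]
   (fun z => (F z.1 z.2)%:E) by exact/measurable_EFinP.
have bound : (\int[mu]_x \int[mu]_y `|(F x y)%:E| < +oo)%E.
  apply: (@le_lt_trans _ _ (\int[mu]_x (G x)%:E)%E); last by rewrite -itgE// ltey.
  apply: ge0_le_integral => //.
  - by move=> x _; exact: integral_ge0.
  - apply: (@measurable_fun_fubini_tonelli_F _ _ _ _ _ mu (fun z => `|(F z.1 z.2)%:E|%E)).
      exact: measurableT_comp.
    by move=> z; exact: abse_ge0.
  - by apply/measurable_EFinP; exact: summableR_measurable.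
  - by move=> x _; rewrite -itg_normE// lee_fin.
have imF : (mu \x mu)%E.-integrable setT (fun z => (F z.1 z.2)%:E).
  exact/integrable12ltyP.
have [s1 e1] := summableR_fine (integrable_fubini_F imF).
have mF2 : measurable_fun [set: measurableTypeR R * measurableTypeR R]
   (fun z => (F z.2 z.1)%:E).
  exact: (measurableT_comp mF' (@measurable_swap _ _ _ _)).
have imF2 : (mu \x mu)%E.-integrable setT (fun z => (F z.2 z.1)%:E).
  exact/integrable21ltyP.
have [s2 e2] := summableR_fine (integrable_fubini_F imF2).
split=> //.
- by apply: EFin_inj; rewrite e1 e2 /fubini_F /fubini_G; exact: (Fubini imF).
- exact: (ae_integrable2 imF).
Qed.

(** The extended integral is then infinite, or a difference of infinities, and its
real part is 0 by convention. Translations and reflections therefore preserve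
[itg] for all measurable functions. *)
Lemma itg_nonsummable f : measurable_fun setT f -> ~ summableR f -> itg f = 0.
Proof.
move=> mf nf; rewrite /itg /Rintegral integralE.
have [p0 n0] : (0 <= \int[mu]_x (EFin \o f)^\+ x)%E /\
   (0 <= \int[mu]_x (EFin \o f)^\- x)%E by split; exact: integral_ge0.
have : ~ ((\int[mu]_x (EFin \o f)^\+ x < +oo)%E /\
   (\int[mu]_x (EFin \o f)^\- x < +oo)%E).
  move=> [p1 n1]; apply: nf; apply: summableRP => //.
  rewrite (_ : (fun x => `|f x|%:E) = (fun x => (EFin \o f)^\+ x + (EFin \o f)^\- x)%E).
    rewrite ge0_integralD//; first exact: lte_add_pinfty.
    - exact/measurable_funepos/measurable_EFinP.
    - exact/measurable_funeneg/measurable_EFinP.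
  by apply/funext => x; exact: (congr1 (@^~ x) (fune_abse (EFin \o f))).
move: (\int[mu]_x (EFin \o f)^\+ x)%E (\int[mu]_x (EFin \o f)^\- x)%E p0 n0.
by move=> [r| |] [r'| |]//= _ _ []; rewrite !ltey.
Qed.

Lemma measurable_shift f (s : R) : measurable_fun setT f ->
  measurable_fun setT (fun t : R => f (t - s)).
Proof.
move=> /(measurable_comp_affine 1 (- s)); apply: eq_measurable_fun => t _.
by rewrite mul1r.
Qed.

Lemma summableR_shift f (s : R) : summableR f -> summableR (fun t => f (t - s)).
Proof.
move=> /(summableR_affine (- s) ltr01); apply: eq_integrable => // t _ /=.
by rewrite mul1r.
Qed.

Lemma itg_shift f (s : R) : measurable_fun setT f -> itg (fun t => f (t - s)) = itg f.
Proof.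
move=> mf; have [f1|f1] := pselect (summableR f).
  transitivity (itg (fun t => f (1 * t + - s))).
    by congr itg; apply/funext => t; rewrite mul1r.
  by rewrite itg_affine// invr1 mul1r.
rewrite !itg_nonsummable//; first exact: measurable_shift.
apply: contra_not f1 => /(summableR_affine s ltr01).
by apply: eq_integrable => // t _ /=; rewrite mul1r addrK.
Qed.

Lemma measurable_refl f (s : R) : measurable_fun setT f ->
  measurable_fun setT (fun t : R => f (s - t)).
Proof.
move=> /(measurable_comp_affine 1 s)/measurable_opp; apply: eq_measurable_fun => t _.
by rewrite mul1r addrC.
Qed.

Lemma summableR_refl f (s : R) : summableR f -> summableR (fun t => f (s - t)).
Proof.
move=> /(summableR_affine s ltr01)/summableR_opp; apply: eq_integrable => // t _ /=.
by rewrite mul1r addrC.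
Qed.

Lemma itg_refl f (s : R) : measurable_fun setT f -> itg (fun t => f (s - t)) = itg f.
Proof.
move=> mf; have [f1|f1] := pselect (summableR f).
  transitivity (itg (fun t => (fun t => f (1 * t + s)) (- t))).
    by congr itg; apply/funext => t; rewrite mul1r addrC.
  by rewrite (@itg_opp (fun t => f (1 * t + s))); [rewrite itg_affine// invr1 mul1r|exact: summableR_affine].
rewrite !itg_nonsummable//; first exact: measurable_refl.
apply: contra_not f1 => /(summableR_refl s).
by apply: eq_integrable => // t _ /=; rewrite subKr.
Qed.

Lemma itgMl (r : R) f : measurable_fun setT f -> itg (fun t => r * f t) = r * itg f.
Proof.
move=> mf; have [->|r0] := eqVneq r 0.
  by rewrite mul0r -[RHS]itg0; congr itg; apply/funext => t; rewrite mul0r.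
have [f1|f1] := pselect (summableR f); first exact: itgZ.
rewrite [in RHS]itg_nonsummable// mulr0 itg_nonsummable//.
  exact: measurable_funM.
apply: contra_not f1 => /(summableRZ r^-1); apply: eq_integrable => // t _ /=.
by rewrite mulrA mulVf// mul1r.
Qed.

End integral_toolkit.

(** * Convolution *)

Section convolution.
Context {R : realType}.
Local Notation mu := (@lebesgue_measure R).
Implicit Types f g h w : R -> R.

Definition convol f g (t : R) : R := itg (fun s => f (t - s) * g s).

Definition damp (m : R) f (t : R) : R := expR (- (m * t)) * f t.

Definition wnorm (m : R) f : R := itg (fun t => `|damp m f t|).

Lemma measurable_sub2 f : measurable_fun setT f ->
  measurable_fun [set: measurableTypeR R * measurableTypeR R] (fun z => f (z.2 - z.1)).
Proof.
move=> mf; apply: (measurableT_comp mf).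
by apply: measurable_funB; [exact: measurable_snd|exact: measurable_fst].
Qed.

Lemma measurable_p1 f : measurable_fun setT f ->
  measurable_fun [set: measurableTypeR R * measurableTypeR R] (fun z => f z.1).
Proof. by move=> mf; exact: (measurableT_comp mf measurable_fst). Qed.

Lemma measurable_p2 f : measurable_fun setT f ->
  measurable_fun [set: measurableTypeR R * measurableTypeR R] (fun z => f z.2).
Proof. by move=> mf; exact: (measurableT_comp mf measurable_snd). Qed.

Lemma conv_section f g (t : R) : measurable_fun setT f -> measurable_fun setT g ->
  measurable_fun setT (fun s : R => f (t - s) * g s).
Proof. by move=> mf mg; apply: measurable_funM => //; exact: measurable_refl. Qed.

(** The weight w = 1 gives the summability of convolutions, and w = cos, sin gives
their transforms. *)
Lemma conv_fubini f g w (M : R) : summableR f -> summableR g ->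
  measurable_fun setT w -> (forall t, `|w t| <= M) ->
  itg (fun t => w t * convol f g t) = itg (fun s => g s * itg (fun r => w (r + s) * f r)) /\
  {ae mu, forall t, summableR (fun s => w t * (f (t - s) * g s))} /\
  summableR (fun t => w t * convol f g t).
Proof.
move=> f1 g1 mw wM.
have mf := summableR_measurable f1; have mg := summableR_measurable g1.
pose F (s t : R) := w t * (f (t - s) * g s).
have mF : measurable_fun [set: measurableTypeR R * measurableTypeR R]
    (fun z => F z.1 z.2).
  apply: measurable_funM; first exact: measurable_p2.
  apply: measurable_funM; first exact: measurable_sub2.
  exact: measurable_p1.
have s1 s : summableR (fun t => f (t - s) * g s).
  apply: eq_integrable (summableRZ (g s) (summableR_shift s f1)) => // t _ /=.
  by rewrite mulrC.
have F1 s : summableR (F s) by apply: (summableR_bounded mw wM).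
have G1 : summableR (fun s => (M * itg (fun t => `|f t|)) * `|g s|).
  by apply: summableRZ; exact: summableR_norm.
have FG s : itg (fun t => `|F s t|) <= (M * itg (fun t => `|f t|)) * `|g s|.
  have -> : M * itg (fun t => `|f t|) * `|g s| =
      itg (fun t => (M * `|g s|) * `|f (t - s)|).
    rewrite itgZ; last exact/summableR_norm/summableR_shift.
    rewrite (@itg_shift _ (fun t => `|f t|)); first by rewrite mulrAC.
    exact: measurableT_comp.
  apply: itg_le; first exact: summableR_norm.
    exact/summableRZ/summableR_norm/summableR_shift.
  move=> t; rewrite /F !normrM mulrAC -mulrA ler_wpM2r// ler_wpM2r//.
have [e _ s2 ae] := fubiniR_suff mF F1 G1 FG.
split; last split => //.
  transitivity (itg (fun t => itg (fun s => F s t))).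
    congr itg; apply/funext => t; rewrite itgMl//; exact: conv_section.
  rewrite -e; congr itg; apply/funext => s.
  transitivity (itg (fun t => g s * (fun r => w (r + s) * f r) (t - s))).
    by congr itg; apply/funext => t; rewrite subrK /F; ring.
  rewrite itgMl; last first.
    apply: (@measurable_shift _ (fun r => w (r + s) * f r)).
    apply: measurable_funM => //.
    have := measurable_shift (- s) mw; apply: eq_measurable_fun => r _.
    by rewrite opprK.
  congr (_ * _); apply: itg_shift.
  apply: measurable_funM => //.
  have := measurable_shift (- s) mw; apply: eq_measurable_fun => r _.
  by rewrite opprK.
apply: eq_integrable s2 => // t _ /=; congr EFin.
by rewrite itgMl//; exact: conv_section.
Qed.

Lemma summable_conv f g : summableR f -> summableR g -> summableR (convol f g).
Proof.
move=> f1 g1; have n1 (t : R) : `|1 : R| <= 1 by rewrite normr1.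
have [_ [_]] := @conv_fubini f g (fun=> 1) 1 f1 g1 (measurable_cst _) n1.
by apply: eq_integrable => // t _ /=; rewrite mul1r.
Qed.

Lemma norm_conv f g (t : R) : measurable_fun setT f -> measurable_fun setT g ->
  summableR (fun s => f (t - s) * g s) ->
  `|convol f g t| <= convol (fun s => `|f s|) (fun s => `|g s|) t.
Proof.
move=> mf mg fg; apply: (le_trans (itg_norm fg)); rewrite le_eqVlt; apply/orP; left.
by apply/eqP; congr itg; apply/funext => s; rewrite normrM.
Qed.

(** Where the section is not summable the left hand side is 0 by convention. *)
Lemma norm_conv_le f g (t : R) : measurable_fun setT f -> measurable_fun setT g ->
  `|convol f g t| <= convol (fun s => `|f s|) (fun s => `|g s|) t.
Proof.
move=> mf mg; have [fg|fg] := pselect (summableR (fun s => f (t - s) * g s)).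
  exact: norm_conv.
rewrite /convol itg_nonsummable ?normr0//; last exact: conv_section.
by apply: itg_ge0 => s; rewrite mulr_ge0.
Qed.

Lemma itg_norm_conv f g : summableR f -> summableR g ->
  itg (fun t => `|convol f g t|) <= itg (fun t => `|f t|) * itg (fun t => `|g t|).
Proof.
move=> f1 g1.
have mf := summableR_measurable f1; have mg := summableR_measurable g1.
have [f2 g2] := (summableR_norm f1, summableR_norm g1).
have n1 (t : R) : `|1 : R| <= 1 by rewrite normr1.
have [e _] := @conv_fubini _ _ (fun=> 1) 1 f2 g2 (measurable_cst _) n1.
apply: (@le_trans _ _ (itg (convol (fun s => `|f s|) (fun s => `|g s|)))).
  apply: itg_le.
  - exact/summableR_norm/summable_conv.
  - exact: summable_conv.
  - by move=> t; exact: norm_conv_le.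
have -> : itg (convol (fun s => `|f s|) (fun s => `|g s|)) =
    itg (fun t => 1 * convol (fun s => `|f s|) (fun s => `|g s|) t).
  by congr itg; apply/funext => t; rewrite mul1r.
rewrite e -[X in _ <= X]itgZ// le_eqVlt; apply/orP; left; apply/eqP.
congr itg; apply/funext => s; rewrite mulrC; congr (_ * _).
by congr itg; apply/funext => t; rewrite mul1r.
Qed.

(** * Exponential damping *)

Lemma measurable_damp m f : measurable_fun setT f -> measurable_fun setT (damp m f).
Proof.
move=> mf; apply: measurable_funM => //.
apply: (measurableT_comp (@measurable_expR R)).
by apply: measurable_funN; exact: mulrl_measurable.
Qed.

Lemma dampK m f : f = damp (- m) (damp m f).
Proof.
apply/funext => t; rewrite /damp mulrA -expRD mulNr opprK.
by rewrite addrN expR0 mul1r.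
Qed.

Lemma measurable_damped m f : measurable_fun setT (damp m f) -> measurable_fun setT f.
Proof. by move=> mf; rewrite (dampK m f); exact: measurable_damp. Qed.

(** The exponential is multiplicative, so it passes through the convolution. *)
Lemma damp_conv m f g : measurable_fun setT f -> measurable_fun setT g ->
  damp m (convol f g) = convol (damp m f) (damp m g).
Proof.
move=> mf mg; apply/funext => t; rewrite /damp /convol -itgMl; last exact: conv_section.
congr itg; apply/funext => s; rewrite mulrACA -expRD; congr (expR _ * _); ring.
Qed.

Lemma wsummable_conv m f g : summableR (damp m f) -> summableR (damp m g) ->
  summableR (damp m (convol f g)).
Proof.
move=> f1 g1; rewrite damp_conv; first exact: summable_conv.
  exact: measurable_damped (summableR_measurable f1).
exact: measurable_damped (summableR_measurable g1).
Qed.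

Lemma wnorm_conv m f g : summableR (damp m f) -> summableR (damp m g) ->
  wnorm m (convol f g) <= wnorm m f * wnorm m g.
Proof.
move=> f1 g1; rewrite /wnorm damp_conv; first exact: itg_norm_conv.
  exact: measurable_damped (summableR_measurable f1).
exact: measurable_damped (summableR_measurable g1).
Qed.

Lemma conv_assoc f g h (t : R) (G : R -> R) :
  measurable_fun setT f -> measurable_fun setT g -> measurable_fun setT h ->
  (forall r, summableR (fun s => f (t - s) * g (s - r) * h r)) ->
  summableR G ->
  (forall r, itg (fun s => `|f (t - s) * g (s - r) * h r|) <= G r) ->
  convol f (convol g h) t = convol (convol f g) h t /\
  summableR (fun s => f (t - s) * convol g h s).
Proof.
move=> mf mg mh F1 G1 FG.
pose F (r s : R) := f (t - s) * g (s - r) * h r.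
have mF : measurable_fun [set: measurableTypeR R * measurableTypeR R]
    (fun z => F z.1 z.2).
  apply: measurable_funM; last exact: measurable_p1.
  apply: measurable_funM; last exact: measurable_sub2.
  by apply: (@measurable_p2 (fun s => f (t - s))); exact: measurable_refl.
have [e _ s2 ae] := fubiniR_suff mF F1 G1 FG.
have E : (fun s => f (t - s) * convol g h s) = (fun s => itg (fun r => F r s)).
  apply/funext => s; rewrite -itgMl; last exact: conv_section.
  by congr itg; apply/funext => r; rewrite /F mulrA.
split; last by rewrite E.
rewrite /convol -/(convol g h).
transitivity (itg (fun s => itg (fun r => F r s))); first by rewrite -E.
rewrite -e; congr itg; apply/funext => r.
rewrite [RHS]mulrC -itgMl; last exact: conv_section.
rewrite -(@itg_shift _ (fun s => h r * (f (t - r - s) * g s)) r); last first.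
  by apply: measurable_funM => //; exact: conv_section.
congr itg; apply/funext => s; rewrite /F mulrC; congr (_ * (f _ * _)); ring.
Qed.

Lemma conv_comm f g : measurable_fun setT f -> measurable_fun setT g ->
  convol f g = convol g f.
Proof.
move=> mf mg; apply/funext => t.
rewrite /convol -(@itg_refl _ (fun s => f (t - s) * g s) t); last exact: conv_section.
by congr itg; apply/funext => s; rewrite subKr mulrC.
Qed.

End convolution.

(** * Power kernels *)

Section power_kernel.
Context {R : realType}.
Local Notation mu := (@lebesgue_measure R).
Implicit Types f g h w : R -> R.

Definition theta (t : R) : R := if 0 < t then 1 else 0.

Definition pw (a t : R) : R := if 0 < t then t `^ (a - 1) else 0.

Lemma measurable_theta : measurable_fun setT theta.
Proof.
by apply: measurable_fun_ifT => //; exact: measurable_fun_ltr.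
Qed.

Lemma measurable_pw a : measurable_fun setT (pw a).
Proof.
apply: measurable_fun_ifT => //; first exact: measurable_fun_ltr.
Qed.

Lemma theta_ge0 t : 0 <= theta t. Proof. by rewrite /theta; case: ifP. Qed.

Lemma pw_ge0 a t : 0 <= pw a t.
Proof. by rewrite /pw; case: ifP => // _; exact: powR_ge0. Qed.

Lemma pwZ a (r t : R) : 0 < r -> pw a (r * t) = r `^ (a - 1) * pw a t.
Proof.
move=> r0; rewrite /pw pmulr_rgt0//; case: ifPn => t0; last by rewrite mulr0.
by rewrite powRM// ltW.
Qed.

(** For a < 1 the integrand is unbounded at 0: the fundamental theorem is applied on
[t / (n + 2), t] and the left end point tends to 0. *)
Lemma integral_pw_oc (a t : R) : 0 < a -> 0 < t ->
  (\int[mu]_(s in `]0%R, t]) (s `^ (a - 1))%:E = (t `^ a / a)%:E)%E.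
Proof.
move=> a0 t0.
pose F (n : nat) : set R := `[t / n.+2%:R, t]%classic.
have tn (n : nat) : 0 < t / n.+2%:R by rewrite divr_gt0.
have tn' (n : nat) : t / n.+2%:R < t by rewrite ltr_pdivrMr// ltr_pMr// ltr1n.
have UF : \bigcup_i F i = `]0, t]%classic.
  apply/seteqP; split => [s [n _]|s]; rewrite /F/= !in_itv/=.
    by move=> /andP[ts ->]; rewrite (lt_le_trans _ ts).
  move=> /andP[s0 st]; exists (Num.truncn (t / s)) => //=.
  rewrite in_itv/= st andbT ler_pdivrMr// -ler_pdivrMl// mulrC.
  rewrite (le_trans (ltW (truncnS_gt _)))// ler_nat.
  by rewrite ltnW.
have mf : measurable_fun setT (fun s : R => (s `^ (a - 1))%:E).
  by apply/measurable_EFinP; exact: measurable_powR.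
have ndF : nondecreasing_seq F.
  move=> n m nm; apply/subsetPset => s; rewrite /F/= !in_itv/= => /andP[ts ->].
  by rewrite andbT (le_trans _ ts)// ler_pM2l// lef_pV2 ?posrE// ler_nat.
have mF n : measurable (F n) by exact: measurable_itv.
have := @ge0_nondecreasing_set_cvg_integral _ (measurableTypeR R) R F (fun s => (s `^ (a - 1))%:E) mu ndF mF.
rewrite UF => H; apply/esym; apply: cvg_unique (H _ _) => //; last 2 first.
  by move=> n; exact: measurable_funTS.
  by move=> n s _; rewrite lee_fin powR_ge0.
have itvE n : (\int[mu]_(s in F n) (s `^ (a - 1))%:E =
    (t `^ a / a - (t / n.+2%:R) `^ a / a)%:E)%E.
  rewrite EFinB.
  apply: (@continuous_FTC2 _ _ (fun s => s `^ a / a)) => //.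
  - apply: continuous_in_subspaceT => s; rewrite inE/= in_itv/= => /andP[ts _].
    apply: differentiable_continuous; apply/derivable1_diffP.
    by apply: derivable_powR; rewrite in_itv/= andbT (lt_le_trans _ ts).
  - have d1 s : 0 < s -> derivable (fun s => s `^ a / a) s 1.
      move=> s0; apply: derivableM => //.
      by apply: derivable_powR; rewrite in_itv/= andbT.
    have c1 s : 0 < s -> {for s, continuous (fun s => s `^ a / a)}.
      by move=> s0; apply: differentiable_continuous; apply/derivable1_diffP/d1.
    split.
    + by move=> s; rewrite in_itv/= => /andP[ts _]; apply: d1; rewrite (lt_trans _ ts).
    + by apply: cvg_at_right_filter; exact: c1.
    + by apply: cvg_at_left_filter; exact: c1.
  - move=> s; rewrite in_itv/= => /andP[ts _].
    have s0 : 0 < s by rewrite (lt_trans _ ts).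
    rewrite derive1Mr ?powR_derive1 ?in_itv/= ?andbT//.
      by rewrite mulrAC divff ?mul1r// gt_eqF.
    by apply: derivable_powR; rewrite in_itv/= andbT.
rewrite [X in X @ _](_ : _ = (fun n : nat => (t `^ a / a - (t / n.+2%:R) `^ a / a)%:E));
  last by apply/funext => n; exact: itvE.
apply: cvg_EFin; first exact: nearW.
rewrite /comp/= -[X in _ --> X]subr0; apply: cvgB; first exact: cvg_cst.
rewrite -(mul0r a^-1); apply: cvgM; last exact: cvg_cst.
move/cvg_at_rightP : (powR_cvg0 a0); apply; split=> //.
rewrite -(mulr0 t); apply: cvgM; first exact: cvg_cst.
have := @cvg_harmonic R; rewrite -cvg_shiftS; exact.
Qed.

Lemma conv_theta_pwE a t s : theta (t - s) * pw a s =
  ((fun s => s `^ (a - 1)) \_ `]0, t[) s.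
Proof.
rewrite /theta /pw patchE subr_gt0; case: (ltP s t) => st.
  case: (ltP 0 s) => s0; first by rewrite mul1r ifT// inE/= in_itv/= s0 st.
  by rewrite mulr0 ifF//; apply/negP; rewrite inE/= in_itv/= ltNge s0.
by rewrite mul0r ifF//; apply/negP; rewrite inE/= in_itv/= !ltNge st andbF.
Qed.

Lemma conv_theta_pw (a t : R) : 0 < a ->
  summableR (fun s => theta (t - s) * pw a s) /\
  convol theta (pw a) t = t * pw a t / a.
Proof.
move=> a0.
have ms : measurable_fun setT (fun s : R => theta (t - s) * pw a s).
  by apply: conv_section; [exact: measurable_theta|exact: measurable_pw].
have [t0|t0] := ltP 0 t; last first.
  have E s : theta (t - s) * pw a s = 0.
    rewrite /theta /pw subr_gt0; case: (ltP s t) => st; last by rewrite mul0r.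
    by rewrite ifF ?mulr0// ltNge (le_trans (ltW st)).
  split; last first.
    rewrite /pw ltNge t0/= mulr0 mul0r /convol -[RHS]itg0.
    by congr itg; apply/funext => s; exact: E.
  by apply: eq_integrable summableR0 => // s _ /=; rewrite E.
have E : (\int[mu]_s (theta (t - s) * pw a s)%:E = (t `^ a / a)%:E)%E.
  rewrite -integral_pw_oc// -[RHS]integral_itv_bndo_bndc; last first.
    by apply/measurable_EFinP/measurable_funTS; exact: measurable_powR.
  rewrite [RHS]integral_mkcond; apply: eq_integral => s _.
  by rewrite conv_theta_pwE !patchE; case: ifP.
split.
  apply: summableRP => //.
  under eq_integral do rewrite ger0_norm ?mulr_ge0 ?theta_ge0 ?pw_ge0//.
  by rewrite E ltey.
rewrite /convol /itg /Rintegral E/= /pw t0 mulr_powRB1//; exact: ltW.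
Qed.

Lemma itg_damp_theta m : 0 < m -> summableR (damp m theta) /\
  itg (damp m theta) = m^-1.
Proof.
move=> m0.
have md : measurable_fun setT (damp m theta) by exact: measurable_damp measurable_theta.
have E : (\int[mu]_s (damp m theta s)%:E = (m^-1)%:E)%E.
  transitivity (m^-1%:E * \int[mu]_s (exponential_pdf m s)%:E)%E; last first.
    by rewrite integral_exponential_pdf// mule1.
  rewrite -ge0_integralZl//; last 3 first.
  - by apply/measurable_EFinP; exact: measurable_exponential_pdf.
  - by move=> s _; rewrite lee_fin exponential_pdf_ge0// ltW.
  - by rewrite lee_fin invr_ge0 ltW.
  apply: ae_eq_integral => //.
  - exact/measurable_EFinP.
  - by apply/measurable_EFinP/measurable_funM => //; exact: measurable_exponential_pdf.
  exists [set 0]; split => //; first exact: lebesgue_measure_set1.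
  move=> s /=; apply: contra_notP => /eqP s0 _; rewrite -EFinM; congr EFin.
  rewrite /damp /theta /exponential_pdf patchE; case: ifPn => s1; case: ifPn => //.
  - by move=> _; rewrite mulr1 mulrA mulVf ?gt_eqF// mul1r mulNr.
  - by rewrite notin_setE/= in_itv/= andbT (ltW s1).
  - by rewrite inE/= in_itv/= andbT le_eqVlt eq_sym (negbTE s0) (negbTE s1).
  - by rewrite !mulr0.
split; last by rewrite /itg /Rintegral E.
apply: summableRP => //.
under eq_integral do rewrite ger0_norm ?mulr_ge0 ?theta_ge0 ?expR_ge0//.
by rewrite E ltey.
Qed.

Lemma summable_damp_pw (a m : R) : 0 < a -> a <= 1 -> 0 < m ->
  summableR (damp m (pw a)).
Proof.
move=> a0 a1 m0.
apply: (@summableR_le _ _ (fun s => theta (1 - s) * pw a s + damp m theta s)).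
- exact: measurable_damp (measurable_pw _).
- by apply: summableRD; [exact: (conv_theta_pw 1 a0).1|exact: (itg_damp_theta m0).1].
move=> t; rewrite !ger0_norm; last 2 first.
- by rewrite addr_ge0// mulr_ge0 ?theta_ge0 ?pw_ge0 ?expR_ge0.
- by rewrite mulr_ge0 ?expR_ge0 ?pw_ge0.
rewrite /damp /theta /pw; case: ifPn => t0; last by rewrite !mulr0 addr0.
rewrite mulr1; case: ifPn => t1.
  rewrite mul1r ler_wpDr ?expR_ge0// ler_piMl ?powR_ge0//.
  by rewrite -expR0 ler_expR oppr_le0 mulr_ge0// ltW.
rewrite mul0r add0r ler_piMr ?expR_ge0//.
rewrite subr_gt0 -leNgt in t1.
by rewrite -[leRHS](powRr0 t) ler_powR// subr_le0.
Qed.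

Lemma GammaE (a : R) : Gamma a = itg (damp 1 (pw a)).
Proof.
rewrite /Gamma /itg [LHS]Rintegral_mkcond; congr (Rintegral _ _ _).
apply/funext => t; rewrite patchE /damp /pw; case: ifPn => t0.
  by move: t0; rewrite inE/= in_itv/= andbT => ->; rewrite mul1r mulrC.
by move: t0; rewrite notin_setE/= in_itv/= andbT => /negP/negbTE ->; rewrite mulr0.
Qed.

(** The substitution of t / m for t reduces to the integral defining Gamma. *)
Lemma itg_damp_pw (a m : R) : 0 < a -> a <= 1 -> 0 < m ->
  itg (damp m (pw a)) = m `^ (- a) * Gamma a.
Proof.
move=> a0 a1 m0.
have i0 : 0 < m^-1 by rewrite invr_gt0.
have sm := summable_damp_pw a0 a1 m0.
have e := itg_affine 0 i0 sm; rewrite invrK in e.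
have E t : damp m (pw a) (m^-1 * t + 0) = m^-1 `^ (a - 1) * damp 1 (pw a) t.
  rewrite addr0 /damp pwZ// mulrCA; congr (_ * (expR _ * _)).
  by rewrite mulrA divff ?lt0r_neq0// mul1r.
have {}e : m^-1 `^ (a - 1) * itg (damp 1 (pw a)) = m * itg (damp m (pw a)).
  rewrite -e -itgZ; last exact: summable_damp_pw.
  by congr itg; apply/funext => t; exact/esym.
apply: (mulfI (lt0r_neq0 m0)); rewrite -e GammaE mulrA; congr (_ * _).
have -> : m * m `^ (- a) = m `^ (1 - a).
  by rewrite -[X in X * _](powRr1 (ltW m0)) -powRD ?(gt_eqF m0) ?implybT.
by rewrite -powR_inv1 ?ltW// -powRrM; congr (_ `^ _); ring.
Qed.

(** The integral is at least its part over ]0, 1[, where exp(- t) >= exp(- 1). *)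
Lemma Gamma_gt0 (a : R) : 0 < a -> a <= 1 -> 0 < Gamma a.
Proof.
move=> a0 a1; rewrite GammaE.
have [i1 e1] := conv_theta_pw 1 a0.
have : 0 < expR (-1) * convol theta (pw a) 1.
  by rewrite e1 mulr_gt0 ?expR_gt0// /pw ltr01 powR1 mulr1 divr_gt0.
move=> /lt_le_trans; apply; rewrite -itgZ//.
apply: itg_le; [exact: summableRZ|exact: summable_damp_pw|move=> t].
rewrite /damp /theta subr_gt0 mul1r; case: (ltP t 1) => t1.
  by rewrite mul1r ler_wpM2r ?pw_ge0// ler_expR lerN2 ltW.
by rewrite mul0r mulr0 mulr_ge0 ?pw_ge0 ?expR_ge0.
Qed.

(** A null set cannot contain ]0, 1[. *)
Lemma ae_exists_gt0 (P : R -> Prop) : {ae mu, forall t, P t} -> exists2 t, 0 < t & P t.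
Proof.
move=> [N [mN N0 PN]]; apply: contrapT => nP.
have sub : `]0, 1[%classic `<=` N.
  move=> t; rewrite /= in_itv/= => /andP[t0 _]; apply: PN => /= Pt.
  by apply: nP; exists t.
have : (mu `]0%R, 1%R[ <= mu N)%E by apply: le_measure; rewrite ?inE.
by rewrite N0 lebesgue_measure_itv/= lte_fin ltr01 -EFinB subr0 lee_fin ler10.
Qed.

(** The convolution of two power kernels whose exponents add up to one is
homogeneous of degree zero, hence constant on the half line. *)
Lemma pw_section_scale (a b t r s : R) : a + b = 1 -> 0 < r ->
  pw b (r * t - r * s) * pw a (r * s) = r^-1 * (pw b (t - s) * pw a s).
Proof.
move=> ab r0; rewrite -mulrBr !pwZ// mulrACA; congr (_ * _).
rewrite -powRD ?(gt_eqF r0) ?implybT// -powR_inv1 ?ltW//; congr (_ `^ _).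
by rewrite addrACA (addrC b) ab; ring.
Qed.

Lemma pw_section_summable (a b t t' : R) : a + b = 1 -> 0 < t -> 0 < t' ->
  summableR (fun s => pw b (t - s) * pw a s) ->
  summableR (fun s => pw b (t' - s) * pw a s) /\
  convol (pw b) (pw a) t' = convol (pw b) (pw a) t.
Proof.
move=> ab t0 t'0 st.
pose r := t' / t; have r0 : 0 < r by rewrite divr_gt0.
have rV0 : 0 < r^-1 by rewrite invr_gt0.
have E s : pw b (t' - s) * pw a s =
    r^-1 * (pw b (t - (r^-1 * s + 0)) * pw a (r^-1 * s + 0)).
  rewrite addr0 -pw_section_scale// mulVKf ?gt_eqF//.
  by rewrite /r divfK ?gt_eqF.
have s2 := summableR_affine 0 rV0 st.
split.
  by apply: eq_integrable (summableRZ r^-1 s2) => // s _ /=; rewrite E.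
rewrite /convol; under [X in itg X]eq_fun do rewrite E.
rewrite itgZ// (@itg_affine _ r^-1 0 (fun s => pw b (t - s) * pw a s))//.
by rewrite mulrA divff ?mul1r// invr_eq0 gt_eqF.
Qed.

(** Sections are summable at almost every point by Fubini's theorem, hence at one
positive point, hence at all of them by homogeneity. The constant value is found
by integrating against exp(- t), which factors into two Gamma integrals. *)
Lemma conv_pw (a b t : R) : 0 < a -> 0 < b -> a + b = 1 ->
  summableR (fun s => pw b (t - s) * pw a s) /\
  convol (pw b) (pw a) t = Gamma a * Gamma b * theta t.
Proof.
move=> a0 b0 ab.
have a1 : a <= 1 by lra.
have b1 : b <= 1 by lra.
have sa := summable_damp_pw a0 a1 ltr01; have sb := summable_damp_pw b0 b1 ltr01.
have n1 (x : R) : `|1 : R| <= 1 by rewrite normr1.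
have [_ [ae _]] := @conv_fubini _ _ _ (fun=> 1) 1 sb sa (measurable_cst _) n1.
have [t0 t00 st0] := ae_exists_gt0 ae.
have {}st0 : summableR (fun s => pw b (t0 - s) * pw a s).
  apply: eq_integrable (summableRZ (expR t0) st0) => // s _ /=; congr EFin.
  rewrite /damp; have -> : expR t0 * (1 * (expR (- (1 * (t0 - s))) * pw b (t0 - s) *
     (expR (- (1 * s)) * pw a s))) = (expR t0 * expR (- (1 * (t0 - s))) * expR (- (1 * s)))
     * (pw b (t0 - s) * pw a s) by ring.
  rewrite -!expRD (_ : _ + _ + _ = 0); last by ring.
  by rewrite expR0 mul1r.
have st t' : 0 < t' -> summableR (fun s => pw b (t' - s) * pw a s).
  by move=> t'0; have [] := pw_section_summable ab t00 t'0 st0.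
have ct t' : 0 < t' -> convol (pw b) (pw a) t' = convol (pw b) (pw a) 1.
  by move=> t'0; have [] := pw_section_summable ab ltr01 t'0 (st _ ltr01).
have E0 t' s : t' <= 0 -> pw b (t' - s) * pw a s = 0.
  move=> t'0; rewrite /pw subr_gt0; case: ifPn => st'; last by rewrite mul0r.
  by rewrite ifF ?mulr0//; apply/negbTE; rewrite -leNgt (le_trans (ltW st')).
have c0 t' : t' <= 0 -> convol (pw b) (pw a) t' = 0.
  move=> t'0; rewrite /convol -[RHS]itg0; congr itg; apply/funext => s; exact: E0.
have cE : convol (pw b) (pw a) = fun t => convol (pw b) (pw a) 1 * theta t.
  apply/funext => t'; rewrite /theta; case: ltP => t'0; first by rewrite mulr1 ct.
  by rewrite mulr0 c0.
have BE : convol (pw b) (pw a) 1 = Gamma a * Gamma b.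
  have [e _] := @conv_fubini _ _ _ (fun=> 1) 1 sb sa (measurable_cst _) n1.
  have key : itg (fun t => 1 * convol (damp 1 (pw b)) (damp 1 (pw a)) t) =
      Gamma b * Gamma a.
    apply: (etrans e).
    transitivity (itg (fun s => Gamma b * damp 1 (pw a) s)).
      congr itg; apply/funext => s; rewrite mulrC; congr (_ * _).
      by apply: etrans (esym (GammaE b)); congr itg; apply/funext => r; exact: mul1r.
    by apply: (etrans (itgZ _ sa)); congr (_ * _); exact/esym/GammaE.
  rewrite [RHS]mulrC -key -damp_conv; [|exact: measurable_pw|exact: measurable_pw].
  transitivity (convol (pw b) (pw a) 1 * itg (damp 1 theta)).
    by rewrite -[LHS]mulr1; congr (_ * _); rewrite (itg_damp_theta ltr01).2 invr1.
  rewrite -itgZ; last exact: (itg_damp_theta ltr01).1.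
  congr itg; apply/funext => s; rewrite mul1r /damp [in RHS]cE mulrCA.
  by congr (_ * _); rewrite mulrC.
split; last by rewrite cE BE.
have [t0'|t0'] := ltP 0 t; first exact: st.
by apply: eq_integrable summableR0 => // s _ /=; rewrite E0.
Qed.

Lemma Gamma1 : Gamma (1 : R) = 1.
Proof.
rewrite GammaE -[RHS]invr1 -(itg_damp_theta ltr01).2; congr itg; apply/funext => t.
by rewrite /damp /pw /theta subrr powRr0.
Qed.

Lemma pw1 : pw 1 = theta.
Proof. by apply/funext => t; rewrite /pw /theta subrr powRr0. Qed.

(** * Kernels of fractional integration *)

Definition fker (a t : R) : R := (Gamma a)^-1 * pw a t.

Lemma fker1 : fker 1 = theta.
Proof. by apply/funext => t; rewrite /fker Gamma1 invr1 mul1r pw1. Qed.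

Lemma measurable_fker a : measurable_fun setT (fker a).
Proof. by apply: measurable_funM => //; exact: measurable_pw. Qed.

Lemma fker_ge0 (a t : R) : 0 < a -> a <= 1 -> 0 <= fker a t.
Proof. by move=> a0 a1; rewrite mulr_ge0 ?pw_ge0// invr_ge0 ltW// Gamma_gt0. Qed.

Lemma fker_le0 (a t : R) : t <= 0 -> fker a t = 0.
Proof. by move=> t0; rewrite /fker /pw ltNge t0 mulr0. Qed.

Lemma damp_fker a m : damp m (fker a) = fun t => (Gamma a)^-1 * damp m (pw a) t.
Proof. by apply/funext => t; rewrite /damp /fker mulrCA. Qed.

Lemma summable_damp_fker (a m : R) : 0 < a -> a <= 1 -> 0 < m ->
  summableR (damp m (fker a)).
Proof.
by move=> a0 a1 m0; rewrite damp_fker; apply: summableRZ; exact: summable_damp_pw.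
Qed.

Lemma itg_damp_fker (a m : R) : 0 < a -> a <= 1 -> 0 < m ->
  itg (damp m (fker a)) = m `^ (- a).
Proof.
move=> a0 a1 m0; rewrite damp_fker itgZ; last exact: summable_damp_pw.
by rewrite itg_damp_pw// mulrC mulfK// gt_eqF// Gamma_gt0.
Qed.

Lemma conv_fker (a t : R) : 0 < a -> a < 1 ->
  summableR (fun s => fker (1 - a) (t - s) * fker a s) /\
  convol (fker (1 - a)) (fker a) t = theta t.
Proof.
move=> a0 a1; have b0 : 0 < 1 - a by lra.
have ab : a + (1 - a) = 1 by ring.
have [st ct] := conv_pw t a0 b0 ab.
have E : (fun s => fker (1 - a) (t - s) * fker a s) = fun s =>
   ((Gamma (1 - a))^-1 * (Gamma a)^-1) * (pw (1 - a) (t - s) * pw a s).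
  by apply/funext => s; rewrite /fker mulrACA.
split; first by rewrite E; exact: summableRZ.
rewrite /convol E itgZ// -/(convol _ _ t) ct.
have Ga : Gamma a != 0 by rewrite gt_eqF// Gamma_gt0// ltW.
have b1 : 1 - a <= 1 by lra.
have Gb : Gamma (1 - a) != 0 by rewrite gt_eqF// Gamma_gt0.
move: (Gamma a) (Gamma (1 - a)) Ga Gb => x z x0 z0.
by field; rewrite x0 z0.
Qed.

(** Multiplication by t becomes a convolution with theta, that is division by s
of the transform: this gives the derivative of the transform of the kernel. *)
Lemma conv_theta_fker (a t : R) : 0 < a ->
  summableR (fun s => theta (t - s) * fker a s) /\
  a * convol theta (fker a) t = t * fker a t.
Proof.
move=> a0; have [st ct] := conv_theta_pw t a0.
have E : (fun s => theta (t - s) * fker a s) = fun s =>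
   (Gamma a)^-1 * (theta (t - s) * pw a s).
  by apply/funext => s; rewrite /fker mulrCA.
split; first by rewrite E; exact: summableRZ.
rewrite /convol E itgZ// -/(convol _ _ t) ct /fker.
by rewrite mulrCA [a * _]mulrC divfK ?gt_eqF// mulrCA.
Qed.

End power_kernel.

(** * Primitives of damped densities *)

Section primitives.
Context {R : realType}.
Local Notation mu := (@lebesgue_measure R).
Implicit Types f g h w : R -> R.

Definition prim f : R -> R := convol theta f.

Lemma summable_cut m (T : R) f : 0 <= m -> summableR (damp m f) ->
  summableR (fun s => theta (T - s) * f s).
Proof.
move=> m0 sf.
have mf : measurable_fun setT f by exact: measurable_damped (summableR_measurable sf).
apply: (summableR_le _ (summableRZ (expR (m * T)) sf)).
  by apply: conv_section => //; exact: measurable_theta.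
move=> s; rewrite /damp mulrA -expRD !normrM ler_wpM2r//.
rewrite [leRHS]ger0_norm ?expR_ge0// /theta subr_gt0.
case: ifPn => sT; last by rewrite normr0 expR_ge0.
by rewrite normr1 -expR0 ler_expR subr_ge0 ler_wpM2l// ltW.
Qed.

Lemma summable_damp_norm m f : summableR (damp m f) -> summableR (damp m (fun t => `|f t|)).
Proof.
move=> /summableR_norm; apply: eq_integrable => // t _ /=.
by rewrite /damp normrM ger0_norm ?expR_ge0.
Qed.

Lemma prim_diff m f s t : 0 <= m -> summableR (damp m f) ->
  summableR (fun r => (theta (t - r) - theta (s - r)) * f r) /\
  prim f t - prim f s = itg (fun r => (theta (t - r) - theta (s - r)) * f r).
Proof.
move=> m0 sf; have E : (fun r => (theta (t - r) - theta (s - r)) * f r) =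
    fun r => theta (t - r) * f r - theta (s - r) * f r.
  by apply/funext => r; rewrite mulrBl.
have st := summable_cut t m0 sf; have ss := summable_cut s m0 sf.
by rewrite E; split; [exact: summableRB|rewrite itgB].
Qed.

Lemma le_theta (s t : R) : s <= t -> theta s <= theta t.
Proof.
rewrite /theta; case: (ltP 0 s) => // s0 st; last by case: ifP.
by rewrite (lt_le_trans s0 st).
Qed.

Lemma prim_le m f s t : 0 <= m -> summableR (damp m f) -> s <= t ->
  `|prim f t - prim f s| <= prim (fun r => `|f r|) t - prim (fun r => `|f r|) s.
Proof.
move=> m0 sf st; have [sd ->] := prim_diff s t m0 sf.
have [sd' ->] := prim_diff s t m0 (summable_damp_norm sf).
apply: (le_trans (itg_norm sd)); apply: itg_le => //; first exact: summableR_norm.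
move=> r; rewrite normrM ler_wpM2r// ger0_norm// subr_ge0.
by apply: le_theta; rewrite lerD2r.
Qed.

(** The primitive of |f| serves as a modulus of continuity for that of f. *)
Lemma prim_lip m f s t : 0 <= m -> summableR (damp m f) ->
  `|prim f t - prim f s| <= `|prim (fun r => `|f r|) t - prim (fun r => `|f r|) s|.
Proof.
move=> m0 sf; have [st|/ltW ts] := leP s t.
  by rewrite [leRHS]ger0_norm ?(le_trans _ (prim_le m0 sf st))//; exact: (prim_le m0).
rewrite distrC (distrC (prim _ t)).
by rewrite [leRHS]ger0_norm ?(le_trans _ (prim_le m0 sf ts))//; exact: (prim_le m0).
Qed.

Lemma prim_causal f t : (forall s, s <= 0 -> f s = 0) -> t <= 0 -> prim f t = 0.
Proof.
move=> f0 t0; rewrite /prim /convol -[RHS]itg0; congr itg; apply/funext => s.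
rewrite /theta subr_gt0; case: ifP => st; last by rewrite mul0r.
by rewrite f0 ?mulr0// (le_trans (ltW st)).
Qed.

Lemma itg_set (A : set R) f (h : R -> R) : measurable A ->
  (forall t, h t = (f \_ A) t) -> itg h = \int[mu]_(t in A) f t.
Proof.
move=> mA hE; rewrite /itg [RHS]Rintegral_mkcond; congr Rintegral.
by apply/funext => t; exact: hE.
Qed.

Lemma theta_sub (s t r : R) : s <= t ->
  theta (t - r) - theta (s - r) = \1_(`[s, t[%classic) r.
Proof.
move=> st; rewrite /theta !subr_gt0 indicE; case: (ltP r t) => rt.
  case: (ltP r s) => rs.
    by rewrite subrr memNset//= in_itv/= leNgt rs.
  by rewrite subr0 mem_set//= in_itv/= rs rt.
rewrite ltNge (le_trans st rt) subrr memNset//= in_itv/= [r < t]ltNge rt andbF.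
by [].
Qed.

Lemma prim_diff_set m f (s t T : R) : 0 <= m -> summableR (damp m f) -> s <= t -> t <= T ->
  `|prim f t - prim f s| <= \int[mu]_(r in `[s, t[) `|theta (T - r) * f r|.
Proof.
move=> m0 sf st tT; apply: (le_trans (prim_le m0 sf st)).
have [_ ->] := prim_diff s t m0 (summable_damp_norm sf).
rewrite le_eqVlt; apply/orP; left; apply/eqP; apply: itg_set => // r.
rewrite theta_sub// indicE patchE; case: ifPn => rst; last by rewrite mul0r.
move: rst; rewrite inE/= in_itv/= => /andP[sr rt].
by rewrite mul1r normrM /theta subr_gt0 (lt_le_trans rt tT) normr1 mul1r.
Qed.

Lemma prim_abs_continuity m f (T : R) : 0 <= m -> summableR (damp m f) ->
  forall e, 0 < e -> exists d : R, 0 < d /\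
  forall A, measurable A -> (mu A < d%:E)%E ->
    \int[mu]_(r in A) `|theta (T - r) * f r| < e.
Proof.
move=> m0 sf e e0.
exact: (integral_normr_continuous (summable_cut T m0 sf) e0).
Qed.

Lemma continuous_prim m f : 0 <= m -> summableR (damp m f) -> continuous (prim f).
Proof.
move=> m0 sf t; apply/cvgrPdist_lt => e e0.
have [d [d0 H]] := prim_abs_continuity (t + 1) m0 sf e0.
have d10 : 0 < Num.min d 1 by rewrite lt_min d0 ltr01.
apply: filterS (nbhsx_ballx t _ d10) => s; rewrite /ball/= lt_min => /andP[tsd ts1].
have mu_lt (x z : R) : x <= z -> z - x < d -> (mu `[x, z[ < d%:E)%E.
  move=> xz zx; rewrite lebesgue_measure_itv/= lte_fin; case: ifP => _.
    by rewrite -EFinD lte_fin.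
  by rewrite lte_fin.
have [st|/ltW st] := leP s t.
  have tT : t <= t + 1 by rewrite lerDl.
  apply: (le_lt_trans (prim_diff_set m0 sf st tT)).
  apply: H => //; apply: mu_lt => //; apply: le_lt_trans tsd; exact: ler_norm.
rewrite distrC; have sT : s <= t + 1.
  by rewrite -lerBlDl (le_trans (ler_norm _))// distrC ltW.
apply: (le_lt_trans (prim_diff_set m0 sf st sT)).
apply: H => //; apply: mu_lt => //; apply: le_lt_trans tsd; rewrite distrC; exact: ler_norm.
Qed.

(** Cut the interval at n equidistant values of [V]: the increments of [D] add up to at
most C (V t - V 0)^2 / n. *)
Lemma quadratic_increments (D V : R -> R) (C t : R) : 0 <= t -> continuous V ->
  (forall r s, `|D r - D s| <= C * (V r - V s) ^+ 2) -> D t = D 0.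
Proof.
move=> t0 cV DV.
have C0 : 0 <= C * (V t - V 0) ^+ 2 by exact: le_trans (DV t 0).
suff H (n : nat) : n.+1%:R * `|D t - D 0| <= C * (V t - V 0) ^+ 2.
  apply/eqP; rewrite -subr_eq0 -normr_eq0; apply/eqP/le_anti.
  rewrite normr_ge0 andbT leNgt; apply/negP => e0.
  have := H (Num.truncn (C * (V t - V 0) ^+ 2 / `|D t - D 0|)).
  by rewrite -ler_pdivlMr// leNgt truncnS_gt.
pose v i := V 0 + i%:R / n.+1%:R * (V t - V 0).
have sv (i : nat) : (i <= n.+1)%N -> exists s, V s = v i.
  move=> i_n.
  have cV' : {within `[0, t], continuous V} by exact: continuous_subspaceT.
  suff vin : Num.min (V 0) (V t) <= v i <= Num.max (V 0) (V t).
    by have [s _ sE] := IVT t0 cV' vin; exists s.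
  have i1 : 0 <= (i%:R / n.+1%:R : R) <= 1.
    by rewrite divr_ge0//= ler_pdivrMr// mul1r ler_nat.
  rewrite /v; case/andP: i1; set q := _ / _ => q0 q1.
  have [VV|/ltW VV] := leP (V 0) (V t).
    by apply/andP; split; nra.
  by apply/andP; split; nra.
pose s i := if i == 0%N then 0 else if i == n.+1 then t else
   if pselect (exists s, V s = v i) is left h then projT1 (cid h) else 0.
have Vs i : (i <= n.+1)%N -> V (s i) = v i.
  move=> i_n; rewrite /s; case: eqVneq => [->|i0]; first by rewrite /v mul0r mul0r addr0.
  case: eqVneq => [->|i1]; first by rewrite /v divff// mul1r; ring.
  by case: pselect => [h|/(_ (sv _ i_n))//]; case: (cid h).
have s0 : s 0%N = 0 by rewrite /s eqxx.
have sn : s n.+1 = t by rewrite /s /= eqxx.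
have sum i : (i <= n.+1)%N -> `|D (s i) - D 0| <= i%:R * (C * ((V t - V 0) / n.+1%:R) ^+ 2).
  elim: i => [_|i IH i_n]; first by rewrite s0 subrr normr0 mul0r.
  have -> : D (s i.+1) - D 0 = (D (s i.+1) - D (s i)) + (D (s i) - D 0) by ring.
  rewrite -natr1 mulrDl mul1r; apply: (le_trans (ler_normD _ _)).
  rewrite [leRHS]addrC; apply: lerD; last by apply: IH; exact: ltnW.
  apply: (le_trans (DV _ _)); rewrite !Vs//; last exact: ltnW.
  rewrite le_eqVlt; apply/orP; left; apply/eqP; congr (_ * _ ^+ 2).
  rewrite /v -[i.+1%:R]natr1; have : (n.+1%:R : R) != 0 by rewrite pnatr_eq0.
  by move: (n.+1%:R : R) => N N0; field.
have := sum _ (leqnn n.+1); rewrite sn => H.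
have : n.+1%:R * `|D t - D 0| <= n.+1%:R * (n.+1%:R * (C * ((V t - V 0) / n.+1%:R) ^+ 2)).
  by rewrite ler_pM2l.
move=> /le_trans; apply; rewrite le_eqVlt; apply/orP; left; apply/eqP.
have : (n.+1%:R : R) != 0 by rewrite pnatr_eq0.
by move: (n.+1%:R : R) => N N0; field.
Qed.

(** * The chain rule for C^{1,1} functions *)

(** The derivative d is given along with g, and the first clause is the form in which
it is used: a Taylor bound on increments, without pointwise limits. *)
Definition C11 (L : R) (g d : R -> R) :=
  [/\ forall x y, `|g x - g y - d y * (x - y)| <= L * (x - y) ^+ 2,
      forall x, `|d x| <= L,
      forall x y, `|g x - g y| <= L * `|x - y| &
      forall x y, `|d x - d y| <= L * `|x - y|].

Lemma lipschitz_continuous (L : R) g : (forall x y, `|g x - g y| <= L * `|x - y|) ->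
  continuous g.
Proof.
move=> gL t; apply/cvgrPdist_lt => e e0.
pose L' := `|L| + 1; have L'0 : 0 < L' by rewrite ltr_pwDr.
have eL : 0 < e / L' by rewrite divr_gt0.
apply: filterS (nbhsx_ballx t _ eL) => s; rewrite /ball/= => ts.
apply: (le_lt_trans (gL _ _)); apply: (@le_lt_trans _ _ (L' * `|t - s|)).
  by rewrite ler_wpM2r// /L' (le_trans (ler_norm L))// lerDl.
by rewrite mulrC -ltr_pdivlMr.
Qed.

Lemma C11_continuous L g d : C11 L g d -> continuous g /\ continuous d.
Proof. by move=> [_ _ gL dL]; split; exact: lipschitz_continuous. Qed.

Lemma C11_ge0 L g d : C11 L g d -> 0 <= L.
Proof. by move=> [_ /(_ 0) d0 _ _]; exact: le_trans d0. Qed.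

Lemma damp_bounded m (M : R) w f : measurable_fun setT w -> (forall t, `|w t| <= M) ->
  summableR (damp m f) -> summableR (damp m (fun t => w t * f t)).
Proof.
move=> mw wM sf; apply: eq_integrable (summableR_bounded mw wM sf) => // t _ /=.
by rewrite /damp mulrCA.
Qed.

(** The difference of the two sides has increments quadratic in those of the
primitive of |y|, so [quadratic_increments] applies although y is only summable. *)
Lemma chain_rule L g d m c (y : R -> R) : C11 L g d -> 0 <= m -> summableR (damp m y) ->
  (forall s, s <= 0 -> y s = 0) ->
  forall t, g (c + prim y t) - g c = prim (fun s => d (c + prim y s) * y s) t.
Proof.
move=> gd m0 sy y0 t; have [g2 dL gL ddL] := gd.
have L0 := C11_ge0 gd.
have [_ cd] := C11_continuous gd.
have [t0|/ltW t0] := leP t 0.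
  by rewrite !prim_causal ?addr0 ?subrr// => s s0; rewrite y0// mulr0.
pose u s := c + prim y s; pose V := prim (fun r => `|y r|).
have cu : continuous u.
  by move=> s; apply: cvgD; [exact: cvg_cst|exact: continuous_prim m0 sy _].
have cV : continuous V by exact: continuous_prim m0 (summable_damp_norm sy).
have mdu : measurable_fun setT (fun s => d (u s)).
  by apply: continuous_measurable_fun => s; apply: continuous_comp; [exact: cu|exact: cd].
have sdy : summableR (damp m (fun s => d (u s) * y s)).
  by apply: (damp_bounded mdu _ sy) => s; exact: dL.
pose D s := g (u s) - prim (fun s => d (u s) * y s) s.
suff : D t = D 0.
  rewrite /D /u [prim y 0]prim_causal// [prim _ 0]prim_causal//; last first.
    by move=> s s0; rewrite y0 ?mulr0.
  by rewrite addr0 subr0 => <-; ring.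
apply: (@quadratic_increments D V (L + L) t t0 cV).
have uV s r : `|u s - u r| <= `|V s - V r|.
  by rewrite /u (_ : _ - _ = prim y s - prim y r); [exact: prim_lip m0 sy|ring].
have key r s : r <= s -> `|D s - D r| <= (L + L) * (V s - V r) ^+ 2.
  move=> rs.
  have VV : 0 <= V s - V r.
    by apply: le_trans (prim_le m0 sy rs).
  have -> : D s - D r = (g (u s) - g (u r) - d (u r) * (u s - u r)) -
     ((prim (fun s => d (u s) * y s) s - prim (fun s => d (u s) * y s) r)
       - d (u r) * (u s - u r)) by rewrite /D; ring.
  have sq : (u s - u r) ^+ 2 <= (V s - V r) ^+ 2.
    by rewrite -real_normK ?num_real// ler_sqr ?nnegrE//; have := uV s r; rewrite (ger0_norm VV).
  rewrite (le_trans (ler_normB _ _))// mulrDl; apply: lerD.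
    by apply: (le_trans (g2 _ _)); rewrite ler_wpM2l.
  have [s1 ->] := prim_diff r s m0 sdy.
  have -> : u s - u r = prim y s - prim y r by rewrite /u; ring.
  have [s2 ->] := prim_diff r s m0 sy.
  rewrite -itgZ// -itgB//; last exact: summableRZ.
  have s3 : summableR (fun q => (theta (s - q) - theta (r - q)) * (d (u q) * y q) -
       d (u r) * ((theta (s - q) - theta (r - q)) * y q)).
    by apply: summableRB => //; exact: summableRZ.
  have [s4 e4] := prim_diff r s m0 (summable_damp_norm sy).
  apply: (le_trans (itg_norm s3)).
  have -> : L * (V s - V r) ^+ 2 = (L * (V s - V r)) * itg (fun q =>
      (theta (s - q) - theta (r - q)) * `|y q|) by rewrite -e4 /V; ring.
  rewrite -itgZ//; apply: itg_le; [exact: summableR_norm|exact: summableRZ|move=> q].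
  have -> : (theta (s - q) - theta (r - q)) * (d (u q) * y q) -
       d (u r) * ((theta (s - q) - theta (r - q)) * y q) =
       (theta (s - q) - theta (r - q)) * ((d (u q) - d (u r)) * y q) by ring.
  rewrite theta_sub// indicE; have [|_] := boolP (q \in `[r, s[%classic); last by rewrite !mul0r normr0 mulr0.
  rewrite inE/= in_itv/= => /andP[rq qs].
  rewrite !mul1r normrM ler_wpM2r// (le_trans (ddL _ _))// ler_wpM2l//.
  apply: (le_trans (uV _ _)); rewrite ger0_norm; last by apply: le_trans (prim_le m0 sy rq).
  by rewrite lerD2r -subr_ge0; apply: le_trans (prim_le m0 sy (ltW qs)).
move=> r s; have [rs|/ltW sr] := leP s r; first exact: key.
rewrite distrC (_ : (V r - V s) ^+ 2 = (V s - V r) ^+ 2); last by ring.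
exact: key.
Qed.

End primitives.

(** * Limits in L1 *)

Section L1_limits.
Context {R : realType}.
Local Notation mu := (@lebesgue_measure R).

Lemma dominated_itg (f_ : nat -> R -> R) (f g : R -> R) :
  (forall n, measurable_fun setT (f_ n)) -> measurable_fun setT f ->
  {ae mu, forall t, f_ n t @[n --> \oo] --> f t} -> summableR g ->
  {ae mu, forall t, forall n, `|f_ n t| <= g t} ->
  [/\ summableR f, itg (fun t => `|f_ n t - f t|) @[n --> \oo] --> 0 &
      itg (f_ n) @[n --> \oo] --> itg f].
Proof.
move=> mf_ mf cf sg fg.
have H := @dominated_convergence _ _ _ mu setT measurableT (fun n t => (f_ n t)%:E)
  (fun t => (f t)%:E) (fun t => (g t)%:E).
have [|||||sf c1 c2] := H.
- by move=> n; apply/measurable_EFinP; exact: mf_.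
- exact/measurable_EFinP.
- by apply: (@filterS _ _ (ae_filter_ringOfSetsType mu) _ _ _ cf) => t /= ct _; apply: cvg_EFin; [exact: nearW|exact: ct].
- exact: sg.
- by apply: (@filterS _ _ (ae_filter_ringOfSetsType mu) _ _ _ fg) => t /= ct n _; rewrite lee_fin.
have sf_ n : summableR (f_ n).
  apply/integrableP; split; first by apply/measurable_EFinP; exact: mf_.
  have /integrableP[_] := sg; apply: le_lt_trans; apply: ae_ge0_le_integral => //.
  - by apply: measurableT_comp => //; apply/measurable_EFinP; exact: mf_.
  - by apply: measurableT_comp => //; apply/measurable_EFinP; exact: summableR_measurable.
  - by apply: (@filterS _ _ (ae_filter_ringOfSetsType mu) _ _ _ fg) => t /= ct _; rewrite lee_fin (le_trans (ct n))// ler_norm.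
have c1' : (\int[mu]_t `|(f_ n t)%:E - (f t)%:E|)%E @[n --> \oo] --> (0 : R)%:E by exact: c1.
have c2' : (\int[mu]_t (f_ n t)%:E)%E @[n --> \oo] --> (itg f)%:E by rewrite itgE.
by split=> //; [exact: (fine_cvg c1')|exact: (fine_cvg c2')].
Qed.

(** The sum of the |f_(n+1) - f_n| has a finite integral, so it is finite almost
everywhere and dominates the sequence. The last clause is used to keep limits
causal. *)
Lemma L1_geometric_limit (f_ : nat -> R -> R) (C : R) :
  (forall n, summableR (f_ n)) ->
  (forall n, itg (fun t => `|f_ n.+1 t - f_ n t|) <= C * (2^-1) ^+ n) ->
  exists f, [/\ summableR f, itg (fun t => `|f_ n t - f t|) @[n --> \oo] --> 0 &
    forall t, (forall n, f_ n t = 0) -> f t = 0].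
Proof.
move=> sf fC.
have mf n := summableR_measurable (sf n).
pose d n t := `|f_ n.+1 t - f_ n t|.
have sd n : summableR (d n) by apply: summableR_norm; exact: summableRB.
have d0 n t : 0 <= d n t by exact: normr_ge0.
pose S t := (\sum_(n <oo) (d n t)%:E)%E.
have mS : measurable_fun setT S.
  apply: ge0_emeasurable_sum => [n t _ _|n _]; first by rewrite lee_fin d0.
  by apply/measurable_EFinP; exact: summableR_measurable.
have S0 t : (0 <= S t)%E by apply: nneseries_ge0 => n _ _; rewrite lee_fin.
have SC : (\int[mu]_t S t <= (2 * C)%:E)%E.
  rewrite /S integral_nneseries; [|by []| |]; last 2 first.
  - by move=> n; apply/measurable_EFinP; exact: summableR_measurable.
  - by move=> n t _; rewrite lee_fin d0.
  apply: (@le_trans _ _ (\sum_(n <oo) (C * (2^-1) ^+ n)%:E)%E).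
    apply: lee_nneseries => [n _ _|n _]; first by apply: integral_ge0 => t _; rewrite lee_fin.
    by rewrite -itgE// lee_fin; exact: fC.
  have C0 : 0 <= C.
    have := fC 0%N; rewrite expr0 mulr1; apply: le_trans; exact: itg_ge0.
  apply: lime_le.
    by apply: is_cvg_nneseries => n _ _; rewrite lee_fin mulr_ge0// exprn_ge0// invr_ge0.
  apply: nearW => n; rewrite sumEFin lee_fin.
  have -> : \sum_(0 <= k < n) C * (2^-1) ^+ k = series (geometric C 2^-1) n by [].
  rewrite geometric_seriesE//=; last by rewrite lt_eqF// invf_lt1// ltr1n.
  have -> : 1 - 2^-1 = 2^-1 :> R by lra.
  rewrite invrK mulrC ler_wpM2l// ler_piMr// gerBl exprn_ge0// invr_ge0.
have iS : mu.-integrable setT S.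
  apply/integrableP; split=> //.
  under eq_integral do rewrite gee0_abs//.
  by apply: (le_lt_trans SC); rewrite ltey.
have [sS _] := summableR_fine iS.
have aeS : {ae mu, forall t : R, S t \is a fin_num}.
  by apply: (@filterS _ _ (ae_filter_ringOfSetsType mu) _ _ _ (integrable_ae measurableT iS)) => t /(_ I).
pose f t : R := if S t \is a fin_num then limn (f_ ^~ t) else 0.
have sumS t n : S t \is a fin_num -> \sum_(0 <= k < n) d k t <= fine (S t).
  move=> St; rewrite -lee_fin fineK// -sumEFin.
  by apply: nneseries_lim_ge => k _ _; rewrite lee_fin.
have cf t : S t \is a fin_num -> f_ n t @[n --> \oo] --> f t.
  move=> St; rewrite /f St.
  suff : cvgn (series (telescope (f_ ^~ t))).
    rewrite telescopeK => /(is_cvgD (is_cvg_cst (f_ 0%N t))).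
    rewrite (_ : _ + _ = f_ ^~ t)//.
    by apply/funext => n; rewrite /= !fctE addrC subrK.
  apply: normed_cvg; apply: nondecreasing_is_cvgn.
    by apply/nondecreasing_series => n _ _ /=.
  exists (fine (S t)) => _ [n _ <-]; exact: sumS.
have bf t n : S t \is a fin_num -> `|f_ n t| <= `|f_ 0%N t| + fine (S t).
  move=> St; have -> : f_ n t = f_ 0%N t + \sum_(0 <= k < n) (f_ k.+1 t - f_ k t).
    by rewrite telescope_sumr// addrC subrK.
  rewrite (le_trans (ler_normD _ _))// lerD2l (le_trans (ler_norm_sum _ _ _))//.
  exact: sumS.
have mE : measurable [set t : R | S t \is a fin_num].
  by have := emeasurable_fin_num measurableT mS; rewrite setTI.
have mf0 : measurable_fun setT f.
  apply: (@measurable_fun_cvg _ (measurableTypeR R) R setT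
    (fun n t => \1_[set t : R | S t \is a fin_num] t * f_ n t)).
    by move=> n; apply: measurable_funM; [exact: measurable_indic|exact: mf].
  move=> t _; have [St|St] := boolP (S t \is a fin_num).
    rewrite (_ : (fun n => _) = f_ ^~ t); first exact: cf.
    by apply/funext => n; rewrite indicE mem_set// mul1r.
  rewrite (_ : (fun n => _) = fun=> 0).
    by rewrite /f (negbTE St); exact: cvg_cst.
  by apply/funext => n; rewrite indicE memNset ?mul0r//= => St'; rewrite St' in St.
exists f.
have [|||s1 c1 _] := @dominated_itg f_ f (fun t => `|f_ 0%N t| + fine (S t)) mf mf0.
- by apply: (@filterS _ _ (ae_filter_ringOfSetsType mu) _ _ _ aeS) => t St; exact: cf.
- by apply: summableRD => //; exact: summableR_norm.
- by apply: (@filterS _ _ (ae_filter_ringOfSetsType mu) _ _ _ aeS) => t St n; exact: bf.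
split => // t f0; rewrite /f; case: ifP => // _.
rewrite (_ : f_ ^~ t = fun=> 0); last by apply/funext => n; exact: f0.
exact: lim_cst.
Qed.
End L1_limits.

(** * Weighted norms of causal functions *)

Section weighted.
Context {R : realType}.
Local Notation mu := (@lebesgue_measure R).
Implicit Types f g h w : R -> R.

Definition causal f := forall s : R, s <= 0 -> f s = 0.

Lemma wnorm_le m f g : measurable_fun setT f -> summableR (damp m g) ->
  (forall t, `|f t| <= g t) -> summableR (damp m f) /\ wnorm m f <= itg (damp m g).
Proof.
move=> mf sg fg; have fg' t : `|damp m f t| <= damp m g t.
  by rewrite /damp normrM ger0_norm ?expR_ge0// ler_wpM2l// expR_ge0.
have sf : summableR (damp m f).
  apply: summableR_le sg _; first exact: measurable_damp.
  by move=> t; rewrite (le_trans (fg' t))// ler_norm.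
by split=> //; apply: itg_le => //; exact: summableR_norm.
Qed.

Lemma wnormE m f : wnorm m f = itg (damp m (fun t => `|f t|)).
Proof.
by congr itg; apply/funext => t; rewrite /damp normrM ger0_norm ?expR_ge0.
Qed.

Lemma wnorm_ge0 m f : 0 <= wnorm m f.
Proof. by apply: itg_ge0. Qed.

Lemma dampD m f g : damp m (fun t => f t + g t) = fun t => damp m f t + damp m g t.
Proof. by apply/funext => t; rewrite /damp mulrDr. Qed.

Lemma dampZ m r f : damp m (fun t => r * f t) = fun t => r * damp m f t.
Proof. by apply/funext => t; rewrite /damp mulrCA. Qed.

Lemma summable_dampD m f g : summableR (damp m f) -> summableR (damp m g) ->
  summableR (damp m (fun t => f t + g t)).
Proof. by move=> sf sg; rewrite dampD; exact: summableRD. Qed.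

Lemma summable_dampZ m r f : summableR (damp m f) -> summableR (damp m (fun t => r * f t)).
Proof. by move=> sf; rewrite dampZ; exact: summableRZ. Qed.

Lemma summable_dampB m f g : summableR (damp m f) -> summableR (damp m g) ->
  summableR (damp m (fun t => f t - g t)).
Proof.
move=> sf sg; rewrite (_ : (fun t => _) = fun t => f t + (-1) * g t).
  by apply: summable_dampD => //; exact: summable_dampZ.
by apply/funext => t; rewrite mulN1r.
Qed.

Lemma wnormZ m r f : summableR (damp m f) -> wnorm m (fun t => r * f t) = `|r| * wnorm m f.
Proof.
move=> sf; rewrite /wnorm dampZ -itgZ; last exact: summableR_norm.
by congr itg; apply/funext => t; rewrite normrM.
Qed.

Lemma wnormD m f g : summableR (damp m f) -> summableR (damp m g) ->
  wnorm m (fun t => f t + g t) <= wnorm m f + wnorm m g.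
Proof.
move=> sf sg; rewrite /wnorm dampD -itgD; try exact: summableR_norm.
apply: itg_le => [| |t]; [exact/summableR_norm/summableRD| |exact: ler_normD].
by apply: summableRD; exact: summableR_norm.
Qed.

Lemma damp_shift m (tau : R) f : damp m (fun t => f (t - tau)) =
  fun t => expR (- (m * tau)) * damp m f (t - tau).
Proof.
by apply/funext => t; rewrite /damp mulrA -expRD; congr (expR _ * _); ring.
Qed.

Lemma summable_damp_shift m (tau : R) f : summableR (damp m f) ->
  summableR (damp m (fun t => f (t - tau))).
Proof. by move=> sf; rewrite damp_shift; apply: summableRZ; exact: summableR_shift. Qed.

Lemma wnorm_shift m (tau : R) f : 0 <= m -> 0 <= tau -> summableR (damp m f) ->
  wnorm m (fun t => f (t - tau)) <= wnorm m f.
Proof.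
move=> m0 t0 sf; rewrite /wnorm damp_shift.
have -> : (fun t => `|expR (- (m * tau)) * damp m f (t - tau)|) =
   fun t => expR (- (m * tau)) * `|damp m f (t - tau)|.
  by apply/funext => t; rewrite normrM ger0_norm ?expR_ge0.
rewrite itgZ; last exact/summableR_norm/summableR_shift.
rewrite (@itg_shift _ (fun t => `|damp m f t|)); last first.
  by apply: summableR_measurable; exact: summableR_norm.
rewrite ler_piMl ?wnorm_ge0// -expR0 ler_expR oppr_le0; exact: mulr_ge0.
Qed.

(** Only positive times count, and there the weight decreases with m. *)
Lemma wnorm_causal_le m m' f : causal f -> m <= m' -> summableR (damp m f) ->
  summableR (damp m' f) /\ wnorm m' f <= wnorm m f.
Proof.
move=> f0 mm sf.
have mf : measurable_fun setT f by exact: measurable_damped (summableR_measurable sf).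
have le t : `|damp m' f t| <= `|damp m f t|.
  have [t0|t0] := leP t 0; first by rewrite /damp f0 ?mulr0.
  rewrite /damp !normrM ler_wpM2r// !ger0_norm ?expR_ge0// ler_expR lerN2.
  by rewrite ler_wpM2r// ltW.
have s' : summableR (damp m' f) by apply: summableR_le le => //; exact: measurable_damp.
by split=> //; apply: itg_le => //; exact: summableR_norm.
Qed.

Lemma prim_wnorm m f t : 0 <= m -> summableR (damp m f) ->
  `|prim f t| <= expR (m * t) * wnorm m f.
Proof.
move=> m0 sf; have sc := summable_cut t m0 sf.
apply: (le_trans (itg_norm sc)); rewrite /wnorm -itgZ; last exact: summableR_norm.
apply: itg_le; [exact: summableR_norm|exact/summableRZ/summableR_norm|move=> s].
rewrite /damp !normrM mulrA [`|expR _|]ger0_norm ?expR_ge0// -expRD ler_wpM2r//.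
rewrite ger0_norm ?theta_ge0// /theta subr_gt0; case: ifPn => st; last exact: expR_ge0.
by rewrite -expR0 ler_expR subr_ge0 ler_wpM2l// ltW.
Qed.

Lemma primD m f g t : 0 <= m -> summableR (damp m f) -> summableR (damp m g) ->
  prim (fun s => f s + g s) t = prim f t + prim g t.
Proof.
move=> m0 sf sg; rewrite /prim /convol -itgD; try exact: (summable_cut _ m0).
by congr itg; apply/funext => s; rewrite mulrDr.
Qed.

Lemma primZ r f t : measurable_fun setT f ->
  prim (fun s => r * f s) t = r * prim f t.
Proof.
move=> mf; rewrite /prim /convol -itgMl; last exact: conv_section measurable_theta mf.
by congr itg; apply/funext => s; rewrite mulrCA.
Qed.

Lemma primB m f g t : 0 <= m -> summableR (damp m f) -> summableR (damp m g) ->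
  prim (fun s => f s - g s) t = prim f t - prim g t.
Proof.
move=> m0 sf sg; rewrite /prim /convol -itgB; try exact: (summable_cut _ m0).
by congr itg; apply/funext => s; rewrite mulrBr.
Qed.

Lemma prim_shift (tau t : R) f : measurable_fun setT f ->
  prim (fun s => f (s - tau)) t = prim f (t - tau).
Proof.
move=> mf; rewrite /prim /convol -[RHS](@itg_shift _ _ tau); last first.
  exact: conv_section measurable_theta mf.
by congr itg; apply/funext => s; congr (theta _ * _); ring.
Qed.

Lemma conv_causal f g : causal f -> causal g -> causal (convol f g).
Proof.
move=> f0 g0 t t0; rewrite /convol -[RHS]itg0; congr itg; apply/funext => s.
have [s0|s0] := leP s 0; first by rewrite g0 ?mulr0.
by rewrite f0 ?mul0r// subr_le0 (le_trans t0)// ltW.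
Qed.

(** Fubini's theorem needs a summable bound although h is only summable with a
weight: as f * g is nondecreasing, its value at t - r is at most its value at t. *)
Lemma conv_assoc_causal f g h m t :
  measurable_fun setT f -> measurable_fun setT g ->
  (forall s, 0 <= f s) -> (forall s, 0 <= g s) ->
  (forall t, summableR (fun s => f (t - s) * g s)) ->
  (forall s t, s <= t -> convol f g s <= convol f g t) -> causal (convol f g) ->
  0 <= m -> summableR (damp m h) -> causal h ->
  convol f (convol g h) t = convol (convol f g) h t /\
  summableR (fun s => f (t - s) * convol g h s).
Proof.
move=> mf mg f0 g0 fg nd c0 m0 sh h0.
have mh : measurable_fun setT h by exact: measurable_damped (summableR_measurable sh).
have E r : (fun s => f (t - s) * g (s - r) * h r) =
    fun s => h r * (fun s => f (t - r - s) * g s) (s - r).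
  by apply/funext => s /=; rewrite mulrC; congr (_ * (f _ * _)); ring.
have ss r : summableR (fun s => (fun s => f (t - r - s) * g s) (s - r)).
  exact: (@summableR_shift _ (fun s => f (t - r - s) * g s)).
apply: (@conv_assoc _ f g h t (fun r => convol f g t * `|theta (t - r) * h r|) mf mg mh).
- by move=> r; rewrite E; exact: summableRZ.
- by apply: summableRZ; apply: summableR_norm; exact: (summable_cut t m0 sh).
move=> r.
have -> : (fun s => `|f (t - s) * g (s - r) * h r|) =
   fun s => `|h r| * (fun s => f (t - r - s) * g s) (s - r).
  apply/funext => s /=; rewrite normrM mulrC [X in _ * X]ger0_norm ?mulr_ge0//.
  by congr (_ * (f _ * _)); ring.
rewrite itgZ// (@itg_shift _ (fun s => f (t - r - s) * g s)); last exact: conv_section.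
rewrite -/(convol f g (t - r)).
have [r0|r0] := leP r 0; first by rewrite h0 ?mulr0 ?normr0 ?mul0r ?mulr0.
rewrite normrM mulrC mulrA ler_wpM2r//.
rewrite /theta subr_gt0; case: ltP => rt.
  by rewrite normr1 mulr1; apply: nd; rewrite gerBl ltW.
by rewrite c0 ?subr_le0// normr0 mulr0.
Qed.

End weighted.

(** * Existence for the delayed fractional equation *)

Section picard.
Context {R : realType}.
Local Notation mu := (@lebesgue_measure R).
Variables (a tau c L : R) (g1 d1 g2 d2 : R -> R).
Hypotheses (a0 : 0 < a) (a1 : a <= 1) (tau0 : 0 <= tau).
Hypotheses (G1 : C11 L g1 d1) (G2 : C11 L g2 d2).
Implicit Types y : R -> R.
Local Notation k := (fker a).

(** The unknown is the density y of the derivative, so that all states are absolutely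
continuous by construction. *)
Definition state y (t : R) : R := c + prim y t.

Definition delayed_rhs y (t : R) : R :=
  theta t * (g1 (state y t) + g2 (state y (t - tau))).

(** This is the derivative of [delayed_rhs] on positive times, see [delayed_rhsE]. *)
Definition rhs_derivative y (t : R) : R :=
  d1 (state y t) * y t + d2 (state y (t - tau)) * y (t - tau).

(** The derivative of the integral equation u = c + k * h; the jump of h at 0
contributes the multiple of k. *)
Definition picard y (t : R) : R :=
  (g1 c + g2 c) * k t + convol k (rhs_derivative y) t.

Definition admissible m y := causal y /\ summableR (damp m y).

Let L0 : 0 <= L := C11_ge0 G1.

Let mk : measurable_fun setT k := measurable_fker a.

Let kge0 s : 0 <= k s.
Proof. exact: fker_ge0. Qed.

Lemma fker_causal : causal k.
Proof. by move=> s s0; exact: fker_le0. Qed.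

Lemma fker_theta_comm : convol k theta = prim k.
Proof. by rewrite conv_comm//; exact: measurable_theta. Qed.

Lemma norm_fker : (fun s => `|k s|) = k.
Proof. by apply/funext => s; rewrite ger0_norm. Qed.

Lemma prim_fker_nd s t : s <= t -> prim k s <= prim k t.
Proof.
move=> st; rewrite -subr_ge0.
have := prim_le ler01 (summable_damp_fker a0 a1 ltr01) st.
by rewrite norm_fker; exact: le_trans.
Qed.

Lemma prim_fker_causal : causal (prim k).
Proof. by move=> t; apply: prim_causal; exact: fker_causal. Qed.

Lemma summable_theta_fker t : summableR (fun s => theta (t - s) * k s).
Proof. exact: (conv_theta_fker t a0).1. Qed.

Lemma summable_fker_theta t : summableR (fun s => k (t - s) * theta s).
Proof.
apply: eq_integrable (summableR_refl t (summable_theta_fker t)) => // s _ /=.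
by rewrite subKr mulrC.
Qed.

Lemma causal_theta : causal (@theta R).
Proof. by move=> s s0; rewrite /theta ltNge s0. Qed.

(** Both sides are theta * k * h, by associativity and commutativity. *)
Lemma prim_conv_fker m h t : 0 <= m -> summableR (damp m h) -> causal h ->
  prim (convol k h) t = convol k (prim h) t /\
  summableR (fun s => k (t - s) * prim h s).
Proof.
move=> m0 sh h0.
have th0 (s : R) : 0 <= theta s by exact: theta_ge0.
have [e1 _] := conv_assoc_causal t measurable_theta mk th0 kge0 summable_theta_fker
  prim_fker_nd prim_fker_causal m0 sh h0.
have nd s r : s <= r -> convol k theta s <= convol k theta r.
  by rewrite fker_theta_comm; exact: prim_fker_nd.
have cc : causal (convol k theta) by rewrite fker_theta_comm; exact: prim_fker_causal.
have [e2 s2] := conv_assoc_causal t mk measurable_theta kge0 th0 summable_fker_theta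
  nd cc m0 sh h0.
split; last exact: s2.
by rewrite /prim e1 -/(prim k) -fker_theta_comm -e2.
Qed.

Lemma continuous_state m y : 0 <= m -> summableR (damp m y) -> continuous (state y).
Proof.
by move=> m0 sy t; apply: cvgD; [exact: cvg_cst|exact: continuous_prim m0 sy _].
Qed.

Lemma continuous_comp_measurable (f g : R -> R) : continuous f -> continuous g ->
  measurable_fun setT (fun s => g (f s)).
Proof.
move=> cf cg; apply: continuous_measurable_fun => s.
by apply: continuous_comp; [exact: cf|exact: cg].
Qed.

Lemma rhs_derivative_damp m y : 0 <= m -> admissible m y ->
  [/\ causal (rhs_derivative y), summableR (damp m (rhs_derivative y)) &
      wnorm m (rhs_derivative y) <= 2 * L * wnorm m y].
Proof.
move=> m0 [y0 sy].
have cu := continuous_state m0 sy.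
have [_ c1] := C11_continuous G1; have [_ c2] := C11_continuous G2.
have [_ b1 _ _] := G1; have [_ b2 _ _] := G2.
have my : measurable_fun setT y by exact: measurable_damped (summableR_measurable sy).
have mu1 := continuous_comp_measurable cu c1.
have mu2 := measurable_shift tau (continuous_comp_measurable cu c2).
have s1 := damp_bounded mu1 (fun t => b1 _) sy.
have sy2 := summable_damp_shift tau sy.
have s2 := damp_bounded mu2 (fun t => b2 _) sy2.
have W (w f : R -> R) : measurable_fun setT w -> (forall t, `|w t| <= L) ->
    summableR (damp m f) -> wnorm m (fun t => w t * f t) <= L * wnorm m f.
  move=> mw wL sf; rewrite [X in _ * X]wnormE -itgZ; last exact: summable_damp_norm.
  rewrite -dampZ; apply: (wnorm_le _ _ _).2 => [| |t].
  - apply: measurable_funM => //; exact: measurable_damped (summableR_measurable sf).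
  - by apply: summable_dampZ; exact: summable_damp_norm.
  - by rewrite normrM ler_wpM2r.
split.
- move=> s s0; rewrite /rhs_derivative !y0 ?mulr0 ?addr0// lerBlDr add0r.
  exact: le_trans tau0.
- exact: summable_dampD.
apply: (le_trans (wnormD s1 s2)); rewrite mulr_natl mulr2n mulrDl; apply: lerD.
  by apply: W.
apply: (le_trans (W _ _ mu2 (fun t => b2 _) sy2)).
by apply: ler_wpM2l => //; exact: wnorm_shift.
Qed.

Lemma delayed_rhsE m y t : 0 <= m -> admissible m y ->
  delayed_rhs y t = (g1 c + g2 c) * theta t + prim (rhs_derivative y) t.
Proof.
move=> m0 ay; have [y0 sy] := ay.
have [rc rs _] := rhs_derivative_damp m0 ay.
have [t0|t0] := leP t 0.
  by rewrite /delayed_rhs prim_causal// /theta ltNge t0/= mul0r mulr0 addr0.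
rewrite /delayed_rhs /theta t0 mul1r mulr1.
have cu := continuous_state m0 sy.
have [_ c1] := C11_continuous G1; have [_ c2] := C11_continuous G2.
have [_ b1 _ _] := G1; have [_ b2 _ _] := G2.
have mu1 := continuous_comp_measurable cu c1.
have mu2 := continuous_comp_measurable cu c2.
have s1 := damp_bounded mu1 (fun t => b1 _) sy.
have s2 := damp_bounded mu2 (fun t => b2 _) sy.
have s3 := summable_damp_shift tau s2.
have e1 := chain_rule c G1 m0 sy y0 t.
have e2 := chain_rule c G2 m0 sy y0 (t - tau).
have e3 := prim_shift tau t (measurable_damped (summableR_measurable s2)).
have -> : prim (rhs_derivative y) t = prim (fun s => d1 (c + prim y s) * y s) t +
    prim (fun s => d2 (c + prim y (s - tau)) * y (s - tau)) t.
  exact: (primD t m0 s1 s3).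
by rewrite e3 -e1 -e2 /state; ring.
Qed.

Lemma admissible_picard m y : 0 < m -> admissible m y ->
  admissible m (picard y) /\
  wnorm m (picard y) <= wnorm m k * (`|g1 c + g2 c| + 2 * L * wnorm m y).
Proof.
move=> m0 ay; have [rc rs rw] := rhs_derivative_damp (ltW m0) ay.
have sk := summable_damp_fker a0 a1 m0.
have s1 := summable_dampZ (g1 c + g2 c) sk.
have s2 := wsummable_conv sk rs.
split; first split.
- move=> s s0; rewrite /picard fker_le0// mulr0 add0r.
  by apply: conv_causal => //; exact: fker_causal.
- exact: summable_dampD.
apply: (le_trans (wnormD s1 s2)); rewrite wnormZ// mulrDr; apply: lerD.
  by rewrite mulrC.
apply: (le_trans (wnorm_conv sk rs)); apply: ler_wpM2l => //; exact: wnorm_ge0.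
Qed.

Lemma prim_picard m y t : 0 < m -> admissible m y ->
  prim (picard y) t = convol k (delayed_rhs y) t /\
  summableR (fun s => k (t - s) * delayed_rhs y s).
Proof.
move=> m0 ay; have [rc rs rw] := rhs_derivative_damp (ltW m0) ay.
have sk := summable_damp_fker a0 a1 m0.
have s1 := summable_dampZ (g1 c + g2 c) sk.
have s2 := wsummable_conv sk rs.
have [e2 s3] := prim_conv_fker t (ltW m0) rs rc.
have E : (fun s => k (t - s) * delayed_rhs y s) = fun s =>
   (g1 c + g2 c) * (k (t - s) * theta s) + k (t - s) * prim (rhs_derivative y) s.
  by apply/funext => s; rewrite (delayed_rhsE _ (ltW m0) ay) mulrDr mulrCA.
have s4 := summableRZ (g1 c + g2 c) (summable_fker_theta t).
split; last by rewrite E; exact: summableRD.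
rewrite (primD t (ltW m0) s1 s2) primZ// e2.
rewrite [RHS]/convol E itgD// itgZ; last exact: summable_fker_theta.
by rewrite -/(convol k theta t) fker_theta_comm.
Qed.


Lemma delayed_rhs_diff m E y z s : 0 <= m -> 0 <= E ->
  (forall t, `|prim y t - prim z t| <= E * expR (m * t)) ->
  `|delayed_rhs y s - delayed_rhs z s| <= 2 * L * E * expR (m * s).
Proof.
move=> m0 E0 yz; have [_ _ l1 _] := G1; have [_ _ l2 _] := G2.
rewrite /delayed_rhs -mulrBr normrM (ger0_norm (theta_ge0 _)).
apply: (@le_trans _ _ `|g1 (state y s) + g2 (state y (s - tau)) -
   (g1 (state z s) + g2 (state z (s - tau)))|).
  by rewrite ler_piMl// /theta; case: ifP.
have -> : g1 (state y s) + g2 (state y (s - tau)) - (g1 (state z s) + g2 (state z (s - tau)))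
   = (g1 (state y s) - g1 (state z s)) + (g2 (state y (s - tau)) - g2 (state z (s - tau))).
  by ring.
have D r : state y r - state z r = prim y r - prim z r by rewrite /state; ring.
apply: (le_trans (ler_normD _ _)).
have -> : 2 * L * E * expR (m * s) = L * (E * expR (m * s)) + L * (E * expR (m * s)) by ring.
apply: lerD.
  by apply: (le_trans (l1 _ _)); rewrite D ler_wpM2l.
apply: (le_trans (l2 _ _)); rewrite D ler_wpM2l//.
apply: (le_trans (yz _)); rewrite ler_wpM2l// ler_expR ler_wpM2l//.
by rewrite lerBlDr lerDl.
Qed.

Lemma prim_picard_diff m E y z t : 0 < m -> 0 <= E -> admissible m y -> admissible m z ->
  (forall t, `|prim y t - prim z t| <= E * expR (m * t)) ->
  `|prim (picard y) t - prim (picard z) t| <= wnorm m k * (2 * L * E) * expR (m * t).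
Proof.
move=> m0 E0 ay az yz.
have [-> s1] := prim_picard t m0 ay; have [-> s2] := prim_picard t m0 az.
rewrite /convol -itgB//; have s3 := summableRB s1 s2.
have sk := summable_damp_fker a0 a1 m0.
have sk' := summableR_refl t sk.
apply: (le_trans (itg_norm s3)).
have -> : wnorm m k * (2 * L * E) * expR (m * t) =
    (2 * L * E * expR (m * t)) * itg (fun s => damp m k (t - s)).
  rewrite itg_refl; last exact: summableR_measurable.
  by rewrite wnormE norm_fker; ring.
rewrite -itgZ//; apply: itg_le; [exact: summableR_norm|exact: summableRZ|move=> s].
rewrite -mulrBr normrM (ger0_norm (kge0 _)) /damp.
have -> : 2 * L * E * expR (m * t) * (expR (- (m * (t - s))) * k (t - s)) =
   k (t - s) * (2 * L * E * (expR (m * t) * expR (- (m * (t - s))))) by ring.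
rewrite -expRD; apply: ler_wpM2l => //.
have -> : m * t - m * (t - s) = m * s by ring.
exact: delayed_rhs_diff (ltW m0) E0 yz.
Qed.

(** The coefficients of y depend on the state, and the difference of two states grows
like exp(m t): the norm on the left has the doubled weight to absorb this factor. *)
Lemma rhs_derivative_diff m E y z : 0 <= m -> 0 <= E -> admissible m y -> admissible m z ->
  (forall t, `|prim y t - prim z t| <= E * expR (m * t)) ->
  wnorm (m + m) (fun t => rhs_derivative y t - rhs_derivative z t) <=
  2 * L * (wnorm (m + m) (fun t => y t - z t) + E * wnorm m z).
Proof.
move=> m0 E0 [y0 sy] [z0 sz] yz.
have mm : m <= m + m by rewrite lerDl.
have mm0 : 0 <= m + m by exact: addr_ge0.
have [sy' _] := wnorm_causal_le y0 mm sy; have [sz' _] := wnorm_causal_le z0 mm sz.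
have [_ sry _] := rhs_derivative_damp mm0 (conj y0 sy').
have [_ srz _] := rhs_derivative_damp mm0 (conj z0 sz').
pose q t := expR (m * t) * `|z t|.
have qE : damp (m + m) q = damp m (fun t => `|z t|).
  apply/funext => t; rewrite /damp /q mulrA -expRD; congr (expR _ * _); ring.
have sq : summableR (damp (m + m) q) by rewrite qE; exact: summable_damp_norm.
pose B t := L * (`|y t - z t| + E * q t).
have sf := summable_damp_norm (summable_dampB sy' sz').
have sB : summableR (damp (m + m) B).
  by apply: summable_dampZ; apply: summable_dampD => //; exact: summable_dampZ.
have sB' := summable_damp_shift tau sB.
have B0 t : 0 <= B t.
  by rewrite mulr_ge0// addr_ge0// mulr_ge0// mulr_ge0// expR_ge0.
have BE : wnorm (m + m) B = L * (wnorm (m + m) (fun t => y t - z t) + E * wnorm m z).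
  have -> : wnorm (m + m) B = itg (damp (m + m) B).
    by rewrite wnormE; congr (itg (damp _ _)); apply/funext => t; rewrite ger0_norm.
  rewrite /B dampZ itgZ; last first.
    by apply: summable_dampD => //; exact: summable_dampZ.
  rewrite dampD dampZ itgD//; last exact: summableRZ.
  by rewrite itgZ// qE -!wnormE.
have le : forall t, `|rhs_derivative y t - rhs_derivative z t| <= B t + B (t - tau).
  have [_ b1 _ l1] := G1; have [_ b2 _ l2] := G2.
  move=> t; rewrite /rhs_derivative.
  have D r : state y r - state z r = prim y r - prim z r by rewrite /state; ring.
  have key (d : R -> R) r : (forall x, `|d x| <= L) ->
     (forall x x', `|d x - d x'| <= L * `|x - x'|) ->
     `|d (state y r) * y r - d (state z r) * z r| <= B r.
    move=> bd ld.
    have -> : d (state y r) * y r - d (state z r) * z r =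
      d (state y r) * (y r - z r) + (d (state y r) - d (state z r)) * z r by ring.
    apply: (le_trans (ler_normD _ _)); rewrite !normrM /B mulrDr; apply: lerD.
      by rewrite ler_wpM2r.
    rewrite /q !mulrA ler_wpM2r// -mulrA (le_trans (ld _ _))// D ler_wpM2l//.
  have -> : forall x1 x2 x3 x4 : R, x1 + x2 - (x3 + x4) = (x1 - x3) + (x2 - x4).
    by move=> *; ring.
  by apply: (le_trans (ler_normD _ _)); apply: lerD; exact: key.
have sd := summable_dampB sry srz.
have md := measurable_damped (summableR_measurable sd).
have sBB := summable_dampD sB sB'.
apply: (le_trans (wnorm_le md sBB le).2).
rewrite dampD itgD//.
have wB : itg (damp (m + m) B) = wnorm (m + m) B.
  by rewrite wnormE; congr (itg (damp _ _)); apply/funext => t; rewrite ger0_norm.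
have wB' : itg (damp (m + m) (fun t => B (t - tau))) = wnorm (m + m) (fun t => B (t - tau)).
  by rewrite wnormE; congr (itg (damp _ _)); apply/funext => t; rewrite ger0_norm.
rewrite -mulrA -BE mulr_natl mulr2n wB wB'; apply: lerD => //.
exact: wnorm_shift.
Qed.

Lemma itg_ae f g : measurable_fun setT f -> measurable_fun setT g ->
  {ae mu, forall t, f t = g t} -> itg f = itg g.
Proof.
move=> mf mg fg; congr fine; apply: ae_eq_integral => //; try exact/measurable_EFinP.
by apply: (@filterS _ _ (ae_filter_ringOfSetsType mu) _ _ _ fg) => t /= ->.
Qed.

Lemma itg_norm_eq0 f : summableR f -> itg (fun t => `|f t|) = 0 ->
  {ae mu, forall t, f t = 0}.
Proof.
move=> sf f0.
have mf : measurable_fun [set: measurableTypeR R] (fun t : R => (f t)%:E).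
  by apply/measurable_EFinP; exact: summableR_measurable.
have [H _] := ae_eq_integral_abs mu measurableT mf.
have := H; rewrite -itg_normE// f0 => /(_ erefl).
apply: (@filterS _ _ (ae_filter_ringOfSetsType mu)) => t /(_ I) /=.
by move=> [].
Qed.

Lemma undamp_section m t s (f g : R -> R) :
  expR (m * t) * (1 * (damp m f (t - s) * damp m g s)) = f (t - s) * g s.
Proof.
rewrite /damp; have -> : expR (m * t) * (1 * (expR (- (m * (t - s))) * f (t - s) *
    (expR (- (m * s)) * g s))) = (expR (m * t) * expR (- (m * (t - s))) * expR (- (m * s)))
     * (f (t - s) * g s) by ring.
rewrite -!expRD (_ : _ + _ + _ = 0); last by ring.
by rewrite expR0 mul1r.
Qed.

Lemma picard_diff m E y z : 0 < m -> 0 <= E -> admissible m y -> admissible m z ->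
  (forall t, `|prim y t - prim z t| <= E * expR (m * t)) ->
  wnorm (m + m) (fun t => picard y t - picard z t) <=
  wnorm m k * (2 * L * (wnorm (m + m) (fun t => y t - z t) + E * wnorm m z)).
Proof.
move=> m0 E0 ay az yz.
have [[y0 sy] [z0 sz]] := (ay, az).
have mm : m <= m + m by rewrite lerDl ltW.
have mm0 : 0 < m + m by exact: addr_gt0.
have [sy' _] := wnorm_causal_le y0 mm sy; have [sz' _] := wnorm_causal_le z0 mm sz.
have [_ sry _] := rhs_derivative_damp (ltW mm0) (conj y0 sy').
have [_ srz _] := rhs_derivative_damp (ltW mm0) (conj z0 sz').
have sk := summable_damp_fker a0 a1 mm0.
have [_ wk] := wnorm_causal_le fker_causal mm (summable_damp_fker a0 a1 m0).
have le := rhs_derivative_diff (ltW m0) E0 ay az yz.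
have sd := summable_dampB sry srz.
apply: (@le_trans _ _ (wnorm (m + m) k * wnorm (m + m)
   (fun t => rhs_derivative y t - rhs_derivative z t))); last first.
  by apply: ler_pM => //; exact: wnorm_ge0.
apply: le_trans (wnorm_conv sk sd); rewrite le_eqVlt; apply/orP; left; apply/eqP.
have mry := measurable_damped (summableR_measurable sry).
have mrz := measurable_damped (summableR_measurable srz).
have c1 := wsummable_conv sk sry; have c2 := wsummable_conv sk srz.
have c3 := wsummable_conv sk sd.
have sp : summableR (damp (m + m) (fun t => picard y t - picard z t)).
  have E1 : (fun t => picard y t - picard z t) =
    fun t => convol k (rhs_derivative y) t - convol k (rhs_derivative z) t.
    by apply/funext => t; rewrite /picard; ring.
  by rewrite E1; exact: summable_dampB.
have n1 (x : R) : `|1 : R| <= 1 by rewrite normr1.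
have [_ [ae1 _]] := @conv_fubini _ _ _ (fun=> 1) 1 sk sry (measurable_cst _) n1.
have [_ [ae2 _]] := @conv_fubini _ _ _ (fun=> 1) 1 sk srz (measurable_cst _) n1.
apply: itg_ae; first by apply: summableR_measurable; exact: summableR_norm.
  by apply: summableR_measurable; exact: summableR_norm.
apply: (@filterS2 _ _ (ae_filter_ringOfSetsType mu) _ _ _ _ ae1 ae2) => t /= s1 s2.
congr (`|_ * _|).
rewrite /picard opprD addrACA subrr add0r /convol -itgB.
- by congr itg; apply/funext => s; rewrite mulrBr.
- apply: eq_integrable (summableRZ (expR ((m + m) * t)) s1) => // s _ /=.
  by rewrite undamp_section.
- apply: eq_integrable (summableRZ (expR ((m + m) * t)) s2) => // s _ /=.
  by rewrite undamp_section.
Qed.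

(** Picard iteration. The iterates converge first in a weighted supremum norm
for the states, then in a weighted L1 norm for the derivatives. *)
Theorem delayed_existence : exists m y, [/\ 0 < m, admissible m y,
  {ae mu, forall t, y t = picard y t} &
  forall t, prim y t = convol k (delayed_rhs y) t /\
    summableR (fun s => k (t - s) * delayed_rhs y s)].
Proof.
(* With the weight m below the kernel has norm 1 / (8 L + 1), which makes the
map on states a contraction of ratio 1/4. *)
pose q : R := 8 * L + 1.
have q0 : 0 < q by rewrite /q ltr_wpDl// mulr_ge0.
pose m := q `^ a^-1.
have m0 : 0 < m by exact: powR_gt0.
have kapE : wnorm m k = q^-1.
  rewrite wnormE norm_fker itg_damp_fker// /m -powRrM mulrN mulVf ?gt_eqF//.
  by rewrite powR_inv1// ltW.
set kap := wnorm m k in kapE.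
have kap0 : 0 <= kap by exact: wnorm_ge0.
have kL : kap * (2 * L) <= 4^-1.
  by rewrite kapE ler_pdivrMl// /q; lra.
pose h0 := `|g1 c + g2 c|.
pose Y n := iter n picard (fun=> 0).
have aY0 : admissible m (fun=> 0 : R).
  split=> //; apply: eq_integrable summableR0 => // t _ /=.
  by rewrite /damp mulr0.
have aY n : admissible m (Y n).
  by elim: n => //= n IH; exact: (admissible_picard m0 IH).1.
pose B := 2 * (kap * h0).
have h00 : 0 <= h0 by exact: normr_ge0.
have B0 : 0 <= B by rewrite mulr_ge0// mulr_ge0.
have bY n : wnorm m (Y n) <= B.
  elim: n => [|n IH].
    rewrite /wnorm (_ : (fun t => _) = fun=> 0) ?itg0//.
    by apply/funext => t; rewrite /damp mulr0 normr0.
  apply: (le_trans (admissible_picard m0 (aY n)).2); rewrite -/kap mulrDr.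
  have : kap * (2 * L * wnorm m (Y n)) <= 4^-1 * B.
    by rewrite mulrA; apply: ler_pM => //; [rewrite mulr_ge0// mulr_ge0|exact: wnorm_ge0].
  by have := mulr_ge0 kap0 h00; rewrite /B -/h0; lra.
pose z2 : R := 2^-1.
have z20 : 0 <= z2 by rewrite invr_ge0.
have eY n t : `|prim (Y n.+1) t - prim (Y n) t| <= (B * z2 ^+ n) * expR (m * t).
  elim: n t => [|n IH] t.
    rewrite expr0 mulr1 (_ : prim (Y 0%N) t = 0); last first.
      by apply: etrans itg0; congr itg; apply/funext => s; rewrite mulr0.
    rewrite subr0; have [_ s1] := aY 1%N.
    apply: (le_trans (prim_wnorm t (ltW m0) s1)); rewrite mulrC ler_wpM2r ?expR_ge0//.
  have E0 : 0 <= B * z2 ^+ n by rewrite mulr_ge0// exprn_ge0.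
  apply: (le_trans (prim_picard_diff t m0 E0 (aY n.+1) (aY n) IH)).
  rewrite ler_wpM2r ?expR_ge0// -/kap.
  have -> : B * z2 ^+ n.+1 = z2 * (B * z2 ^+ n) by rewrite exprS mulrCA.
  rewrite mulrA ler_wpM2r//.
  by apply: (le_trans kL); rewrite /z2; lra.
pose C := B + B ^+ 2.
have C0 : 0 <= C by rewrite addr_ge0// exprn_ge0.
have mm : m <= m + m by rewrite lerDl ltW.
have mm0 : 0 < m + m by exact: addr_gt0.
have sY2 n : summableR (damp (m + m) (Y n)) by exact: (wnorm_causal_le (aY n).1 mm (aY n).2).1.
have dY n : wnorm (m + m) (fun t => Y n.+1 t - Y n t) <= C * z2 ^+ n.
  elim: n => [|n IH].
    rewrite expr0 mulr1 (_ : (fun t => _) = Y 1%N).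
      apply: (le_trans (wnorm_causal_le (aY 1%N).1 mm (aY 1%N).2).2).
      by apply: (le_trans (bY 1%N)); rewrite lerDl exprn_ge0.
    by apply/funext => t; rewrite subr0.
  have E0 : 0 <= B * z2 ^+ n by rewrite mulr_ge0// exprn_ge0.
  apply: (le_trans (picard_diff m0 E0 (aY n.+1) (aY n) (eY n))).
  rewrite mulrA -/kap.
  have H : wnorm (m + m) (fun t => Y n.+1 t - Y n t) + B * z2 ^+ n * wnorm m (Y n) <=
      2 * C * z2 ^+ n.
    have -> : 2 * C * z2 ^+ n = C * z2 ^+ n + C * z2 ^+ n by ring.
    apply: lerD => //; apply: (@le_trans _ _ (B * z2 ^+ n * B)).
      by apply: ler_wpM2l.
    by rewrite mulrAC ler_wpM2r ?exprn_ge0// /C expr2 lerDr.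
  apply: (@le_trans _ _ (4^-1 * (2 * C * z2 ^+ n))).
    apply: ler_pM => //; first by rewrite mulr_ge0// mulr_ge0.
    by rewrite addr_ge0 ?wnorm_ge0// mulr_ge0// wnorm_ge0.
  by rewrite exprSr; move: (z2 ^+ n) => X; rewrite /z2; lra.
have [f [sf cf f0]] : exists f, [/\ summableR f,
    itg (fun t => `|damp (m + m) (Y n) t - f t|) @[n --> \oo] --> 0 &
    forall t, (forall n, damp (m + m) (Y n) t = 0) -> f t = 0].
  apply: (@L1_geometric_limit _ (fun n => damp (m + m) (Y n)) C) => // i.
  apply: le_trans (dY i); rewrite le_eqVlt; apply/orP; left; apply/eqP.
  by congr itg; apply/funext => t; rewrite /damp mulrBr.
pose y := damp (- (m + m)) f.
have yf : damp (m + m) y = f.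
  by have := dampK (- (m + m)) f; rewrite opprK => <-.
have ay : admissible (m + m) y.
  split; last by rewrite yf.
  move=> s s0; rewrite /y /damp f0 ?mulr0// => n.
  by rewrite /damp (aY n).1// mulr0.
pose e n := wnorm (m + m) (fun t => Y n t - y t).
have ce : e n @[n --> \oo] --> 0.
  rewrite (_ : e = fun n => itg (fun t => `|damp (m + m) (Y n) t - f t|))//.
  apply/funext => n; congr itg; apply/funext => t.
  by rewrite -yf /damp mulrBr.
have e0 n : 0 <= e n by exact: wnorm_ge0.
pose w := (m + m) + (m + m).
have w0 : m + m <= w by rewrite lerDl ltW.
have [sy yP] : summableR (damp w (fun t => picard y t - y t)) /\
   wnorm w (fun t => picard y t - y t) = 0.
  have [ap bp] := admissible_picard mm0 ay.
  have cd : causal (fun t => picard y t - y t).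
    by move=> s s0; rewrite ap.1// ay.1// subrr.
  have s1 := summable_dampB ap.2 ay.2.
  have [s2 _] := wnorm_causal_le cd w0 s1.
  split=> //; apply/eqP; rewrite eq_le wnorm_ge0 andbT.
  pose K := wnorm (m + m) k * (2 * L * (1 + wnorm (m + m) y)).
  have bound n : wnorm w (fun t => picard y t - y t) <= K * e n + e n.+1.
    have aYn : admissible (m + m) (Y n) by split; [exact: (aY n).1|exact: sY2].
    have aYn1 : admissible (m + m) (Y n.+1) by split; [exact: (aY n.+1).1|exact: sY2].
    have Yy t : `|prim (Y n) t - prim y t| <= e n * expR ((m + m) * t).
      have sd := summable_dampB (sY2 n) ay.2.
      rewrite -(primB t (ltW mm0) (sY2 n) ay.2) mulrC.
      exact: (prim_wnorm t (ltW mm0) sd).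
    have H := picard_diff mm0 (e0 n) aYn ay Yy.
    have cn : causal (fun t => Y n t - y t) by move=> s s0; rewrite aYn.1// ay.1// subrr.
    have cn1 : causal (fun t => Y n.+1 t - y t).
      by move=> s s0; rewrite aYn1.1// ay.1// subrr.
    have [sn hn] := wnorm_causal_le cn w0 (summable_dampB aYn.2 ay.2).
    have [sn1 hn1] := wnorm_causal_le cn1 w0 (summable_dampB aYn1.2 ay.2).
    have cp : causal (fun t => Y n.+1 t - picard y t).
      by move=> s s0; rewrite aYn1.1// ap.1// subrr.
    have [sp _] := wnorm_causal_le cp w0 (summable_dampB aYn1.2 ap.2).
    have -> : (fun t => picard y t - y t) =
       fun t => (-1) * (Y n.+1 t - picard y t) + (Y n.+1 t - y t).
      by apply/funext => t; ring.
    apply: (le_trans (wnormD (summable_dampZ _ sp) sn1)).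
    rewrite wnormZ// normrN1 mul1r; apply: lerD => //.
    apply: (le_trans H).
    have -> : K * e n = wnorm (m + m) k * (2 * L * (e n + e n * wnorm (m + m) y)).
      by rewrite /K; ring.
    apply: ler_wpM2l; first exact: wnorm_ge0.
    by apply: ler_wpM2l; [rewrite mulr_ge0|exact: lerD].
  have cb : K * e n + e n.+1 @[n --> \oo] --> K * 0 + 0.
    by apply: cvgD; [apply: cvgM => //; exact: cvg_cst|rewrite cvg_shiftS].
  rewrite mulr0 addr0 in cb.
  rewrite leNgt; apply/negP => W0.
  have /cvgrPdist_lt /(_ _ W0)[N _ /(_ N (leqnn N))] := cb.
  rewrite /= sub0r normrN => H; have := le_lt_trans (ler_norm _) H.
  by rewrite ltNge bound.
exists (m + m), y.
have [ap _] := admissible_picard mm0 ay.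
have ae0 := itg_norm_eq0 sy yP.
  have ae1 : {ae mu, forall t, y t = picard y t}.
    apply: (@filterS _ _ (ae_filter_ringOfSetsType mu) _ _ _ ae0) => t /eqP.
    by rewrite /damp mulf_eq0 gt_eqF ?expR_gt0//= subr_eq0 => /eqP.
  split=> // t; have [pE s1] := prim_picard t mm0 ay; split=> //.
  rewrite -pE; apply: itg_ae.
  - exact: conv_section measurable_theta (measurable_damped (summableR_measurable ay.2)).
  - exact: conv_section measurable_theta (measurable_damped (summableR_measurable ap.2)).
  by apply: (@filterS _ _ (ae_filter_ringOfSetsType mu) _ _ _ ae1) => s ->.
Qed.

End picard.

(** * Absolute continuity of primitives *)

Section regularity.
Context {R : realType}.
Local Notation mu := (@lebesgue_measure R).
Implicit Types f x : R -> R.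

Lemma abs_continuous_prim m f a b : 0 <= m -> summableR (damp m f) ->
  abs_continuous a b (prim f).
Proof.
move=> m0 sf e e0; have [d [d0 H]] := prim_abs_continuity b m0 sf e0.
exists d => // n u v uv tuv suv.
pose F (i : 'I_n) : set R := `]u i, v i[%classic.
pose g r := theta (b - r) * f r.
have sg : summableR g by exact: summable_cut m0 sf.
have mF i : measurable (F i) by exact: measurable_itv.
have le i : `|prim f (v i) - prim f (u i)| <= \int[mu]_(r in F i) `|g r|.
  have [_ [uvi vb]] := uv i.
  apply: (le_trans (prim_diff_set m0 sf uvi vb)).
  rewrite -Rintegral_itv_obnd_cbnd//.
  exact: integrableS (summableR_norm sg).
apply: le_lt_trans (ler_sum _ (fun i _ => le i)) _.
have -> : \sum_(i < n) \int[mu]_(r in F i) `|g r| =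
    \int[mu]_(r in \big[setU/set0]_(i < n) F i) `|g r|.
  rewrite /Rintegral integral_bigsetU_EFin//=; last 3 first.
  - exact: index_enum_uniq.
  - by apply: sub_trivIset tuv.
  - apply/measurable_EFinP/measurable_funTS.
    by apply: summableR_measurable; exact: summableR_norm.
  rewrite sum_fine// => i _; apply: integrable_fin_num => //.
    exact: mF.
  apply: (@integrableS _ _ _ mu setT (F i)) => //; first exact: mF.
  exact: summableR_norm sg.
apply: H; first by apply: bigsetU_measurable => i _; exact: mF.
rewrite measure_bigsetU_ord//.
rewrite (eq_bigr (fun i => (v i - u i)%:E)); first by rewrite sumEFin lte_fin.
move=> i _; transitivity (mu `]u i, v i[%classic); first by [].
rewrite lebesgue_measure_itv/= lte_fin; case: ltP => vu; first by rewrite EFinB.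
by have [_ [uvi _]] := uv i; rewrite (@le_anti _ _ (u i) (v i)) ?subrr// uvi.
Qed.

(** * Borel measurability of derivatives *)

Definition dquot x (h s : R) : R := h^-1 *: (x (h + s) - x s).

(** Cauchy's criterion for difference quotients, in terms of sets that are closed when
x is continuous. *)
Definition almost_derivable x (n j : nat) : set R :=
  [set s | forall h h', 0 < `|h| < n.+1%:R^-1 -> 0 < `|h'| < n.+1%:R^-1 ->
     `|dquot x h s - dquot x h' s| <= j.+1%:R^-1].

Lemma continuous_dquot x h : continuous x -> continuous (dquot x h).
Proof.
move=> cx s; apply: cvgZr; apply: cvgB; last exact: cx.
apply: continuous_comp; last exact: cx.
by apply: cvgD; [exact: cvg_cst|exact: cvg_id].
Qed.

Lemma closed_almost_derivable x n j : continuous x -> closed (almost_derivable x n j).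
Proof.
move=> cx.
have -> : almost_derivable x n j = \bigcap_(p in [set p : R * R |
    0 < `|p.1| < n.+1%:R^-1 /\ 0 < `|p.2| < n.+1%:R^-1])
   ((fun s => `|dquot x p.1 s - dquot x p.2 s|) @^-1` [set y | y <= j.+1%:R^-1]).
  apply/seteqP; split => [s H [h h'] /= [h1 h2]|s H h h' h1 h2]; first exact: H.
  exact: (H (h, h')).
apply: closed_bigI => p _; apply: closed_comp; last exact: closed_le.
move=> s _; apply: cvg_norm; apply: cvgB; exact: continuous_dquot.
Qed.

Lemma cvg_dquotP x s : cvg (dquot x h s @[h --> 0^']) <->
  forall j, exists n, almost_derivable x n j s.
Proof.
split=> [|H].
  move=> /cvg_ex[l /cvgrPdist_le cl] j.
  have j0 : 0 < (2 * j.+1%:R)^-1 :> R by rewrite invr_gt0 mulr_gt0.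
  have [e /= e0 He] := cl _ j0.
  have [n [_ ne]] : exists n, True /\ n.+1%:R^-1 <= e.
    exists (Num.truncn e^-1); split => //.
    by rewrite invf_ple ?posrE// ltW// truncnS_gt.
  have key h : 0 < `|h| < n.+1%:R^-1 -> `|l - dquot x h s| <= (2 * j.+1%:R)^-1.
    move=> /andP[h0 hn]; apply: He; last by rewrite -normr_gt0.
    by rewrite /= sub0r normrN (lt_le_trans hn).
  exists n => h h' h1 h2.
  have -> : dquot x h s - dquot x h' s = (l - dquot x h' s) - (l - dquot x h s) by ring.
  apply: (le_trans (ler_normB _ _)); apply: (le_trans (lerD (key _ h2) (key _ h1))).
  have : (j.+1%:R : R) != 0 by rewrite pnatr_eq0.
  move: (j.+1%:R : R) => J J0; rewrite le_eqVlt; apply/orP; left; apply/eqP; field.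
  exact: J0.
apply/cauchy_cvgP/cauchy_exP => e e0.
have [n Hn] := H (Num.truncn e^-1).
have n0 : 0 < n.+1%:R^-1 :> R by rewrite invr_gt0.
pose h0 : R := n.+1%:R^-1 / 2.
have h00 : 0 < h0 by rewrite divr_gt0.
have h0n : h0 < n.+1%:R^-1 by rewrite ltr_pdivrMr// ltr_pMr// ltr1n.
exists (dquot x h0 s); exists n.+1%:R^-1 => //= h; rewrite /= sub0r normrN => hn hne.
have := Hn h0 h; rewrite (gtr0_norm h00) h00 h0n hn normr_gt0 hne => /(_ isT isT) le.
rewrite /ball/=; apply: le_lt_trans le _.
by rewrite invf_plt ?posrE// truncnS_gt.
Unshelve. all: by end_near. Qed.

(** The set of points of differentiability is Borel, derive1 is a limit of difference
quotients on it, and it is the default value of the limit elsewhere. *)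
Lemma measurable_derive1 x : continuous x ->
  measurable_fun [set: measurableTypeR R] (derive1 x : R -> R).
Proof.
move=> cx.
pose E := \bigcap_j \bigcup_n almost_derivable x n j.
have mE : measurable E.
  apply: bigcap_measurable => // j _; apply: bigcup_measurable => n _.
  by apply: closed_measurable; exact: closed_almost_derivable.
have EP s : E s <-> cvg (dquot x h s @[h --> 0^']).
  rewrite cvg_dquotP; split=> [Es j|H j _]; first by have [n _ ?] := Es j I; exists n.
  by have [n ?] := H j; exists n.
pose hn n : R := n.+1%:R^-1.
apply: (@measurable_fun_cvg _ (measurableTypeR R) R setT
    (fun n (s : R) => (\1_E s : R) * dquot x (hn n) s + (\1_(~` E) s : R) * (point : R) : R)).
  move=> n; apply: measurable_funD; apply: measurable_funM.
  - exact: measurable_indic.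
  - by apply: continuous_measurable_fun; exact: continuous_dquot.
  - by apply: measurable_indic; exact: measurableC.
  - exact: measurable_cst.
move=> s _; have [Es|Es] := pselect (E s).
  rewrite (_ : (fun n => _) = fun n => dquot x (hn n) s); last first.
    apply/funext => n; rewrite !indicE mem_set// memNset ?mul1r ?mul0r ?addr0//.
  have /EP cs := Es.
  have : dquot x h s @[h --> 0^'] --> derive1 x s by exact: cs.
  move=> /cvgr_dnbhsP; apply; split.
    by move=> n; rewrite /hn invr_eq0 pnatr_eq0.
  exact: cvg_harmonic.
rewrite (_ : (fun n => _) = fun=> point); last first.
  apply/funext => n; rewrite !indicE memNset// mem_set// ?mul1r ?mul0r ?add0r//.
have -> : derive1 x s = point; last exact: cvg_cst.
by apply: (@dvgP R) => cs; apply: Es; exact/EP.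
Qed.

End regularity.

(** * From the integral equation to the Caputo equation *)

Section solutions.
Context {R : realType}.
Local Notation mu := (@lebesgue_measure R).
Implicit Types f h x : R -> R.

Lemma summableR_ae (f g : R -> R) : measurable_fun setT f -> summableR g ->
  {ae mu, forall t, f t = g t} -> summableR f.
Proof.
move=> mf sg fg; apply: summableRP => //.
have mg := summableR_measurable sg.
have /integrableP[_] := sg; congr (_ < _)%E; apply: ae_eq_integral => //.
- by apply/measurable_EFinP; exact: measurableT_comp.
- by apply/measurable_EFinP; exact: measurableT_comp.
by apply: (@filterS _ _ (ae_filter_ringOfSetsType mu) _ _ _ fg) => t /= ->.
Qed.

Lemma cut_half_line (h : R -> R) (t : R) s :
  theta (t - s) * h s = (h \_ `]-oo, t[) s.
Proof.
rewrite patchE /theta subr_gt0; case: ltP => st.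
  by rewrite mul1r ifT// inE/= in_itv/= st.
by rewrite mul0r ifF//; apply/negP; rewrite inE/= in_itv/= ltNge st.
Qed.

Lemma integrable_half_line m h u : 0 <= m -> summableR (damp m h) ->
  mu.-integrable `]-oo, u] (EFin \o h).
Proof.
move=> m0 sh; have sc := summable_cut (u + 1) m0 sh.
have sub : `]-oo, u]%classic `<=` `]-oo, u + 1[%classic.
  by move=> s; rewrite /= !in_itv/= => su; rewrite (le_lt_trans su)// ltrDl.
apply: (@integrableS _ _ _ mu `]-oo, (u + 1)%R[%classic) => //.
rewrite integrable_mkcond//; apply: eq_integrable sc => // s _ /=.
by rewrite cut_half_line !patchE; case: ifP.
Qed.

Lemma primE m h t : 0 <= m -> summableR (damp m h) ->
  prim h t = \int[mu]_(s in `]-oo, t]) h s.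
Proof.
move=> m0 sh; rewrite -Rintegral_itv_bndo_bndc; last first.
  have := integrable_half_line t m0 sh; apply: integrableS => //.
  by move=> s; rewrite /= !in_itv/=; exact: ltW.
rewrite [RHS]Rintegral_mkcond; congr Rintegral; apply/funext => s.
exact: cut_half_line.
Qed.

Lemma derive_prim_continuous m h t : 0 <= m -> summableR (damp m h) ->
  {for t, continuous h} -> derivable (prim h) t 1 /\ derive1 (prim h) t = h t.
Proof.
move=> m0 sh ch.
have -> : prim h = fun s => \int[mu]_(r in `]-oo, s]) h r.
  by apply/funext => s; exact: primE m0 sh.
have tt : t < t + 1 by rewrite ltrDl.
apply: (@continuous_FTC1 R h -oo%O t (t + 1) tt (integrable_half_line (t + 1) m0 sh)).
  by rewrite ltNyr.
exact: ch.
Qed.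

Lemma derive_prim_ae m h : 0 <= m -> summableR (damp m h) ->
  {ae mu, forall t, derive1 (prim h) t = h t}.
Proof.
move=> m0 sh.
have -> : prim h = fun s => \int[mu]_(r in `]-oo, s]) h r.
  by apply/funext => s; exact: primE m0 sh.
have mh : measurable_fun setT h by exact: measurable_damped (summableR_measurable sh).
have loc : locally_integrable [set: R] h.
  split=> //; first exact: openT.
  move=> K _ cK; have [M [_ KM]] := compact_bounded cK.
  have KM1 (z : R) : K z -> z <= M + 1.
    by move=> Kz; rewrite (le_trans (ler_norm _))// (KM (M + 1))// ltrDl.
  have mK : measurable K by exact: compact_measurable.
  have sub : K `<=` `]-oo, (M + 1)%R]%classic.
    by move=> z Kz /=; rewrite in_itv/= KM1.
  have /integrableP[_] : mu.-integrable K (EFin \o h).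
    by apply: integrableS (integrable_half_line (M + 1) m0 sh).
  exact.
have := FTC1Ny (fun u => integrable_half_line u m0 sh) loc.
by apply: (@filterS _ _ (ae_filter_ringOfSetsType mu)) => t [].
Qed.

Lemma caputo_kernelE (a t s : R) : 0 < a -> a < 1 ->
  s < t -> (t - s) `^ (- a) = Gamma (1 - a) * fker (1 - a) (t - s).
Proof.
move=> a0 a1 st; have b0 : 0 < 1 - a by lra.
have b1 : 1 - a <= 1 by lra.
rewrite /fker mulVKf ?gt_eqF ?Gamma_gt0// /pw subr_gt0 st; congr (_ `^ _); ring.
Qed.

(** The derivative of the primitive is y almost everywhere, and the Caputo kernel is
the kernel of order 1 - a multiplied by Gamma(1 - a). *)
Lemma caputo_prim (a m C : R) y t v : 0 < a -> a < 1 -> 0 <= m -> summableR (damp m y) ->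
  causal y -> 0 < t -> summableR (fun s => fker (1 - a) (t - s) * y s) ->
  convol (fker (1 - a)) y t = v ->
  caputo_defined a (fun s => C + prim y s) t /\ caputo a (fun s => C + prim y s) t = v.
Proof.
move=> a0 a1 m0 sy y0 t0 sv vE.
have a_neq1 : (a == 1) = false by rewrite lt_eqF.
rewrite /caputo_defined /caputo a_neq1.
pose x s := C + prim y s.
have cx : continuous x.
  by move=> s; apply: cvgD; [exact: cvg_cst|exact: continuous_prim m0 sy _].
have dx s : derive1 x s = derive1 (prim y) s.
  have E r : x (r + s) - x s = prim y (r + s) - prim y s by rewrite /x; ring.
  by rewrite /derive1; under eq_fun do rewrite E.
have G0 : Gamma (1 - a) != 0 by rewrite gt_eqF// Gamma_gt0//; lra.
pose F s := (t - s) `^ (- a) * derive1 x s.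
have mF : measurable_fun [set: measurableTypeR R] F.
  apply: measurable_funM; last exact: (measurable_derive1 cx).
  apply: (@measurable_refl _ (fun s => s `^ (- a)) t); exact: measurable_powR.
have mFr : measurable_fun [set: measurableTypeR R] (F \_ `]0, t[).
  by apply/(measurable_restrictT _ _).1 => //; exact: measurable_funTS.
have ae : {ae mu, forall s, (F \_ `]0, t[) s = Gamma (1 - a) * (fker (1 - a) (t - s) * y s)}.
  apply: (@filterS _ _ (ae_filter_ringOfSetsType mu) _ _ _ (derive_prim_ae m0 sy)) => s ds.
  rewrite patchE; case: ifPn => st.
    move: st; rewrite inE/= in_itv/= => /andP[_ st].
    by rewrite /F dx ds caputo_kernelE// mulrA.
  move: st; rewrite notin_setE/= in_itv/= => /negP; rewrite negb_and -!leNgt.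
  move=> /orP[s0|ts]; first by rewrite y0// !mulr0.
  by rewrite fker_le0 ?mul0r ?mulr0// subr_le0.
have sF := summableR_ae mFr (summableRZ _ sv) ae.
split.
  rewrite -/x integrable_mkcond//; apply: eq_integrable sF => // s _.
  by rewrite /= !patchE; case: ifP.
have -> : \int[mu]_(s in `]0, t[) ((t - s) `^ (- a) * derive1 x s) = itg (F \_ `]0, t[).
  by rewrite [LHS]Rintegral_mkcond.
rewrite (itg_ae mFr (summableR_measurable (summableRZ _ sv)) ae) itgZ//.
by rewrite mulrA mulVf// mul1r.
Qed.

Section state_solution.
Variables (a tau c L xs r m : R) (g1 d1 g2 d2 : R -> R) (F : R -> R -> R) (y : R -> R).
Hypotheses (a0 : 0 < a) (a1 : a <= 1) (tau0 : 0 <= tau).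
Hypotheses (G1 : C11 L g1 d1) (G2 : C11 L g2 d2).
Hypotheses (m0 : 0 < m) (ay : admissible m y).
Hypothesis yE : {ae mu, forall t, y t = picard a tau c g1 d1 g2 d2 y t}.
Hypothesis yP : forall t, prim y t = convol (fker a) (delayed_rhs tau c g1 g2 y) t.
Local Notation u := (state c y).

Let sy : summableR (damp m y). Proof. exact: ay.2. Qed.

Lemma state_continuous : continuous u.
Proof. exact: continuous_state (ltW m0) sy. Qed.

Lemma state_history t : t <= 0 -> u t = c.
Proof. by move=> t0; rewrite /state prim_causal ?addr0//; exact: ay.1. Qed.

Lemma delayed_rhs_damp :
  summableR (damp m (delayed_rhs tau c g1 g2 y)).
Proof.
have [rc rs _] := rhs_derivative_damp c tau0 G1 G2 (ltW m0) ay.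
rewrite (_ : delayed_rhs tau c g1 g2 y = fun t =>
  (g1 c + g2 c) * theta t + convol theta (rhs_derivative tau c d1 d2 y) t).
  have [st _] := itg_damp_theta m0.
  by apply: summable_dampD; [exact: summable_dampZ|exact: wsummable_conv].
by apply/funext => t; exact: (delayed_rhsE c tau0 G1 G2 t (ltW m0) ay).
Qed.

(** For order one the right hand side is continuous at positive times, so the
fundamental theorem applies at every such time. *)
Lemma state_ode t : a = 1 -> 0 < t ->
  derivable u t 1 /\ derive1 u t = g1 (u t) + g2 (u (t - tau)).
Proof.
move=> aE t0.
have uE : u = fun t => c + prim (delayed_rhs tau c g1 g2 y) t.
  by apply/funext => s; rewrite /state yP aE fker1.
have th t' : 0 < t' -> delayed_rhs tau c g1 g2 y t' = g1 (u t') + g2 (u (t' - tau)).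
  by move=> t'0; rewrite /delayed_rhs /theta t'0 mul1r.
have cu := state_continuous.
have [c1 _] := C11_continuous G1; have [c2 _] := C11_continuous G2.
have cd : {for t, continuous (delayed_rhs tau c g1 g2 y)}.
  have cG : (fun s => g1 (u s) + g2 (u (s - tau))) @ t --> delayed_rhs tau c g1 g2 y t.
    rewrite (th t t0); apply: (@cvgD _ _ _ _ _ (fun s => g1 (u s)) (fun s => g2 (u (s - tau)))).
      by apply: (@continuous_comp _ _ _ u g1); [exact: cu|exact: c1].
    apply: (@continuous_comp _ _ _ (fun s : R => u (s - tau)) g2); last exact: c2.
    apply: (@continuous_comp _ _ _ (fun s : R => s - tau) u); last exact: cu.
    by apply: (@cvgB _ _ _ _ _ id (cst tau)); [exact: cvg_id|exact: cvg_cst].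
  apply: cvg_trans cG; apply: near_eq_cvg; near=> s; apply/esym/th.
  near: s; exact: lt_nbhsr.
have [d e] := derive_prim_continuous (ltW m0) delayed_rhs_damp cd.
have dc : derivable (cst c : R -> R) t 1 by exact: derivable_cst.
rewrite -th// -e uE; split; first exact: derivableD.
by rewrite !derive1E deriveD// derive_cst add0r.
Unshelve. all: by end_near. Qed.

(** The kernels of orders 1 - a and a convolve to theta, so that convolving the
equation for y yields the right hand side of [delayed_rhsE]. *)
Lemma convol_caputo t : a < 1 ->
  convol (fker (1 - a)) y t = delayed_rhs tau c g1 g2 y t /\
  summableR (fun s => fker (1 - a) (t - s) * y s).
Proof.
move=> a1'.
have [rc rs _] := rhs_derivative_damp c tau0 G1 G2 (ltW m0) ay.
have b0 : 0 < 1 - a by rewrite subr_gt0.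
have b1 : 1 - a <= 1 by rewrite lerBlDr lerDl ltW.
have E : convol (fker (1 - a)) (fker a) = theta :> (R -> R).
  by apply/funext => s; exact: (conv_fker s a0 a1').2.
have nd (s s' : R) : s <= s' ->
  convol (fker (1 - a)) (fker a) s <= convol (fker (1 - a)) (fker a) s'.
  by rewrite E; exact: le_theta.
have ca : causal (convol (fker (1 - a)) (fker a) : R -> R) by rewrite E; exact: causal_theta.
have [e s2] := conv_assoc_causal t (measurable_fker (1 - a)) (measurable_fker a)
  (fun s => fker_ge0 s b0 b1) (fun s => fker_ge0 s a0 a1)
  (fun s => (conv_fker s a0 a1').1) nd ca (ltW m0) rs rc.
rewrite E in e.
have s1 := summableRZ (g1 c + g2 c) (conv_fker t a0 a1').1.
have s3 := summableRD s1 s2.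
have ae : {ae mu, forall s, fker (1 - a) (t - s) * y s =
   (g1 c + g2 c) * (fker (1 - a) (t - s) * fker a s) +
   fker (1 - a) (t - s) * convol (fker a) (rhs_derivative tau c d1 d2 y) s}.
  apply: (@filterS _ _ (ae_filter_ringOfSetsType mu) _ _ _ yE) => s ->.
  by rewrite /picard; ring.
have my := measurable_damped (summableR_measurable sy).
have ms := conv_section t (measurable_fker (1 - a)) my.
split; last exact: summableR_ae s3 ae.
rewrite /convol (itg_ae ms (summableR_measurable s3) ae) itgD// itgZ; last first.
  exact: (conv_fker t a0 a1').1.
by rewrite -!/(convol _ _ _) e (conv_fker t a0 a1').2 (delayed_rhsE c tau0 G1 G2 t (ltW m0) ay).
Qed.

Theorem state_solution (T : \bar R) : `|c| <= r ->
  (forall x v : R, `|x| <= r -> `|v| <= r -> F (xs + x) (xs + v) = g1 x + g2 v) ->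
  (forall t, 0 <= t -> (t%:E < T)%E -> `|u t| <= r) ->
  solution a tau F T (fun t => xs + u t).
Proof.
move=> cr FE ur.
have urr t : (t%:E < T)%E -> `|u t| <= r.
  by move=> tT; have [t0|/ltW t0] := leP 0 t; [exact: ur|rewrite state_history].
have cx : continuous (fun t => xs + u t).
  by move=> s; apply: cvgD; [exact: cvg_cst|exact: state_continuous].
split.
- exact: continuous_subspaceT.
- move=> b b0 bT e e0.
  have [d d0 H] := abs_continuous_prim 0 b (ltW m0) sy e0.
  exists d => // n p q pq tI sd; have := H n p q pq tI sd.
  congr (_ < _); apply: eq_bigr => i _; congr `|_|; rewrite /state; ring.
move=> t t0 tT.
have FtE : F (xs + u t) (xs + u (t - tau)) = g1 (u t) + g2 (u (t - tau)).
  apply: FE; apply: urr => //; apply: le_lt_trans tT; rewrite lee_fin.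
  by rewrite lerBlDr lerDl.
rewrite FtE.
have [a1E|a_neq1] := eqVneq a 1.
  have [d e] := state_ode a1E t0.
  rewrite /caputo_defined /caputo a1E eqxx.
  have dc : derivable (cst xs : R -> R) t 1 by exact: derivable_cst.
  split; first exact: derivableD.
  by rewrite derive1E deriveD// derive_cst add0r -derive1E.
have a1' : a < 1 by rewrite lt_neqAle a_neq1.
have [e s1] := convol_caputo t a1'.
have xE : (fun t => xs + u t) = fun t => (xs + c) + prim y t.
  by apply/funext => s; rewrite /state addrA.
have ev : convol (fker (1 - a)) y t = g1 (u t) + g2 (u (t - tau)).
  by rewrite e /delayed_rhs /theta t0 mul1r.
have := caputo_prim (xs + c) a0 a1' (ltW m0) sy ay.1 t0 s1 ev.
by rewrite xE.
Qed.

End state_solution.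

End solutions.

(** * Tangent continuation of cubic polynomials *)

Section truncation.
Context {R : realType}.
Variables (A B C r : R).
Hypotheses (r0 : 0 <= r) (r1 : r <= 1).

Definition clip (x : R) : R := if x < - r then - r else if r < x then r else x.

Definition cubic (x : R) : R := A * x + B * x ^+ 2 + C * x ^+ 3.

Definition cubic_slope (x : R) : R := A + 2 * B * x + 3 * C * x ^+ 2.

(** Outside [-r, r] the cubic is continued by its tangent lines. This gives a C^{1,1}
constant that does not depend on r. *)
Definition truncated (x : R) : R :=
  cubic (clip x) + cubic_slope (clip x) * (x - clip x).

Definition truncated_slope (x : R) : R := cubic_slope (clip x).

Definition cubic_modulus : R := 2 * `|B| + 6 * `|C|.

Local Notation M := cubic_modulus.

Lemma cubic_modulus_ge0 : 0 <= M.
Proof. by rewrite /cubic_modulus addr_ge0// mulr_ge0. Qed.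

Lemma clip_le x : - r <= clip x /\ clip x <= r.
Proof. by rewrite /clip; have := r0; case: ltP => ?; [|case: ltP => ?]; split; lra. Qed.

Lemma norm_clip x : `|clip x| <= r.
Proof. by rewrite ler_norml; have [-> ->] := clip_le x. Qed.

Lemma clip_id x : `|x| <= r -> clip x = x.
Proof. by rewrite ler_norml /clip => /andP[? ?]; rewrite !ltNge; case: ifP; [lra|case: ifP]; lra. Qed.

Lemma clip_lip x y : `|clip x - clip y| <= `|x - y|.
Proof.
rewrite /clip; have r0' := r0; case: (ltP x (- r)) => ?; case: (ltP y (- r)) => ?; case: (ltP r x) => ?; case: (ltP r y) => ?; rewrite ler_norml;
  case: (ler0P (x - y)) => ?; apply/andP; split; lra.
Qed.

(** This controls the product of the variation of the slope with the overshoot in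
[truncated_mixed]: one of them vanishes or the overshoot is at most |x - y|. *)
Lemma clip_rest x y : clip x = clip y \/ `|x - clip x| <= `|x - y|.
Proof.
rewrite /clip; have r0' := r0; case: (ltP x (- r)) => ?; case: (ltP y (- r)) => ?; case: (ltP r x) => ?; case: (ltP r y) => ?; try (by left); right; rewrite ler_norml;
  case: (ler0P (x - y)) => ?; apply/andP; split; lra.
Qed.

Lemma clip_norm_split x : `|clip x| + `|x - clip x| = `|x|.
Proof.
rewrite /clip; have r0' := r0; case: (ltP x (- r)) => ?; last case: (ltP r x) => ?.
- by rewrite !ler0_norm; lra.
- by rewrite !ger0_norm; lra.
- by rewrite subrr normr0 addr0.
Qed.

Lemma cubic_slope_lip x y : `|x| <= r -> `|y| <= r ->
  `|cubic_slope x - cubic_slope y| <= M * `|x - y|.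
Proof.
move=> xr yr.
have -> : cubic_slope x - cubic_slope y = (2 * B + 3 * C * (x + y)) * (x - y).
  by rewrite /cubic_slope; ring.
rewrite normrM ler_wpM2r// (le_trans (ler_normD _ _))// !normrM !normr_nat.
have := ler_normD x y => xy.
have C0 := normr_ge0 C.
have xy2 : `|x + y| <= 2 by move: r1 xr yr xy; lra.
have := ler_wpM2l C0 xy2; rewrite /cubic_modulus; lra.
Qed.

Lemma cubic_taylor x y : `|x| <= r -> `|y| <= r ->
  `|cubic x - cubic y - cubic_slope y * (x - y)| <= M * (x - y) ^+ 2.
Proof.
move=> xr yr.
have -> : cubic x - cubic y - cubic_slope y * (x - y) =
    (B + C * (x + 2 * y)) * (x - y) ^+ 2.
  by rewrite /cubic_slope /cubic; ring.
rewrite normrM (ger0_norm (sqr_ge0 _)) ler_wpM2r ?sqr_ge0//.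
rewrite (le_trans (ler_normD _ _))// !normrM.
have : `|x + 2 * y| <= 3.
  by apply: (le_trans (ler_normD _ _)); rewrite normrM normr_nat; move: r1 xr yr; lra.
have C0 := normr_ge0 C; have B0 := normr_ge0 B.
move=> /(ler_wpM2l C0); rewrite /cubic_modulus; lra.
Qed.

Lemma truncated_slope_sub x : `|truncated_slope x - A| <= M * r.
Proof.
have := cubic_slope_lip (norm_clip x) (_ : `|0| <= r).
rewrite normr0 subr0 => /(_ r0).
have -> : cubic_slope 0 = A by rewrite /cubic_slope; ring.
move=> H; apply: (le_trans H); rewrite ler_wpM2l ?cubic_modulus_ge0//.
exact: norm_clip.
Qed.

Lemma truncatedE x y : truncated x - truncated y - truncated_slope y * (x - y) =
  (cubic (clip x) - cubic (clip y) - cubic_slope (clip y) * (clip x - clip y)) +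
  (cubic_slope (clip x) - cubic_slope (clip y)) * (x - clip x).
Proof. by rewrite /truncated /truncated_slope; ring. Qed.

Lemma truncated_mixed x y : `|cubic_slope (clip x) - cubic_slope (clip y)| * `|x - clip x| <=
  M * `|clip x - clip y| * `|x - y|.
Proof.
have [->|xy] := clip_rest x y; first by rewrite !subrr normr0 mul0r mulr0 mul0r.
apply: ler_pM => //; exact: cubic_slope_lip (norm_clip _) (norm_clip _).
Qed.

Lemma truncated_slope_lip x y :
  `|truncated_slope x - truncated_slope y| <= M * `|x - y|.
Proof.
apply: (le_trans (cubic_slope_lip (norm_clip _) (norm_clip _))).
by rewrite ler_wpM2l ?cubic_modulus_ge0//; exact: clip_lip.
Qed.

Lemma truncated_C11 : C11 (`|A| + 7 * M) truncated truncated_slope.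
Proof.
have M0 := cubic_modulus_ge0; have A0 := normr_ge0 A.
have Mr : M * r <= M by rewrite ler_piMr.
have c2 x y : `|clip x - clip y| <= 2.
  apply: (le_trans (ler_normB _ _)); have := norm_clip x; have := norm_clip y; move: r1; lra.
have taylor x y : `|truncated x - truncated y - truncated_slope y * (x - y)| <=
    2 * M * `|clip x - clip y| * `|x - y|.
  rewrite truncatedE; apply: (le_trans (ler_normD _ _)).
  rewrite [in X in _ + X]normrM.
  have H1 := cubic_taylor (norm_clip x) (norm_clip y).
  have H2 := truncated_mixed x y.
  have H3 : M * (clip x - clip y) ^+ 2 <= M * `|clip x - clip y| * `|x - y|.
    rewrite -mulrA ler_wpM2l// -real_normK ?num_real// expr2.
    by rewrite ler_wpM2l// clip_lip.
  have -> : 2 * M * `|clip x - clip y| * `|x - y| =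
    M * `|clip x - clip y| * `|x - y| + M * `|clip x - clip y| * `|x - y| by ring.
  by apply: lerD => //; exact: le_trans H1 H3.
have bd x : `|truncated_slope x| <= `|A| + M.
  have := truncated_slope_sub x => H.
  have -> : truncated_slope x = A + (truncated_slope x - A) by ring.
  by apply: (le_trans (ler_normD _ _)); lra.
split=> [x y|x|x y|x y].
- apply: (le_trans (taylor x y)).
  have -> : (x - y) ^+ 2 = `|x - y| * `|x - y| by rewrite -expr2 real_normK// num_real.
  rewrite mulrA ler_wpM2r//; apply: ler_pM => //; [lra|lra|exact: clip_lip].
- by apply: (le_trans (bd x)); lra.
- have -> : truncated x - truncated y =
    (truncated x - truncated y - truncated_slope y * (x - y)) + truncated_slope y * (x - y) by ring.
  apply: (le_trans (ler_normD _ _)); rewrite [in X in _ + X]normrM.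
  have H1 := ler_wpM2r (normr_ge0 (x - y)) (bd y).
  have H2 : 2 * M * `|clip x - clip y| * `|x - y| <= 4 * M * `|x - y|.
    rewrite ler_wpM2r//; have := ler_wpM2l M0 (c2 x y); lra.
  have := taylor x y; have := mulr_ge0 M0 (normr_ge0 (x - y)); lra.
- apply: (le_trans (truncated_slope_lip x y)); rewrite ler_wpM2r//; lra.
Qed.

(** The nonlinear part has size M r relative to x, as small as desired for small r. *)
Lemma truncated_sub x : `|truncated x - A * x| <= M * r * `|x|.
Proof.
have M0 := cubic_modulus_ge0.
have -> : truncated x - A * x = (cubic (clip x) - A * clip x) +
    (truncated_slope x - A) * (x - clip x) by rewrite /truncated /truncated_slope; ring.
have -> : M * r * `|x| = M * r * `|clip x| + M * r * `|x - clip x|.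
  by rewrite -mulrDr clip_norm_split.
apply: (le_trans (ler_normD _ _)); apply: lerD; last first.
  by rewrite normrM ler_wpM2r// truncated_slope_sub.
have -> : cubic (clip x) - A * clip x = (B + C * clip x) * clip x * clip x.
  by rewrite /cubic; ring.
rewrite 2!normrM ler_wpM2r//; apply: ler_pM => //; last exact: norm_clip.
apply: (le_trans (ler_normD _ _)); rewrite normrM.
have c1 : `|clip x| <= 1 by exact: le_trans (norm_clip x) r1.
have := ler_wpM2l (normr_ge0 C) c1; have := normr_ge0 B; have := normr_ge0 C.
rewrite /cubic_modulus; lra.
Qed.

Lemma truncated_id x : `|x| <= r -> truncated x = cubic x.
Proof. by move=> xr; rewrite /truncated clip_id// subrr mulr0 addr0. Qed.

End truncation.

(** * Elementary trigonometric estimates *)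

Section trig.
Context {R : realType}.
Implicit Types x y P V : R.

Lemma mean_value_norm (f df : R -> R) x y : (forall z : R, is_derive z 1 f (df z)) ->
  exists2 c, `|c - y| <= `|x - y| & `|f x - f y| = `|df c| * `|x - y|.
Proof.
move=> fd.
have cf (z1 z2 : R) : {within `[z1, z2], continuous f}.
  apply: continuous_subspaceT => z; apply: differentiable_continuous.
  by have [d _] := fd z; apply/derivable1_diffP.
have [xy|/ltW xy] := leP y x.
  have [c cxy e] := MVT_segment xy (fun z _ => fd z) (cf y x).
  exists c; last by rewrite e normrM.
  by move: cxy; rewrite in_itv/= => /andP[? ?]; rewrite !ger0_norm; lra.
have [c cxy e] := MVT_segment xy (fun z _ => fd z) (cf x y).
exists c; last by rewrite distrC e normrM (distrC y).
by move: cxy; rewrite in_itv/= => /andP[? ?]; rewrite !ler0_norm; lra.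
Qed.

Lemma norm_sin_le x : `|sin x| <= `|x|.
Proof.
have [c _] := mean_value_norm x 0 (@is_derive_sin R).
rewrite sin0 !subr0 => ->; by rewrite ler_piMl// cos_max.
Qed.

Lemma norm_cosB1_le x : `|cos x - 1| <= `|x|.
Proof.
have [c _] := mean_value_norm x 0 (@is_derive_cos R).
by rewrite cos0 !subr0 => ->; rewrite ler_piMl// normrN sin_max.
Qed.

Lemma norm_cosB1_le_sqr x : `|cos x - 1| <= x ^+ 2.
Proof.
have [c] := mean_value_norm x 0 (@is_derive_cos R).
rewrite cos0 !subr0 => cx ->; rewrite normrN -real_normK ?num_real// expr2.
by rewrite ler_wpM2r// (le_trans (norm_sin_le _)).
Qed.

Lemma norm_sinB_le_sqr x : `|sin x - x| <= x ^+ 2.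
Proof.
have H (z : R) : is_derive z 1 (fun t : R => sin t - t) (cos z - 1).
  by apply: is_deriveB.
have [c] := mean_value_norm x 0 H.
rewrite sin0 !subr0 => cx ->; rewrite -real_normK ?num_real// expr2.
by rewrite ler_wpM2r// (le_trans (norm_cosB1_le _)).
Qed.

Lemma expRN_taylor P : 0 <= P -> 0 <= expR (- P) - 1 + P /\ expR (- P) - 1 + P <= P ^+ 2.
Proof.
move=> P0; split; first by have := expR_ge1Dx (- P); lra.
have e1 := expR_ge1Dx P; have e0 := expR_gt0 (- P).
have e2 : expR (- P) * expR P = 1 by rewrite -expRD addNr expR0.
have : expR (- P) * (1 + P) <= 1 by rewrite -[X in _ <= X]e2 ler_wpM2l// ltW.
have : 0 <= P ^+ 3 by exact: exprn_ge0.
have P1 : 0 < 1 + P by lra.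
move=> P3 le; rewrite -(ler_pM2r P1).
have -> : (expR (- P) - 1 + P) * (1 + P) = expR (- P) * (1 + P) - 1 + P ^+ 2 by ring.
have -> : P ^+ 2 * (1 + P) = P ^+ 2 + P ^+ 3 by ring.
lra.
Qed.

Lemma expRN_le1 P : 0 <= P -> expR (- P) <= 1.
Proof. by move=> P0; rewrite -expR0 ler_expR oppr_le0. Qed.

Lemma expRN_cos_taylor P V : 0 <= P ->
  `|expR (- P) * cos V - 1 + P| <= 2 * (P ^+ 2 + V ^+ 2).
Proof.
move=> P0; have [e1 e2] := expRN_taylor P0.
have -> : expR (- P) * cos V - 1 + P = (expR (- P) - 1 + P) + expR (- P) * (cos V - 1) by ring.
apply: (le_trans (ler_normD _ _)); rewrite ger0_norm// normrM ger0_norm ?expR_ge0//.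
have := norm_cosB1_le_sqr V => h.
have : expR (- P) * `|cos V - 1| <= V ^+ 2.
  by apply: le_trans h; rewrite ler_piMl// expRN_le1.
by have := sqr_ge0 P; have := sqr_ge0 V; lra.
Qed.

Lemma expRN_sin_taylor P V : 0 <= P ->
  `|expR (- P) * sin V - V| <= 2 * (P ^+ 2 + V ^+ 2).
Proof.
move=> P0; have [e1 e2] := expRN_taylor P0.
have -> : expR (- P) * sin V - V = (sin V - V) + (expR (- P) - 1) * sin V by ring.
apply: (le_trans (ler_normD _ _)); rewrite normrM.
have h := norm_sinB_le_sqr V; have h' := norm_sin_le V.
have e3 := expRN_le1 P0.
have : `|expR (- P) - 1| * `|sin V| <= P * `|V|.
  by apply: ler_pM => //; rewrite ler0_norm; lra.
have e4 : 2 * (P * `|V|) <= P ^+ 2 + V ^+ 2.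
  have := sqr_ge0 (P - `|V|); rewrite sqrrB (real_normK (num_real V)).
  by rewrite -mulr_natl; lra.
have := sqr_ge0 P; have := sqr_ge0 V; lra.
Qed.

End trig.

(** * Laplace transforms *)

Section laplace.
Context {R : realType}.
Local Notation mu := (@lebesgue_measure R).
Implicit Types (f g : R -> R) (s w t : R).

(** The value at s + i w. *)
Definition laplace f s w : R[i] :=
  Complex (itg (fun t => cos (w * t) * damp s f t)) (- itg (fun t => sin (w * t) * damp s f t)).

(** This is exp(- (s + i w) t). *)
Definition cexpN s w t : R[i] :=
  Complex (expR (- (s * t)) * cos (w * t)) (- (expR (- (s * t)) * sin (w * t))).

Lemma continuous_scale w : continuous (fun t => w * t).
Proof. by move=> t; apply: cvgM; [exact: cvg_cst|exact: cvg_id]. Qed.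

Lemma measurable_cos w : measurable_fun setT (fun t => cos (w * t)).
Proof.
apply: continuous_measurable_fun => t.
by apply: (@continuous_comp _ _ _ (fun t => w * t) cos);
  [exact: continuous_scale|exact: continuous_cos].
Qed.

Lemma measurable_sin w : measurable_fun setT (fun t => sin (w * t)).
Proof.
apply: continuous_measurable_fun => t.
by apply: (@continuous_comp _ _ _ (fun t => w * t) sin);
  [exact: continuous_scale|exact: continuous_sin].
Qed.

Lemma summable_cos w f : summableR f -> summableR (fun t => cos (w * t) * f t).
Proof.
by apply: (@summableR_bounded _ _ 1); [exact: measurable_cos|move=> t; exact: cos_max].
Qed.

Lemma summable_sin w f : summableR f -> summableR (fun t => sin (w * t) * f t).
Proof.
by apply: (@summableR_bounded _ _ 1); [exact: measurable_sin|move=> t; exact: sin_max].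
Qed.

Lemma complexP (z z' : R[i]) : Re z = Re z' -> Im z = Im z' -> z = z'.
Proof. by case: z z' => [x y] [x' y'] /= -> ->. Qed.

Lemma laplaceD f g s w : summableR (damp s f) -> summableR (damp s g) ->
  laplace (fun t => f t + g t) s w = laplace f s w + laplace g s w.
Proof.
move=> sf sg; rewrite /laplace dampD.
apply: complexP => /=; rewrite -?opprD; [|congr (- _)].
- rewrite -itgD; [|exact: summable_cos..].
  by congr itg; apply/funext => t; rewrite mulrDr.
- rewrite -itgD; [|exact: summable_sin..].
  by congr itg; apply/funext => t; rewrite mulrDr.
Qed.

Lemma laplaceZ r f s w : summableR (damp s f) ->
  laplace (fun t => r * f t) s w = r%:C%C * laplace f s w.
Proof.
move=> sf; rewrite /laplace dampZ; apply: complexP => /=; rewrite mul0r ?subr0 ?addr0 ?mulrN.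
  rewrite -itgZ; last exact: summable_cos.
  by congr itg; apply/funext => t; rewrite mulrCA.
rewrite -itgZ; last exact: summable_sin.
by congr (- _); congr itg; apply/funext => t; rewrite mulrCA.
Qed.

(** The addition formulas turn convolution into multiplication. *)
Lemma laplace_conv f g s w : summableR (damp s f) -> summableR (damp s g) ->
  laplace (convol f g) s w = laplace f s w * laplace g s w.
Proof.
move=> sf sg.
have mf := measurable_damped (summableR_measurable sf).
have mg := measurable_damped (summableR_measurable sg).
rewrite /laplace damp_conv//.
have b1 t : `|cos (w * t)| <= 1 by exact: cos_max.
have b2 t : `|sin (w * t)| <= 1 by exact: sin_max.
have [e1 _] := conv_fubini sf sg (measurable_cos w) b1.
have [e2 _] := conv_fubini sf sg (measurable_sin w) b2.
have cf := summable_cos w sf; have zf := summable_sin w sf.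
have cg := summable_cos w sg; have zg := summable_sin w sg.
set CF := itg (fun t => cos (w * t) * damp s f t).
set SF := itg (fun t => sin (w * t) * damp s f t).
set CG := itg (fun t => cos (w * t) * damp s g t).
set SG := itg (fun t => sin (w * t) * damp s g t).
have i1 r : itg (fun t => cos (w * (t + r)) * damp s f t) = cos (w * r) * CF - sin (w * r) * SF.
  rewrite -!itgZ// -itgB; [|exact: summableRZ..].
  by congr itg; apply/funext => t; rewrite mulrDr cosD; ring.
have i2 r : itg (fun t => sin (w * (t + r)) * damp s f t) = cos (w * r) * SF + sin (w * r) * CF.
  rewrite -!itgZ// -itgD; [|exact: summableRZ..].
  by congr itg; apply/funext => t; rewrite mulrDr sinD; ring.
apply: complexP => /=.
  rewrite e1 (_ : (fun r => _) = fun r => CF * (cos (w * r) * damp s g r) -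
    SF * (sin (w * r) * damp s g r)); last by apply/funext => r; rewrite i1; ring.
  rewrite itgB; [|exact: summableRZ..].
  by rewrite !itgZ// -/CG -/SG; ring.
rewrite e2 (_ : (fun r => _) = fun r => SF * (cos (w * r) * damp s g r) +
    CF * (sin (w * r) * damp s g r)); last by apply/funext => r; rewrite i2; ring.
rewrite itgD; [|exact: summableRZ..].
by rewrite !itgZ// -/CG -/SG; ring.
Qed.

Lemma laplace_shift f s w tau : summableR (damp s f) ->
  laplace (fun t => f (t - tau)) s w = cexpN s w tau * laplace f s w.
Proof.
move=> sf; rewrite /laplace /cexpN.
have cf := summable_cos w sf; have zf := summable_sin w sf.
set CF := itg (fun t => cos (w * t) * damp s f t).
set SF := itg (fun t => sin (w * t) * damp s f t).
have E : damp s (fun t => f (t - tau)) = fun t => expR (- (s * tau)) * damp s f (t - tau).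
  exact: damp_shift.
apply: complexP => /=; rewrite ?mulrNN ?mulrN ?mulNr -?opprD ?opprK; [|congr (- _)].
  pose G t := expR (- (s * tau)) * cos (w * tau) * (cos (w * t) * damp s f t) -
     expR (- (s * tau)) * sin (w * tau) * (sin (w * t) * damp s f t).
  transitivity (itg (fun t => G (t - tau))).
    congr itg; apply/funext => t; rewrite E /G.
    have -> : w * t = w * tau + w * (t - tau) by ring.
    by rewrite cosD; ring.
  rewrite itg_shift; last by apply: measurable_funB; apply: summableR_measurable; exact: summableRZ.
  rewrite itgB; [|exact: summableRZ..].
  by rewrite !itgZ// -/CF -/SF; ring.
pose G t := expR (- (s * tau)) * sin (w * tau) * (cos (w * t) * damp s f t) +
     expR (- (s * tau)) * cos (w * tau) * (sin (w * t) * damp s f t).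
transitivity (itg (fun t => G (t - tau))).
  congr itg; apply/funext => t; rewrite E /G.
  have -> : w * t = w * tau + w * (t - tau) by ring.
  by rewrite sinD; ring.
rewrite itg_shift; last by apply: measurable_funD; apply: summableR_measurable; exact: summableRZ.
rewrite itgD; [|exact: summableRZ..].
by rewrite !itgZ// -/CF -/SF; ring.
Qed.

Lemma normc_le_sum (z : R[i]) : normc z <= `|Re z| + `|Im z|.
Proof.
case: z => x y /=; rewrite -(@ler_pXn2r _ 2)// ?nnegrE ?sqrtr_ge0 ?addr_ge0//.
rewrite sqr_sqrtr ?addr_ge0 ?sqr_ge0// sqrrD !real_normK ?num_real//.
by rewrite lerD2r lerDl mulrn_wge0// mulr_ge0.
Qed.

Lemma Re_le_normc (z : R[i]) : `|Re z| <= normc z.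
Proof.
case: z => x y /=; rewrite -(@ler_pXn2r _ 2)// ?nnegrE ?sqrtr_ge0//.
by rewrite sqr_sqrtr ?addr_ge0 ?sqr_ge0// real_normK ?num_real// lerDl sqr_ge0.
Qed.

Lemma normc_ge0 (z : R[i]) : 0 <= normc z.
Proof. by case: z => x y; exact: sqrtr_ge0. Qed.

Lemma sqr_normcE (z : R[i]) : normc z ^+ 2 = Re z ^+ 2 + Im z ^+ 2.
Proof. by case: z => x y /=; rewrite sqr_sqrtr// addr_ge0 ?sqr_ge0. Qed.

Lemma normc_cexpN s w t : normc (cexpN s w t) = expR (- (s * t)).
Proof.
rewrite /cexpN /= sqrrN !exprMn -mulrDr cos2Dsin2 mulr1 sqrtr_sqr.
by rewrite ger0_norm// expR_ge0.
Qed.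

Lemma normc_laplace f s w : summableR (damp s f) -> normc (laplace f s w) <= 2 * wnorm s f.
Proof.
move=> sf; apply: (le_trans (normc_le_sum _)); rewrite /= normrN mulr_natl mulr2n.
have nf := summableR_norm sf.
apply: lerD.
  apply: (le_trans (itg_norm (summable_cos w sf))); apply: itg_le => // [|t].
    exact: summableR_norm (summable_cos w sf).
  by rewrite normrM ler_piMl// cos_max.
apply: (le_trans (itg_norm (summable_sin w sf))); apply: itg_le => // [|t].
  exact: summableR_norm (summable_sin w sf).
by rewrite normrM ler_piMl// sin_max.
Qed.

End laplace.

(** * Laplace transforms of subexponential functions *)

Section subexponential.
Context {R : realType}.
Local Notation mu := (@lebesgue_measure R).
Implicit Types (f g : R -> R) (s w t p v : R) (z : R[i]).

Lemma normcD z z' : normc (z + z') <= normc z + normc z'.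
Proof. exact: (@le_normcD R). Qed.

Lemma normcNE z : normc (- z) = normc z.
Proof. by case: z => x y /=; rewrite !sqrrN. Qed.

Lemma normcB z z' : normc (z - z') <= normc z + normc z'.
Proof. by apply: (le_trans (normcD _ _)); rewrite normcNE. Qed.

Lemma normc_real x : normc (x%:C)%C = `|x| :> R.
Proof. by rewrite /= expr0n/= addr0 sqrtr_sqr. Qed.

Lemma normc_small z (D : R) : (forall e, 0 < e -> normc z <= D * e) -> z = 0.
Proof.
move=> H; apply: eq0_normc; apply/eqP; rewrite eq_le normc_ge0 andbT.
have D0 : 0 <= D by have := H 1 ltr01; rewrite mulr1; apply: le_trans; exact: normc_ge0.
apply/ler_addgt0Pr => e e0; rewrite add0r.
have D1 : 0 < D + 1 by rewrite ltr_wpDl.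
apply: (le_trans (H (e / (D + 1)) (divr_gt0 e0 D1))).
rewrite mulrCA; apply: ler_piMr; first exact: ltW.
by rewrite ler_pdivrMr// mul1r lerDl.
Qed.

Lemma cexpN_taylor s w t : 0 <= s * t ->
  normc (cexpN s w t - 1 + (t%:C)%C * Complex s w) <= 4 * (s ^+ 2 + w ^+ 2) * t ^+ 2.
Proof.
move=> st0; apply: (le_trans (normc_le_sum _)).
have h1 := expRN_cos_taylor (w * t) st0; have h2 := expRN_sin_taylor (w * t) st0.
have -> : Re (cexpN s w t - 1 + (t%:C)%C * Complex s w) =
  expR (- (s * t)) * cos (w * t) - 1 + s * t by rewrite /=; ring.
have -> : Im (cexpN s w t - 1 + (t%:C)%C * Complex s w) =
  - (expR (- (s * t)) * sin (w * t) - w * t) by rewrite /=; ring.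
rewrite normrN; move: h1 h2; rewrite !exprMn; lra.
Qed.

Definition subexponential f := causal f /\ forall s, 0 < s -> summableR (damp s f).

Lemma subexpD f g : subexponential f -> subexponential g ->
  subexponential (fun t => f t + g t).
Proof.
move=> [f0 sf] [g0 sg]; split=> [t t0|s s0]; first by rewrite f0// g0// addr0.
by apply: summable_dampD; [exact: sf|exact: sg].
Qed.

Lemma subexpZ r f : subexponential f -> subexponential (fun t => r * f t).
Proof.
move=> [f0 sf]; split=> [t t0|s s0]; first by rewrite f0// mulr0.
by apply: summable_dampZ; exact: sf.
Qed.

Lemma subexp_shift tau f : 0 <= tau -> subexponential f ->
  subexponential (fun t => f (t - tau)).
Proof.
move=> tau0 [f0 sf]; split=> [t t0|s s0]; first by rewrite f0// lerBlDr (le_trans t0)// add0r.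
by apply: summable_damp_shift; exact: sf.
Qed.

Lemma subexp_theta : subexponential (@theta R).
Proof. by split=> [|s s0]; [exact: causal_theta|exact: (itg_damp_theta s0).1]. Qed.

Lemma subexp_fker a : 0 < a -> a <= 1 -> subexponential (fker a : R -> R).
Proof.
move=> a0 a1; split=> [t t0|s s0]; first exact: fker_le0.
exact: summable_damp_fker.
Qed.

Lemma subexp_bounded f (M : R) : causal f -> measurable_fun setT f ->
  (forall t, `|f t| <= M) -> subexponential f.
Proof.
move=> f0 mf fM; split=> // s s0.
have M0 : 0 <= M by exact: le_trans (fM 0).
apply: (summableR_le (measurable_damp s mf) (summableRZ M (itg_damp_theta s0).1)) => t.
rewrite /damp (mulrCA M) !normrM ler_wpM2l// -normrM.
have [t0|t0] := leP t 0; first by rewrite f0// normr0.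
by rewrite /theta t0 mulr1 (ger0_norm M0).
Qed.

Lemma subexp_mulX f : subexponential f -> subexponential (fun t => t * f t).
Proof.
move=> [f0 sf]; split=> [t t0|s s0]; first by rewrite f0// mulr0.
have h0 : 0 < s / 2 by rewrite divr_gt0.
have mf := measurable_damped (summableR_measurable (sf _ h0)).
apply: (summableR_le _ (summableRZ (s / 2)^-1 (sf _ h0))) => [|t].
  apply: measurable_damp; apply: measurable_funM => //; exact: measurable_id.
have [t0|t0] := leP t 0; first by rewrite /damp f0// !mulr0.
rewrite /damp mulrA [in X in _ <= X]mulrA !normrM ler_wpM2r//.
rewrite !gtr0_norm ?expR_gt0//; last by rewrite invr_gt0.
rewrite mulrC ler_pdivlMl// mulrA.
have -> : expR (- (s / 2 * t)) = expR (s / 2 * t) * expR (- (s * t)).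
  by rewrite -expRD; congr expR; field.
rewrite ler_wpM2r ?expR_ge0//; have := expR_ge1Dx (s / 2 * t); lra.
Qed.

(** Second order expansion of exp(- (p + i v) t) under the integral; the two
components are bounded separately. *)
Lemma laplace_taylor f s w p v : subexponential f -> 0 < s -> 0 <= p ->
  normc (laplace f (s + p) (w + v) - laplace f s w +
         Complex p v * laplace (fun t => t * f t) s w) <=
  8 * (p ^+ 2 + v ^+ 2) * wnorm s (fun t => t * (t * f t)).
Proof.
move=> ef s0 p0; have e1 := subexp_mulX ef; have e2 := subexp_mulX e1.
have sp0 : 0 < s + p by rewrite ltr_wpDr.
pose X t := expR (- (p * t)) * cos (v * t) - 1 + p * t.
pose Y t := expR (- (p * t)) * sin (v * t) - v * t.
have sf := ef.2 _ s0; have s1 := e1.2 _ s0; have s2 := e2.2 _ s0; have sfp := ef.2 _ sp0.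
have dE t : damp (s + p) f t = expR (- (p * t)) * damp s f t.
  rewrite /damp mulrA -expRD; congr (expR _ * _); ring.
have d1 t : damp s (fun t => t * f t) t = t * damp s f t by rewrite /damp; ring.
have bound (h : R -> R) : summableR h ->
   (forall t, `|h t| <= (`|X t| + `|Y t|) * `|damp s f t|) ->
   `|itg h| <= 4 * (p ^+ 2 + v ^+ 2) * wnorm s (fun t => t * (t * f t)).
  move=> sh hb; have sn := summableR_norm s2.
  apply: (le_trans (itg_norm sh)); rewrite -itgZ//.
  apply: itg_le => [||t]; [exact: summableR_norm|exact: summableRZ|].
  apply: (le_trans (hb t)); have [t0|t0] := leP t 0.
    by rewrite /damp ef.1// !mulr0 normr0 !mulr0.
  have -> : damp s (fun t => t * (t * f t)) t = t ^+ 2 * damp s f t by rewrite /damp; ring.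
  rewrite (normrM (t ^+ 2)) mulrA ler_wpM2r// (ger0_norm (sqr_ge0 t)).
  have pt0 : 0 <= p * t by rewrite mulr_ge0// ltW.
  have h1 := expRN_cos_taylor (v * t) pt0; have h2 := expRN_sin_taylor (v * t) pt0.
  by move: h1 h2; rewrite /X /Y !exprMn; lra.
have -> : 8 * (p ^+ 2 + v ^+ 2) * wnorm s (fun t => t * (t * f t)) =
  4 * (p ^+ 2 + v ^+ 2) * wnorm s (fun t => t * (t * f t)) +
  4 * (p ^+ 2 + v ^+ 2) * wnorm s (fun t => t * (t * f t)) by ring.
apply: (le_trans (normc_le_sum _)); apply: lerD.
  pose h t := (cos (w * t) * X t - sin (w * t) * Y t) * damp s f t.
  have hE : h = fun t => cos ((w + v) * t) * damp (s + p) f t - cos (w * t) * damp s f t +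
     (p * (cos (w * t) * damp s (fun t => t * f t) t) + v * (sin (w * t) * damp s (fun t => t * f t) t)).
    by apply/funext => t; rewrite /h dE d1 (mulrDl w v t) cosD /X /Y; ring.
  have c1 := summable_cos (w + v) sfp; have c2 := summable_cos w sf.
  have c3 := summableRZ p (summable_cos w s1); have c4 := summableRZ v (summable_sin w s1).
  have c12 := summableRB c1 c2; have c34 := summableRD c3 c4.
  have sh : summableR h by rewrite hE; exact: summableRD.
  rewrite (_ : Re _ = itg h); last first.
    rewrite hE itgD// itgB// itgD// itgZ ?itgZ; [|exact: summable_sin|exact: summable_cos].
    by rewrite /=; ring.
  apply: bound => // t; rewrite /h normrM ler_wpM2r//.
  apply: (le_trans (ler_normB _ _)); rewrite !normrM; apply: lerD.
    by rewrite ler_piMl// cos_max.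
  by rewrite ler_piMl// sin_max.
pose h t := - (sin (w * t) * X t + cos (w * t) * Y t) * damp s f t.
have hE : h = fun t => sin (w * t) * damp s f t - sin ((w + v) * t) * damp (s + p) f t +
   (v * (cos (w * t) * damp s (fun t => t * f t) t) - p * (sin (w * t) * damp s (fun t => t * f t) t)).
  by apply/funext => t; rewrite /h dE d1 (mulrDl w v t) sinD /X /Y; ring.
have c1 := summable_sin (w + v) sfp; have c2 := summable_sin w sf.
have c3 := summableRZ v (summable_cos w s1); have c4 := summableRZ p (summable_sin w s1).
have c12 := summableRB c2 c1; have c34 := summableRB c3 c4.
have sh : summableR h by rewrite hE; exact: summableRD.
rewrite (_ : Im _ = itg h); last first.
  rewrite hE itgD// itgB// itgB// itgZ ?itgZ; [|exact: summable_sin|exact: summable_cos].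
  by rewrite /=; ring.
apply: bound => // t; rewrite /h normrM normrN ler_wpM2r//.
apply: (le_trans (ler_normD _ _)); rewrite !normrM; apply: lerD.
  by rewrite ler_piMl// sin_max.
by rewrite ler_piMl// cos_max.
Qed.

End subexponential.

(** * Accumulation of zeros *)

Section zeros.
Context {R : realType}.
Local Notation mu := (@lebesgue_measure R).
Implicit Types (f g : R -> R) (s w t p v : R) (z : R[i]).

(** Bolzano and Weierstrass. *)
Lemma bounded_cluster (u : nat -> R) (W : R) : (forall n, `|u n| <= W) ->
  exists2 x, `|x| <= W & forall e, 0 < e -> forall N, exists2 n, (N <= n)%N & `|u n - x| < e.
Proof.
move=> uW.
have [|x [xW xc]] := @segment_compact R (- W) W (u n @[n --> \oo]) _.
  by exists 0%N => // n _ /=; rewrite in_itv/= -ler_norml.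
exists x; first by move: xW; rewrite /= in_itv/= -ler_norml.
move=> e e0 N.
have [|_ [[n Nn <-] xe]] := xc (u @` [set n | (N <= n)%N]) (ball x e) _ (nbhsx_ballx _ _ e0).
  by exists N => // n Nn; exists n.
by exists n => //; rewrite distrC.
Qed.

Lemma normc_le2 p v e : `|p| <= e -> `|v| <= e -> normc (Complex p v) <= 2 * e.
Proof. by move=> pe ve; apply: (le_trans (normc_le_sum _)) => /=; lra. Qed.

(** Letting the displacement tend to 0 in the Taylor expansion gives the zero of the
function; dividing by the displacement, which is not 0 since p > 0, then gives the
zero of the derivative. *)
Lemma double_zero f (c s w : R) : subexponential f -> 0 < s ->
  (forall e, 0 < e -> exists p v, [/\ 0 < p, p < e, `|v| < e &
     c%:C%C + laplace f (s + p) (w + v) = 0]) ->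
  c%:C%C + laplace f s w = 0 /\ laplace (fun t => t * f t) s w = 0.
Proof.
move=> ef s0 H.
set L := laplace f s w; set L1 := laplace _ s w.
set T := wnorm s (fun t => t * (t * f t)).
have T0 : 0 <= T by exact: wnorm_ge0.
have key e : 0 < e -> exists z, [/\ 0 < normc z, normc z <= 2 * e &
    normc (z * L1 - (c%:C%C + L)) <= 8 * normc z ^+ 2 * T].
  move=> e0; have [p [v [p0 pe ve E]]] := H e e0.
  exists (Complex p v); split.
  - by apply: lt_le_trans (Re_le_normc _) => /=; rewrite gtr0_norm.
  - by apply: normc_le2; [rewrite ger0_norm; exact: ltW|exact: ltW].
  rewrite sqr_normcE.
  have -> : Complex p v * L1 - (c%:C%C + L) =
      laplace f (s + p) (w + v) - L + Complex p v * L1.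
    have -> : laplace f (s + p) (w + v) = - c%:C%C by apply/eqP; rewrite -addr_eq0 addrC E.
    by ring.
  exact: laplace_taylor (ltW p0).
have LE : c%:C%C + L = 0.
  apply: (@normc_small _ _ (2 * normc L1 + 32 * T + 1)) => e' e'0.
  pose e := Num.min e' 1.
  have e0 : 0 < e by rewrite /e lt_min e'0 ltr01.
  have ee' : e <= e' by rewrite ge_min lexx.
  have e1 : e <= 1 by rewrite ge_min lexx orbT.
  have [z [z0 ze le]] := key e e0.
  have -> : c%:C%C + L = z * L1 - (z * L1 - (c%:C%C + L)) by ring.
  apply: (le_trans (normcB _ _)); rewrite normcM.
  have h1 : normc z * normc L1 <= 2 * e * normc L1 by rewrite ler_wpM2r// normc_ge0.
  have h2 : 8 * normc z ^+ 2 * T <= 8 * (4 * e) * T.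
    rewrite ler_wpM2r// ler_pM2l// expr2.
    apply: (@le_trans _ _ (2 * e * (2 * e))); first by apply: ler_pM => //; exact: ltW.
    by have : e * e <= e by [rewrite ler_piMr// ltW]; lra.
  apply: (@le_trans _ _ ((2 * normc L1 + 32 * T + 1) * e)); first by have := ltW e0; lra.
  by rewrite ler_wpM2l// addr_ge0// addr_ge0 ?mulr_ge0// normc_ge0.
split=> //.
apply: (@normc_small _ _ (16 * T)) => e e0.
have [z [z0 ze]] := key e e0; rewrite LE subr0 normcM => le.
rewrite -(ler_pM2l z0); apply: (le_trans le).
have -> : normc z * (16 * T * e) = 8 * (normc z * (2 * e)) * T by ring.
by rewrite ler_wpM2r// ler_pM2l// expr2 ler_pM2l.
Qed.

(** The zeros on the lines slightly further right have bounded ordinates, so they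
accumulate at a point of the given line, where [double_zero] applies. *)
Lemma double_zero_on_lines f (c lam W : R) : subexponential f ->
  (forall s, 0 < s -> s < lam -> exists2 w, `|w| <= W & c%:C%C + laplace f s w = 0) ->
  forall s, 0 < s -> s < lam -> exists w, [/\ `|w| <= W, c%:C%C + laplace f s w = 0 &
    laplace (fun t => t * f t) s w = 0].
Proof.
move=> ef H s s0 sl.
pose d n : R := (lam - s) / 2 / n.+1%:R.
have d0 n : 0 < d n by rewrite !divr_gt0// subr_gt0.
have dl n : s + d n < lam.
  have : d n <= (lam - s) / 2.
    by rewrite ler_pdivrMr// ler_peMr ?ler1n// divr_ge0// subr_ge0 ltW.
  by move: sl; lra.
have ex n : {w | `|w| <= W & c%:C%C + laplace f (s + d n) w = 0}.
  by apply: cid2; apply: H => //; rewrite addr_gt0.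
have wW n : `|s2val (ex n)| <= W by case: (ex n).
have [x xW xc] := bounded_cluster wW.
exists x.
suff [? ?] : c%:C%C + laplace f s x = 0 /\ laplace (fun t => t * f t) s x = 0 by split.
apply: double_zero => // e e0.
pose N := Num.truncn ((lam - s) / e).
have [n Nn we] := xc e e0 N.
exists (d n), (s2val (ex n) - x); split=> //.
  have h1 : (lam - s) / e < N.+1%:R by exact: truncnS_gt.
  have h2 : N.+1%:R <= n.+1%:R :> R by rewrite ler_nat.
  rewrite ltr_pdivrMr// in h1.
  rewrite /d ltr_pdivrMr//; have := ler_wpM2r (ltW e0) h2.
  have : 0 < lam - s by rewrite subr_gt0.
  by move: h1; rewrite (mulrC e); lra.
by rewrite (addrC x) subrK; case: (ex n).
Qed.

(** Comparing the unit step with its translate by h computes its transform: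
the difference is the indicator of an interval of length h, and h tends to 0. *)
Lemma laplace_theta s w : 0 < s -> Complex s w * laplace theta s w = 1.
Proof.
move=> s0; have [st it] := itg_damp_theta s0.
pose L := laplace theta s w.
pose D := 4 * (s ^+ 2 + w ^+ 2) * normc L + (s + 2 * `|w|).
suff key h : 0 < h -> normc (Complex s w * L - 1) <= D * h.
  by apply/eqP; rewrite -subr_eq0; apply/eqP; exact: normc_small key.
move=> h0.
pose q (t : R) : R := theta t - theta (t - h).
have sq : summableR (damp s q).
  by apply: summable_dampB => //; exact: summable_damp_shift.
have q0 t : 0 <= q t by rewrite subr_ge0; apply: le_theta; rewrite gerBl ltW.
have qE : laplace q s w = (1 - cexpN s w h) * L.
  have -> : laplace q s w = laplace (fun t => theta t + (-1) * theta (t - h)) s w.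
    by congr (laplace _ s w); apply/funext => t; rewrite /q mulN1r.
  have ss := summable_damp_shift h st.
  rewrite laplaceD//; last exact: summable_dampZ.
  rewrite laplaceZ// laplace_shift// mulrBl mul1r; congr (_ + _).
  by rewrite rmorphN1 mulN1r.
have I : itg (damp s q) = (1 - expR (- (s * h))) / s.
  have -> : damp s q = fun t => damp s theta t - damp s (fun t => theta (t - h)) t.
    by apply/funext => t; rewrite /damp /q mulrBr.
  rewrite itgB//; last exact: summable_damp_shift.
  rewrite it damp_shift itgZ; last exact: summableR_shift.
  by rewrite itg_shift ?it ?mulrBl ?mul1r//; exact: summableR_measurable.
have Ih : itg (damp s q) <= h.
  rewrite I ler_pdivrMr//; have := expR_ge1Dx (- (s * h)); lra.
have dq0 t : 0 <= damp s q t by rewrite mulr_ge0// expR_ge0.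
have bound (f : R -> R) : measurable_fun setT f -> (forall t, 0 <= t -> `|f t| <= `|w| * t) ->
   `|itg (fun t => f t * damp s q t)| <= `|w| * h ^+ 2.
  move=> mf fb.
  have le t : `|f t * damp s q t| <= `|w| * h * damp s q t.
    rewrite normrM (ger0_norm (dq0 t)).
    have [t0|t0] := leP t 0.
      rewrite (_ : damp s q t = 0) ?mulr0// /damp /q /theta ltNge t0 ltNge.
      by rewrite lerBlDr (le_trans t0) ?subrr ?mulr0// add0r ltW.
    have [th|th] := leP t h.
      rewrite ler_wpM2r//; apply: (le_trans (fb t (ltW t0))).
      by rewrite ler_wpM2l.
    by rewrite (_ : damp s q t = 0) ?mulr0// /damp /q /theta t0 subr_gt0 th subrr mulr0.
  have sf : summableR (fun t => f t * damp s q t).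
    apply: (summableR_le _ (summableRZ (`|w| * h) sq)) => [|t].
      by apply: measurable_funM => //; exact: summableR_measurable.
    by apply: (le_trans (le t)); exact: ler_norm.
  apply: (le_trans (itg_norm sf)).
  apply: (@le_trans _ _ (itg (fun t => `|w| * h * damp s q t))).
    by apply: itg_le => //; [exact: summableR_norm|exact: summableRZ].
  by rewrite itgZ// expr2 mulrA ler_wpM2l// mulr_ge0// ltW.
have nw t : 0 <= t -> `|w * t| = `|w| * t by move=> t0; rewrite normrM (ger0_norm t0).
have E1 : `|Re (laplace q s w) - itg (damp s q)| <= `|w| * h ^+ 2.
  rewrite /= -itgB//; last exact: summable_cos.
  have -> : (fun t => cos (w * t) * damp s q t - damp s q t) =
     fun t => (cos (w * t) - 1) * damp s q t by apply/funext => t; ring.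
  apply: bound => [|t t0]; first by apply: measurable_funB => //; exact: measurable_cos.
  by rewrite -nw//; exact: norm_cosB1_le.
have E2 : `|Im (laplace q s w)| <= `|w| * h ^+ 2.
  rewrite /= normrN; apply: bound => [|t t0]; first exact: measurable_sin.
  by rewrite -nw//; exact: norm_sin_le.
have E3 : `|itg (damp s q) - h| <= s * h ^+ 2.
  have [] := @expRN_taylor _ (s * h) (mulr_ge0 (ltW s0) (ltW h0)).
  have -> : itg (damp s q) - h = - ((expR (- (s * h)) - 1 + s * h) / s).
    by rewrite I; field; rewrite gt_eqF.
  move=> e1 e2; rewrite normrN ger0_norm ?divr_ge0 ?(ltW s0)// ler_pdivrMr//.
  by apply: (le_trans e2); rewrite exprMn expr2 mulrAC lexx.
have E4 : normc (laplace q s w - h%:C%C) <= (s + 2 * `|w|) * h ^+ 2.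
  apply: (le_trans (normc_le_sum _)).
  have -> : Re (laplace q s w - h%:C%C) =
     (Re (laplace q s w) - itg (damp s q)) + (itg (damp s q) - h) by rewrite /=; ring.
  have -> : Im (laplace q s w - h%:C%C) = Im (laplace q s w) by rewrite /=; ring.
  have := ler_normD (Re (laplace q s w) - itg (damp s q)) (itg (damp s q) - h).
  by move: E1 E2 E3; lra.
have E5 := @cexpN_taylor _ s w h (mulr_ge0 (ltW s0) (ltW h0)).
have hz : 0 < normc (h%:C%C : R[i]) by rewrite normc_real gtr0_norm.
rewrite -(ler_pM2l hz) -normcM.
have -> : h%:C%C * (Complex s w * L - 1) =
   (cexpN s w h - 1 + h%:C%C * Complex s w) * L + (laplace q s w - h%:C%C).
  by rewrite qE; ring.
apply: (le_trans (normcD _ _)); rewrite normcM normc_real (gtr0_norm h0).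
have h5 := ler_wpM2r (normc_ge0 L) E5.
have -> : h * (D * h) = 4 * (s ^+ 2 + w ^+ 2) * h ^+ 2 * normc L + (s + 2 * `|w|) * h ^+ 2.
  by rewrite /D; ring.
exact: lerD.
Qed.


End zeros.

(** * Decay of the transform of the kernel *)

Section zero_free_line.
Context {R : realType}.
Local Notation mu := (@lebesgue_measure R).
Implicit Types (f g : R -> R) (s w t p v : R) (z : R[i]).

Lemma fker_nonincreasing a t p : a <= 1 -> 0 < a -> 0 < t -> t <= p ->
  fker a p <= fker a t :> R.
Proof.
move=> a1 a0 t0 tp; have p0 : 0 < p by exact: lt_le_trans tp.
have G0 : 0 <= (Gamma a)^-1 by rewrite invr_ge0 ltW// Gamma_gt0.
rewrite /fker ler_wpM2l// /pw t0 p0.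
have -> : a - 1 = - (1 - a) by ring.
rewrite !powRN lef_pV2 ?posrE ?powR_gt0//.
by apply: ge0_ler_powR; rewrite ?nnegrE ?subr_ge0//; exact: ltW.
Qed.

(** Translating by half a period changes the sign of the oscillating factor, so
the transform of a decreasing function only sees its mass near the origin. *)
Lemma laplace_fker_decay a s w : 0 < a -> a <= 1 -> 0 < s -> w != 0 ->
  normc (laplace (fker a) s w) <= 2 * prim (fker a) (2 * (pi / `|w|)).
Proof.
move=> a0 a1 s0 w0; pose h := pi / `|w|.
have h0 : 0 < h by rewrite divr_gt0 ?pi_gt0// normr_gt0.
have wh : w * h = pi \/ w * h = - pi.
  rewrite /h; have [wp|wn|/eqP] := ltgtP 0 w; last by rewrite eq_sym (negPf w0).
    by left; rewrite gtr0_norm// mulrC divfK.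
  by right; rewrite ltr0_norm// invrN mulrN mulrN mulrC divfK.
have ch t : cos (w * (t + h)) = - cos (w * t).
  by rewrite mulrDr; case: wh => ->; rewrite ?cosDpi// cosB cospi sinpi mulr0 addr0 mulrN1.
have zh t : sin (w * (t + h)) = - sin (w * t).
  by rewrite mulrDr; case: wh => ->; rewrite ?sinDpi// sinB cospi sinpi mulr0 subr0 mulrN1.
pose F := damp s (fker a).
have sF : summableR F by exact: summable_damp_fker.
have sFh : summableR (fun t => F (t - h)) by exact: summableR_shift.
have F0 t : 0 <= F t by rewrite mulr_ge0 ?expR_ge0 ?fker_ge0.
have sc : summableR (fun s => theta (2 * h - s) * F s).
  by apply: (@summable_cut _ 0) => //; rewrite (_ : damp 0 F = F)//; apply/funext => t;
    rewrite /damp mul0r oppr0 expR0 mul1r.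
have dF t : `|F t - F (t - h)| <= F (t - h) - F t + 2 * (theta (2 * h - t) * F t).
  have [th|th] := leP t h.
    rewrite (_ : F (t - h) = 0); last by rewrite /F /damp fker_le0 ?mulr0// subr_le0.
    rewrite /theta ifT; last by move: h0 th; lra.
    by rewrite subr0 ger0_norm//; lra.
  have Fth : F t <= F (t - h).
    apply: ler_pM; rewrite ?expR_ge0 ?fker_ge0//.
      by rewrite ler_expR lerN2 ler_wpM2l ?ltW// ltrBlDr ltrDl.
    by apply: fker_nonincreasing; rewrite ?subr_gt0// lerBlDr lerDl ltW.
  rewrite ler0_norm ?subr_le0// opprB lerDl mulr_ge0// mulr_ge0// theta_ge0//.
have mass : itg (fun t => `|F t - F (t - h)|) <= 2 * prim (fker a) (2 * h).
  apply: (@le_trans _ _ (itg (fun t => F (t - h) - F t + 2 * (theta (2 * h - t) * F t)))).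
    apply: itg_le => //; first exact: summableR_norm (summableRB sF sFh).
    by apply: summableRD; [exact: summableRB|exact: summableRZ].
  rewrite itgD; [|exact: summableRB|exact: summableRZ].
  rewrite itgB// itg_shift ?subrr ?add0r; last exact: summableR_measurable.
  rewrite itgZ// ler_pM2l//; apply: itg_le => //.
    exact: (summable_cut _ ler01 (summable_damp_fker a0 a1 ltr01)).
  move=> t; rewrite ler_wpM2l ?theta_ge0// /F /damp.
  have [t0|t0] := leP t 0; first by rewrite fker_le0// mulr0.
  by rewrite ler_piMl ?fker_ge0// expRN_le1// mulr_ge0// ltW.
have half (osc : R -> R) : measurable_fun setT osc -> (forall t, `|osc t| <= 1) ->
   (forall t, osc (t + h) = - osc t) ->
   `|itg (fun t => osc t * F t)| <= prim (fker a) (2 * h).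
  move=> mo o1 oh.
  have s1 := summableR_bounded mo o1 sF; have s2 := summableR_bounded mo o1 sFh.
  have E : itg (fun t => osc t * F (t - h)) = - itg (fun t => osc t * F t).
    rewrite -[RHS]mulN1r -itgZ// -(itg_shift h (summableR_measurable (summableRZ (-1) s1))).
    by congr itg; apply/funext => t; have := oh (t - h); rewrite subrK => ->; ring.
  have : `|2 * itg (fun t => osc t * F t)| <= 2 * prim (fker a) (2 * h).
    have -> : 2 * itg (fun t => osc t * F t) = itg (fun t => osc t * (F t - F (t - h))).
      transitivity (itg (fun t => osc t * F t) - itg (fun t => osc t * F (t - h))).
        by rewrite E; ring.
      by rewrite -itgB//; congr itg; apply/funext => t; ring.
    have sd := summableRB sF sFh; have s3 := summableR_bounded mo o1 sd.
    apply: le_trans mass; apply: (le_trans (itg_norm s3)).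
    apply: itg_le; [exact: summableR_norm|exact: summableR_norm|move=> t].
    by rewrite normrM ler_piMl.
  by rewrite normrM normr_nat ler_pM2l.
apply: (le_trans (normc_le_sum _)); rewrite /= normrN mulr_natl mulr2n; apply: lerD.
  by apply: half => //; [exact: measurable_cos|move=> t; exact: cos_max].
by apply: half => //; [exact: measurable_sin|move=> t; exact: sin_max].
Qed.

(** Uniformity in s is what bounds the zeros on all lines of the strip at once. *)
Lemma laplace_fker_small a e : 0 < a -> a <= 1 -> 0 < e -> exists2 W : R, 0 < W &
  forall s w, 0 < s -> W <= `|w| -> normc (laplace (fker a) s w) <= e.
Proof.
move=> a0 a1 e0.
have c0 : {for (0 : R), continuous (prim (fker a))}.
  exact: (continuous_prim ler01 (summable_damp_fker a0 a1 ltr01)).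
have p0 : prim (fker a) 0 = 0 :> R by apply: prim_causal => //; exact: fker_le0.
have /cvgrPdist_lt /(_ _ (divr_gt0 e0 (ltr0Sn _ 1)))[d /= d0 H] := c0.
have q0 : 0 < 2 * pi :> R by rewrite mulr_gt0// pi_gt0.
exists (2 * (2 * pi) / d); first by rewrite divr_gt0// mulr_gt0.
move=> s w s0 wW.
have w0 : 0 < `|w| by apply: lt_le_trans wW; rewrite divr_gt0// mulr_gt0.
apply: (le_trans (laplace_fker_decay a0 a1 s0 _)); first by rewrite -normr_gt0.
have {}H := H (2 * (pi / `|w|)); rewrite p0 !sub0r !normrN in H.
have t0 : 0 <= 2 * (pi / `|w|) :> R by rewrite mulr_ge0// divr_ge0 ?pi_ge0.
have : `|prim (fker a) (2 * (pi / `|w|))| < e / 2.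
  apply: H; rewrite /ball_/= sub0r normrN (ger0_norm t0).
  have -> : 2 * (pi / `|w|) = 2 * pi / `|w| :> R by rewrite mulrA.
  rewrite ltr_pdivrMr//; move: wW; rewrite ler_pdivrMr// (mulrC _ d); move: q0; lra.
by move=> /(le_lt_trans (ler_norm _)); lra.
Qed.

(** By continuity and compactness for |w| <= W, by hypothesis beyond. *)
Lemma laplace_gap f (c W s : R) : subexponential f -> 0 < s ->
  (forall w, `|w| <= W -> c%:C%C + laplace f s w <> 0) ->
  (forall w, W <= `|w| -> 2^-1 <= normc (c%:C%C + laplace f s w)) ->
  exists2 k, 0 < k & forall w, k <= normc (c%:C%C + laplace f s w).
Proof.
move=> ef s0 nz far; apply: contrapT => H.
have ex n : {w | normc (c%:C%C + laplace f s w) < 2^-1 / n.+1%:R}.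
  apply: cid; apply: contrapT => no; apply: H; exists (2^-1 / n.+1%:R) => [|w].
    by rewrite divr_gt0.
  by rewrite leNgt; apply/negP => lt; apply: no; exists w.
have wW n : `|sval (ex n)| <= W.
  case: (ex n) => w /= lt; rewrite leNgt; apply/negP => /ltW/far.
  rewrite leNgt => /negP; apply; apply: (lt_le_trans lt).
  by rewrite ler_pdivrMr// ler_peMr ?ler1n.
have [x xW xc] := bounded_cluster wW.
apply: (nz x xW).
set L1 := laplace (fun t => t * f t) s x; set T := wnorm s (fun t => t * (t * f t)).
have T0 : 0 <= T by exact: wnorm_ge0.
have L0 := normc_ge0 L1.
apply: (@normc_small _ _ (1 + normc L1 + 8 * T)) => e' e'0.
pose e := Num.min e' 1.
have e0 : 0 < e by rewrite /e lt_min e'0 ltr01.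
have ee' : e <= e' by rewrite ge_min lexx.
have e1 : e <= 1 by rewrite ge_min lexx orbT.
have [n Nn we] := xc e e0 (Num.truncn e^-1).
set v := sval (ex n) - x in we.
have := laplace_taylor x v ef s0 (lexx 0); rewrite addr0 -/L1 -/T.
have -> : x + v = sval (ex n) by rewrite /v addrC subrK.
set z := laplace f s (sval (ex n)) - laplace f s x + Complex 0 v * L1 => zle.
have zn : normc (c%:C%C + laplace f s (sval (ex n))) <= e.
  case: (ex n) => w /= lt; apply: (le_trans (ltW lt)).
  have h1 : e^-1 < (Num.truncn e^-1).+1%:R by exact: truncnS_gt.
  have h2 : (Num.truncn e^-1).+1%:R <= n.+1%:R :> R by rewrite ler_nat.
  rewrite invf_plt ?posrE// in h1.
  have h3 : n.+1%:R^-1 <= e.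
    by rewrite invf_ple ?posrE// ltW// (lt_le_trans _ h2)// truncnS_gt.
  have : 0 < n.+1%:R^-1 :> R by [].
  by move: h3; move: (n.+1%:R^-1) => X; lra.
have -> : c%:C%C + laplace f s x = c%:C%C + laplace f s (sval (ex n)) + Complex 0 v * L1 - z.
  by rewrite /z; ring.
apply: (le_trans (normcB _ _)).
have h4 := normcD (c%:C%C + laplace f s (sval (ex n))) (Complex 0 v * L1).
rewrite normcM in h4.
have nv : normc (Complex 0 v : R[i]) = `|v| by rewrite /= expr0n/= add0r sqrtr_sqr.
rewrite nv in h4.
have h5 : `|v| * normc L1 <= e * normc L1 by rewrite ler_wpM2r// ltW.
have h6 : 8 * (0 ^+ 2 + v ^+ 2) * T <= 8 * e * T.
  rewrite expr0n/= add0r ler_wpM2r// ler_pM2l// -real_normK ?num_real// expr2.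
  apply: (@le_trans _ _ (e * 1)); last by rewrite mulr1.
  by apply: ler_pM => //; [exact: ltW|exact: le_trans (ltW we) e1].
apply: (@le_trans _ _ ((1 + normc L1 + 8 * T) * e)); first by move: zle; lra.
by rewrite ler_wpM2l// addr_ge0// ?addr_ge0// mulr_ge0.
Qed.

End zero_free_line.

(** * A vertical line without characteristic roots *)

Section zero_free_line.
Context {R : realType}.
Local Notation mu := (@lebesgue_measure R).
Implicit Types (f g : R -> R) (s w t p v : R) (z : R[i]).

Lemma complex_neq0 s w : 0 < s -> Complex s w != 0 :> R[i].
Proof. by move=> s0; apply/eqP => -[sE _]; move: s0; rewrite sE ltxx. Qed.

Lemma laplace_thetaE s w : 0 < s -> laplace theta s w = (Complex s w)^-1.
Proof.
move=> s0; have z0 := complex_neq0 w s0.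
by apply: (mulfI z0); rewrite laplace_theta// mulfV.
Qed.

(** The identity a (theta * k) = t k makes the derivative of the transform of k
a rational multiple of the transform. *)
Lemma laplace_mulX_fker a s w : 0 < a -> a <= 1 -> 0 < s ->
  laplace (fun t => t * fker a t) s w =
  a%:C%C * ((Complex s w)^-1 * laplace (fker a) s w).
Proof.
move=> a0 a1 s0.
have -> : (fun t => t * fker a t) = fun t => a * convol theta (fker a) t.
  by apply/funext => t; rewrite (conv_theta_fker t a0).2.
have [st _] := itg_damp_theta s0; have sk := summable_damp_fker a0 a1 s0.
by rewrite laplaceZ ?laplace_conv ?laplace_thetaE//; exact: wsummable_conv.
Qed.

Variables (a A B tau lam : R).
Hypotheses (a0 : 0 < a) (a1 : a <= 1) (tau0 : 0 <= tau) (lam0 : 0 < lam).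

(** The sign is such that 1 + laplace feedback is the characteristic function. *)
Definition feedback t : R := (- A) * fker a t + (- B) * fker a (t - tau).

Lemma subexp_feedback : subexponential feedback.
Proof.
have ek := subexp_fker a0 a1.
by apply: subexpD; apply: subexpZ => //; exact: subexp_shift.
Qed.

Lemma laplace_feedback s w : 0 < s -> laplace feedback s w =
  - ((A%:C%C + B%:C%C * cexpN s w tau) * laplace (fker a) s w).
Proof.
move=> s0; have sk := summable_damp_fker a0 a1 s0.
have sk' := summable_damp_shift tau sk.
rewrite laplaceD; [|exact: summable_dampZ..].
by rewrite (laplaceZ (- A) w sk) (laplaceZ (- B) w sk') (laplace_shift w tau sk) !rmorphN/=; ring.
Qed.

(** Otherwise the characteristic function has a double zero on each line. Eliminating
exp(- s tau) between the two equations gives tau + a / s - tau A L = 0 with L the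
transform of the kernel, which again is a constant plus a transform; at a double
zero of it 1 / s = tau A L. Hence tau s = 1 - a on two different lines, so that
tau = 0, and then 1 / s = 0. *)
Lemma zero_free_line : exists s, [/\ 0 < s, s < lam & exists2 k, 0 < k &
  forall w, k <= normc (1 - (A%:C%C + B%:C%C * cexpN s w tau) * laplace (fker a) s w)].
Proof.
apply: contrapT => H.
have ef := subexp_feedback.
have E0 : 0 < (2 * (`|A| + `|B| + 1))^-1.
  by rewrite invr_gt0 mulr_gt0// ltr_wpDl// addr_ge0.
have [W W0 far] := laplace_fker_small a0 a1 E0.
have oneE : (1%:C)%C = 1 :> R[i] by [].
have zeros s : 0 < s -> s < lam ->
    exists2 w, `|w| <= W & 1%:C%C + laplace feedback s w = 0.
  move=> s0 sl; apply: contrapT => nz; apply: H; exists s; split=> //.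
  have [|w wW|k k0 kle] := laplace_gap (W := W) ef s0 (c := 1).
  - by move=> w wW E; apply: nz; exists w.
  - rewrite laplace_feedback// oneE.
    set X := _ * _.
    have : normc X <= 2^-1.
      rewrite /X normcM.
      have e1 : normc (A%:C%C + B%:C%C * cexpN s w tau) <= `|A| + `|B|.
        apply: (le_trans (normcD _ _)); rewrite normcM !normc_real lerD2l.
        by rewrite ler_piMr// normc_cexpN expRN_le1// mulr_ge0// ltW.
      have e2 := far s w s0 wW.
      apply: (@le_trans _ _ ((`|A| + `|B|) * (2 * (`|A| + `|B| + 1))^-1)).
        by apply: ler_pM => //; exact: normc_ge0.
      have C0 : 0 <= `|A| + `|B| by rewrite addr_ge0.
      move: C0; move: (`|A| + `|B|) => C C0.
      by rewrite ler_pdivrMr; [lra|rewrite mulr_gt0// ltr_wpDl].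
    have : normc (1 : R[i]) <= normc (1 - X) + normc X.
      by have := normcD (1 - X) X; rewrite subrK.
    by rewrite normc1; lra.
  exists k => // w; have := kle w.
  by rewrite laplace_feedback.
have dbl := double_zero_on_lines ef zeros.
pose g (t : R) : R := a * theta t + (- (tau * A)) * fker a t.
have eg : subexponential g.
  by apply: subexpD; apply: subexpZ; [exact: subexp_theta|exact: subexp_fker].
have gE s w : 0 < s -> laplace g s w =
    a%:C%C * (Complex s w)^-1 - tau%:C%C * A%:C%C * laplace (fker a) s w.
  move=> s0; have [st _] := itg_damp_theta s0; have sk := summable_damp_fker a0 a1 s0.
  rewrite laplaceD; [|exact: summable_dampZ..].
  by rewrite (laplaceZ a w st) (laplaceZ (- (tau * A)) w sk) laplace_thetaE// rmorphN rmorphM/=; ring.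
have zeros2 s : 0 < s -> s < lam ->
    exists2 w, `|w| <= W & tau%:C%C + laplace g s w = 0.
  move=> s0 sl; have [w [wW z1 z2]] := dbl s s0 sl; exists w; first exact: wW.
  rewrite gE//; move: z1 z2; rewrite oneE laplace_feedback//.
  have sk := summable_damp_fker a0 a1 s0.
  have s1 := (subexp_mulX (subexp_fker a0 a1)).2 _ s0.
  have s2 := summable_damp_shift tau sk; have s3 := summable_damp_shift tau s1.
  have -> : (fun t => t * feedback t) = fun t => (- A) * (t * fker a t) +
     ((- B) * ((t - tau) * fker a (t - tau)) + (- (B * tau)) * fker a (t - tau)).
    by apply/funext => t; rewrite /feedback; ring.
  have d1 := summable_dampZ (- A) s1; have d2 := summable_dampZ (- B) s3.
  have d3 := summable_dampZ (- (B * tau)) s2; have d23 := summable_dampD d2 d3.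
  rewrite (laplaceD _ d1 d23) (laplaceD _ d2 d3) (laplaceZ (- A) w s1).
  rewrite (laplaceZ (- B) w s3) (laplaceZ (- (B * tau)) w s2).
  rewrite (laplace_shift w tau sk) (@laplace_shift _ (fun t => t * fker a t) s w tau)//.
  rewrite laplace_mulX_fker// !rmorphN !rmorphM/=.
  have z0 := complex_neq0 w s0.
  move: (laplace (fker a) s w) (cexpN s w tau) (Complex s w) z0 => L E z z0.
  move: (A%:C)%C (B%:C)%C (tau%:C)%C (a%:C)%C => A' B' t' a' e1 e2.
  have e3 : B' * E * L = 1 - A' * L.
    by apply/eqP; rewrite -subr_eq0 -oppr_eq0 -e1; apply/eqP; ring.
  have -> : t' + (a' * z^-1 - t' * A' * L) =
    - (- A' * (a' * (z^-1 * L)) + (- B' * (E * (a' * (z^-1 * L))) + - (B' * t') * (E * L)))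
     + a' * z^-1 * (1 - A' * L - B' * E * L) + t' * (1 - A' * L - B' * E * L) by ring.
  by rewrite e2 e3; ring.
have dbl2 := double_zero_on_lines eg zeros2.
have last s : 0 < s -> s < lam -> tau * s = 1 - a /\
   exists2 z : R[i], z != 0 & exists L, z^-1 = tau%:C%C * L.
  move=> s0 sl; have [w [_ z1 z2]] := dbl2 s s0 sl; move: z1 z2.
  have z0 := complex_neq0 w s0.
  rewrite gE//.
  have -> : (fun t => t * g t) = fun t => a * (t * fker 1 t) + (- (tau * A)) * (t * fker a t).
    by apply/funext => t; rewrite /g fker1; ring.
  have k1 := (subexp_mulX (subexp_fker (@ltr01 R) (lexx 1))).2 _ s0.
  have ka := (subexp_mulX (subexp_fker a0 a1)).2 _ s0.
  rewrite laplaceD; [|exact: summable_dampZ..].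
  rewrite (laplaceZ a w k1) (laplaceZ (- (tau * A)) w ka) !laplace_mulX_fker// fker1 laplace_thetaE// oneE mul1r.
  rewrite rmorphN rmorphM/= => e1 e2.
  have a'0 : a%:C%C != 0 :> R[i] by apply/eqP => -[aE]; move: a0; rewrite aE ltxx.
  have e3 : (Complex s w)^-1 = tau%:C%C * (A%:C%C * laplace (fker a) s w).
    apply: (mulfI a'0); apply: (mulIf (invr_neq0 z0)).
    apply/eqP; rewrite -subr_eq0 -e2; apply/eqP; ring.
  split; last by exists (Complex s w) => //; exists (A%:C%C * laplace (fker a) s w).
  have e4 : tau%:C%C * Complex s w = 1 - a%:C%C.
    have e5 : tau%:C%C + (a%:C%C - 1) * (Complex s w)^-1 = 0.
      by rewrite -[RHS]e1 mulrBl mul1r {2}e3; ring.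
    have : (tau%:C%C + (a%:C%C - 1) * (Complex s w)^-1) * Complex s w = 0 by rewrite e5 mul0r.
    by rewrite mulrDl mulfVK// => /eqP; rewrite addr_eq0 => /eqP ->; ring.
  by have := congr1 (@Re R) e4; rewrite /= mul0r subr0.
have l1 : 0 < lam / 2 by rewrite divr_gt0.
have l2 : 0 < lam / 4 by rewrite divr_gt0.
have [e1 [z z0 [L zL]]] := last (lam / 2) l1 (ltac:(by move: lam0; lra)).
have [e2 _] := last (lam / 4) l2 (ltac:(by move: lam0; lra)).
have : tau = 0.
  have : tau * (lam / 2 - lam / 4) = 0 by rewrite mulrBr e1 e2 subrr.
  move=> /eqP; rewrite mulf_eq0 => /orP[/eqP //|/eqP E].
  by move: lam0 E; lra.
move=> tE; move: zL; rewrite tE mul0r => /eqP; rewrite invr_eq0.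
by rewrite (negPf z0).
Qed.

End zero_free_line.

(** * Comparison of energies *)

Section plancherel.
Context {R : realType}.
Local Notation mu := (@lebesgue_measure R).
Implicit Types (f g F : R -> R) (s w t x : R) (z : R[i]).

Definition cauchy_density x : R := (oneDsqr x)^-1.
Local Notation pk := cauchy_density.

Lemma cauchy_density_ge0 x : 0 <= pk x.
Proof. by rewrite invr_ge0 (le_trans ler01)// oneDsqr_ge1. Qed.

Lemma measurable_cauchy : measurable_fun setT pk.
Proof. by apply: continuous_measurable_fun; exact: continuous_oneDsqrV. Qed.

Lemma summable_cauchy : summableR pk.
Proof.
pose c := pk \_ `[0, +oo[.
have mc : measurable_fun [set: measurableTypeR R] c.
  by apply/(measurable_restrictT _ _).1 => //; exact: measurable_funTS measurable_cauchy.
have c0 x : 0 <= c x by rewrite /c patchE; case: ifP => // _; exact: cauchy_density_ge0.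
have sc : summableR c.
  apply: summableRP => //.
  rewrite (_ : (\int[mu]_t _)%E = (\int[mu]_(t in `[0%R, +oo[) (oneDsqr t)^-1%:E)%E).
    by rewrite integral0y_oneDsqr ltry.
  rewrite [RHS]integral_mkcond; apply: eq_integral => t _.
  by rewrite ger0_norm// /c !patchE; case: ifP.
apply: (summableR_le measurable_cauchy (summableRD sc (summableR_opp sc))) => x.
rewrite ger0_norm ?cauchy_density_ge0// ger0_norm; last by rewrite addr_ge0.
have [x0|x0] := leP 0 x.
  by rewrite {1}/c patchE ifT ?lerDl// inE/= in_itv/= x0.
rewrite {2}/c patchE ifT; last by rewrite inE/= in_itv/= oppr_ge0 ltW.
by rewrite (_ : pk (- x) = pk x) ?lerDr// /pk /cauchy_density /oneDsqr sqrrN.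
Qed.

Lemma itg_cauchy_gt0 : 0 < itg pk.
Proof.
rewrite lt_neqAle itg_ge0 ?andbT; last exact: cauchy_density_ge0.
apply/eqP => I0.
have nE : itg (fun t => `|pk t|) = 0.
  by rewrite I0; congr itg; apply/funext => t; rewrite ger0_norm// cauchy_density_ge0.
have [t t0 E] := ae_exists_gt0 (itg_norm_eq0 summable_cauchy nE).
have : 0 < pk t by rewrite invr_gt0 (lt_le_trans ltr01)// oneDsqr_ge1.
by rewrite E ltxx.
Qed.

Lemma damp0 f : damp 0 f = f.
Proof. by apply/funext => t; rewrite /damp mul0r oppr0 expR0 mul1r. Qed.

Definition energy F : R := itg (fun t => F t ^+ 2).

Definition autocorrelation F := convol F (fun t => F (- t)).

Definition abel_mean e F : R :=
  itg (fun w => damp e theta w * normc (laplace F 0 w) ^+ 2).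

Section one_function.
Variables (F : R -> R) (M : R).
Hypotheses (sF : summableR F) (FM : forall t, `|F t| <= M).
Local Notation A := (autocorrelation F).

Let mF : measurable_fun setT F. Proof. exact: summableR_measurable. Qed.

Lemma summable_sqr : summableR (fun t => F t ^+ 2).
Proof.
rewrite (_ : (fun t => _) = fun t => F t * F t); last by apply/funext => t; rewrite expr2.
exact: summableR_bounded FM sF.
Qed.

Lemma energy_ge0 : 0 <= energy F.
Proof. by apply: itg_ge0 => t; exact: sqr_ge0. Qed.

Lemma summable_autocorrelation : summableR A.
Proof. by apply: summable_conv => //; exact: summableR_opp. Qed.

Lemma autocorrelation0 : A 0 = energy F.
Proof.
rewrite /energy -(itg_opp summable_sqr); congr itg; apply/funext => t.
by rewrite sub0r expr2.
Qed.

Lemma autocorrelation_le x : `|A x| <= energy F.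
Proof.
have s2 := summable_sqr.
have s3 := summableR_refl x s2; have s4 := summableR_opp s2.
have sA : summableR (fun t => F (x - t) * F (- t)).
  apply: (@summableR_bounded _ (fun t => F (x - t)) M) => //; first exact: measurable_refl.
  exact: summableR_opp.
apply: (le_trans (itg_norm sA)).
have -> : energy F = itg (fun t => 2^-1 * (F (x - t) ^+ 2) + 2^-1 * (F (- t) ^+ 2)).
  rewrite itgD; [|exact: summableRZ..].
  rewrite !itgZ// (itg_opp s2) (itg_refl x (summableR_measurable s2)) -/(energy F); lra.
apply: itg_le; [exact: summableR_norm|by apply: summableRD; exact: summableRZ|move=> t].
rewrite normrM -(real_normK (num_real (F (x - t)))) -(real_normK (num_real (F (- t)))).
by have := sqr_ge0 (`|F (x - t)| - `|F (- t)|); rewrite sqrrB -mulr_natl; lra.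
Qed.

(** The autocorrelation convolves F with its reflection, whose transform at a point of
the imaginary axis is the conjugate of that of F. *)
Lemma laplace_autocorrelation w :
  itg (fun t => cos (w * t) * A t) = normc (laplace F 0 w) ^+ 2.
Proof.
have sF0 : summableR (damp 0 F) by rewrite damp0.
have sG : summableR (damp 0 (fun t => F (- t))) by rewrite damp0; exact: summableR_opp.
rewrite sqr_normcE.
have H := congr1 (@Re R) (laplace_conv w sF0 sG); move: H.
rewrite -/(autocorrelation F) /= !damp0 => ->.
have -> : itg (fun t => cos (w * t) * F (- t)) = itg (fun t => cos (w * t) * F t).
  rewrite -[RHS]itg_opp; last exact: summable_cos.
  by congr itg; apply/funext => t; rewrite mulrN cosN.
have -> : itg (fun t => sin (w * t) * F (- t)) = - itg (fun t => sin (w * t) * F t).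
  rewrite -(itg_opp (summable_sin w sF)) -mulN1r -itgZ; last first.
    exact: summableR_opp (summable_sin w sF).
  by congr itg; apply/funext => t; rewrite mulrN sinN; ring.
ring.
Qed.

(** The integral over w of exp(- e w) cos(w x) is the real part of the transform of
theta, that is the Poisson kernel e / (e^2 + x^2); x is then replaced by e x. *)
Lemma abel_meanE e : 0 < e ->
  abel_mean e F = itg (fun x => A (e * x) * pk x) /\
  summableR (fun w => damp e theta w * normc (laplace F 0 w) ^+ 2) /\
  summableR (fun x => A (e * x) * pk x).
Proof.
move=> e0; have [st _] := itg_damp_theta e0.
have sA := summable_autocorrelation.
have mA := summableR_measurable sA.
pose G w x := damp e theta w * (cos (w * x) * A x).
have mG : measurable_fun [set: measurableTypeR R * measurableTypeR R] (fun u => G u.1 u.2).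
  apply: measurable_funM; first exact: measurable_p1 (summableR_measurable st).
  apply: measurable_funM; last exact: measurable_p2.
  apply: (@measurableT_comp _ _ _ _ _ _ (@cos R)).
    by apply: continuous_measurable_fun; exact: continuous_cos.
  apply: measurable_funM; [exact: (measurable_p1 (@measurable_id _ _ setT))|].
  exact: (measurable_p2 (@measurable_id _ _ setT)).
have sG w : summableR (G w) by apply: summableRZ; exact: summable_cos.
have d0 w : 0 <= damp e theta w by rewrite mulr_ge0 ?expR_ge0 ?theta_ge0.
have bG w : itg (fun x => `|G w x|) <= itg (fun t => `|A t|) * damp e theta w.
  rewrite mulrC -itgZ; last exact: summableR_norm.
  apply: itg_le => [||x]; [exact: summableR_norm|by apply: summableRZ; exact: summableR_norm|].
  rewrite /G normrM (normrM (cos _)) (ger0_norm (d0 w)) ler_wpM2l// ler_piMl// cos_max//.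
have [fub s1 s2 _] := fubiniR_suff mG sG (summableRZ (itg (fun t => `|A t|)) st) bG.
have E1 : (fun w => itg (fun x => G w x)) = fun w => damp e theta w * normc (laplace F 0 w) ^+ 2.
  apply/funext => w; transitivity (damp e theta w * itg (fun x => cos (w * x) * A x)).
    exact: itgZ (summable_cos w sA).
  by congr (_ * _); exact: laplace_autocorrelation.
pose h x := A x * (e / (e ^+ 2 + x ^+ 2)).
have E2 : (fun x => itg (fun w => G w x)) = h.
  apply/funext => x.
  have -> : (fun w => G w x) = fun w => A x * (cos (x * w) * damp e theta w).
    by apply/funext => w; rewrite /G (mulrC w); ring.
  rewrite itgZ; last exact: summable_cos.
  congr (_ * _); have := congr1 (@Re R) (laplace_thetaE x e0).
  by move=> /= ->.
rewrite E1 in fub s1; rewrite E2 in fub s2.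
have hE : (fun x => h (e * x + 0)) = fun x => e^-1 * (A (e * x) * pk x).
  apply/funext => x; rewrite /h addr0 /cauchy_density /oneDsqr.
  have : 0 < 1 + x ^+ 2 by rewrite ltr_pwDl// sqr_ge0.
  move=> /lt0r_neq0 x1; have e1 := lt0r_neq0 e0.
  have x2 : e ^+ 2 + (e * x) ^+ 2 != 0.
    by rewrite exprMn -{1}(mulr1 (e ^+ 2)) -mulrDr mulf_neq0// expf_neq0.
  by field; rewrite x1 x2 e1.
have s3 : summableR (fun x => A (e * x) * pk x).
  have := summableR_affine 0 e0 s2; rewrite hE => /(summableRZ e).
  by apply: eq_integrable => // x _ /=; rewrite mulVKf// gt_eqF.
split; last by [].
rewrite /abel_mean fub; have := itg_affine 0 e0 s2; rewrite hE itgZ// => /mulfI.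
by move=> ->//; rewrite invr_eq0 gt_eqF.
Qed.

Lemma abel_mean_le e : 0 < e -> abel_mean e F <= energy F * itg pk.
Proof.
move=> e0; have [-> [_ s1]] := abel_meanE e0.
rewrite -itgZ; last exact: summable_cauchy.
apply: itg_le => // [|x]; first by apply: summableRZ; exact: summable_cauchy.
rewrite ler_wpM2r ?cauchy_density_ge0//.
exact: le_trans (ler_norm _) (autocorrelation_le _).
Qed.

Hypotheses (F0 : F 0 = 0) (cF : forall t, t != 0 -> {for t, continuous F}).

(** For small e only the value of the autocorrelation at 0 counts, which is the energy. *)
Lemma abel_mean_cvg : abel_mean n.+1%:R^-1 F @[n --> \oo] --> energy F * itg pk.
Proof.
have e0 n : 0 < n.+1%:R^-1 :> R by [].
have -> : (fun n => abel_mean n.+1%:R^-1 F) = fun n => itg (fun x => A (n.+1%:R^-1 * x) * pk x).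
  by apply/funext => n; exact: (abel_meanE (e0 n)).1.
have -> : energy F * itg pk = itg (fun x => energy F * pk x).
  by rewrite itgZ//; exact: summable_cauchy.
have sE := summableRZ (energy F) summable_cauchy.
have s1 n := (abel_meanE (e0 n)).2.2.
have lim x : A (n.+1%:R^-1 * x) * pk x @[n --> \oo] --> energy F * pk x.
  apply: cvgM; last exact: cvg_cst.
  rewrite -autocorrelation0 /autocorrelation /convol.
  have x0 : (n.+1%:R^-1 * x : R) @[n --> \oo] --> (0 : R).
    by rewrite -[X in _ --> X](mul0r x); apply: cvgM; [exact: cvg_harmonic|exact: cvg_cst].
  have sM := summableRZ M (summableR_norm (summableR_opp sF)).
  have mG y : measurable_fun setT (fun t => F (y - t) * F (- t)).
    by apply: measurable_funM; [exact: measurable_refl|exact: measurable_opp].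
  have l t : F (n.+1%:R^-1 * x - t) * F (- t) @[n --> \oo] --> F (0 - t) * F (- t).
    have [->|t0] := eqVneq t 0.
      rewrite oppr0 F0 mulr0 (_ : (fun n => _) = fun=> 0); first exact: cvg_cst.
      by apply/funext => n; rewrite mulr0.
    apply: cvgM; last exact: cvg_cst.
    apply: (@continuous_cvg nat R R _ _ (fun n => n.+1%:R^-1 * x - t) F (0 - t)).
      by apply: cF; rewrite sub0r oppr_eq0.
    by apply: cvgB => //; exact: cvg_cst.
  have b n t : `|F (n.+1%:R^-1 * x - t) * F (- t)| <= M * `|F (- t)|.
    by rewrite normrM ler_wpM2r.
  have al : {ae mu, forall t, F (n.+1%:R^-1 * x - t) * F (- t) @[n --> \oo] --> F (0 - t) * F (- t)}.
    by apply: aeW.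
  have ab : {ae mu, forall t, forall n, `|F (n.+1%:R^-1 * x - t) * F (- t)| <= M * `|F (- t)|}.
    by apply: aeW.
  have [_ _] := dominated_itg (fun n => mG (n.+1%:R^-1 * x)) (mG 0) al sM ab.
  exact.
have bound x n : `|A (n.+1%:R^-1 * x) * pk x| <= energy F * pk x.
  rewrite normrM (ger0_norm (cauchy_density_ge0 x)).
  by rewrite ler_wpM2r ?cauchy_density_ge0// autocorrelation_le.
have al : {ae mu, forall x, A (n.+1%:R^-1 * x) * pk x @[n --> \oo] --> energy F * pk x}.
  by apply: aeW.
have ab : {ae mu, forall x, forall n, `|A (n.+1%:R^-1 * x) * pk x| <= energy F * pk x}.
  by apply: aeW.
have [_ _] := dominated_itg (fun n => summableR_measurable (s1 n)) (summableR_measurable sE) al sE ab.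
exact.
Qed.

End one_function.

(** The hypothesis passes to Abel means. These are at most a fixed multiple of the
energies, and those of F, which is continuous off the origin, converge to this
multiple of its energy. *)
Lemma energy_comparison (F G1 G2 : R -> R) (M k a b : R) :
  summableR F -> summableR G1 -> summableR G2 ->
  (forall t, `|F t| <= M) -> (forall t, `|G1 t| <= M) -> (forall t, `|G2 t| <= M) ->
  F 0 = 0 -> (forall t, t != 0 -> {for t, continuous F}) -> 0 <= a -> 0 <= b ->
  (forall w, k * normc (laplace F 0 w) ^+ 2 <=
     a * normc (laplace G1 0 w) ^+ 2 + b * normc (laplace G2 0 w) ^+ 2) ->
  k * energy F <= a * energy G1 + b * energy G2.
Proof.
move=> sF s1 s2 FM M1 M2 F0 cF a0 b0 H.
pose E := a * energy G1 + b * energy G2.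
have P0 := itg_cauchy_gt0.
suff : k * (energy F * itg pk) <= E * itg pk by rewrite mulrA ler_pM2r.
have step n : k * abel_mean n.+1%:R^-1 F <= E * itg pk.
  have e0 : 0 < n.+1%:R^-1 :> R by [].
  have [_ [sQ _]] := abel_meanE sF e0.
  have [_ [sQ1 _]] := abel_meanE s1 e0; have [_ [sQ2 _]] := abel_meanE s2 e0.
  have l1 := abel_mean_le s1 M1 e0; have l2 := abel_mean_le s2 M2 e0.
  apply: (@le_trans _ _ (a * abel_mean n.+1%:R^-1 G1 + b * abel_mean n.+1%:R^-1 G2)).
    rewrite /abel_mean -!itgZ// -itgD; [|exact: summableRZ..].
    apply: itg_le; [exact: summableRZ|by apply: summableRD; exact: summableRZ|move=> w].
    rewrite !(mulrCA _ (damp _ _ _)) -mulrDr ler_wpM2l//.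
    by rewrite mulr_ge0 ?expR_ge0 ?theta_ge0.
  by rewrite /E mulrDl -!mulrA; apply: lerD; apply: ler_wpM2l.
have c : k * abel_mean n.+1%:R^-1 F @[n --> \oo] --> k * (energy F * itg pk).
  by apply: cvgM; [exact: cvg_cst|exact: (abel_mean_cvg sF FM F0 cF)].
by apply: (cvgr_to_le c); exact: nearW.
Qed.

End plancherel.

(** * The real characteristic root *)

Section instability.
Context {R : realType}.
Local Notation mu := (@lebesgue_measure R).
Implicit Types (f g : R -> R) (s w t x : R) (z : R[i]).

(** In the variable ln lam the function A + B exp(- lam tau) - lam^a is continuous on
the whole line, positive far to the left since A + B > 0, and negative far to the
right. *)
Lemma characteristic_root (a A B tau : R) : 0 < a -> a <= 1 -> 0 <= tau -> 0 < A + B ->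
  exists2 lam, 0 < lam & lam `^ (- a) * (A + B * expR (- (lam * tau))) = 1.
Proof.
move=> a0 a1 tau0 AB0.
pose h x := A + B * expR (- (expR x * tau)) - expR (a * x).
have ch : continuous h.
  have cexp (f : R -> R) : continuous f -> continuous (fun x => expR (f x)).
    by move=> cf x; apply: (@continuous_comp _ _ _ f expR); [exact: cf|exact: continuous_expR].
  move=> x; apply: cvgB; last by apply: cexp => {}x; exact: continuous_scale.
  apply: cvgD; first exact: cvg_cst.
  apply: cvgM; first exact: cvg_cst.
  apply: (cexp (fun x => - (expR x * tau))) => {}x; apply: cvgN.
  by apply: cvgM; [exact: continuous_expR|exact: cvg_cst].
have Bt0 : 0 <= `|B| * tau by rewrite mulr_ge0.
(* If lam <= q and lam^a <= q, then |B| (1 - exp(- lam tau)) + lam^a is at most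
(A + B) / 2. *)
pose q := (A + B) / (2 * (1 + `|B| * tau)).
have d0 : 0 < 2 * (1 + `|B| * tau) by rewrite mulr_gt0// ltr_pwDl.
have q0 : 0 < q by rewrite divr_gt0.
pose x0 := - (q^-1 / a); pose x1 := (`|A| + `|B|) / a.
have qa0 : 0 < q^-1 / a by rewrite divr_gt0// invr_gt0.
have x10 : 0 <= x1 by apply: divr_ge0; [exact: addr_ge0|exact: ltW].
have small : expR (a * x0) <= q.
  rewrite /x0 mulrN mulrC divfK ?gt_eqF// expRN invf_ple ?posrE ?expR_gt0//.
  by have := expR_ge1Dx q^-1; lra.
have small' : expR x0 <= q.
  apply: le_trans small; rewrite ler_expR /x0 mulrN lerN2 ler_piMl// ltW//.
have hx0 : 0 <= h x0.
  have := expR_ge1Dx (- (expR x0 * tau)) => e1.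
  have e2 : expR (- (expR x0 * tau)) <= 1 by rewrite expRN_le1// mulr_ge0// expR_ge0.
  have e3 : `|B| * (1 - expR (- (expR x0 * tau))) <= `|B| * (q * tau).
    rewrite ler_wpM2l//; have := ler_wpM2r tau0 small'; lra.
  have e4 : B * (1 - expR (- (expR x0 * tau))) <= `|B| * (1 - expR (- (expR x0 * tau))).
    by rewrite ler_wpM2r ?subr_ge0// ler_norm.
  have e5 : 2 * (q + `|B| * (q * tau)) = A + B by rewrite /q; field; rewrite gt_eqF// ltr_pwDl.
  have q00 := ltW q0; have : 0 <= `|B| * (q * tau) by rewrite mulr_ge0// mulr_ge0.
  by move: small e3 e4 e5 AB0; rewrite /h; lra.
have hx1 : h x1 <= 0.
  have e2 : expR (- (expR x1 * tau)) <= 1 by rewrite expRN_le1// mulr_ge0// expR_ge0.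
  have e3 : B * expR (- (expR x1 * tau)) <= `|B|.
    apply: (le_trans (ler_norm _)); rewrite normrM ler_piMr// ger0_norm ?expR_ge0//.
  have e4 := expR_ge1Dx (a * x1).
  have e5 : a * x1 = `|A| + `|B| by rewrite /x1 mulrC divfK ?gt_eqF.
  have := ler_norm A; rewrite /h; move: e3 e4 e5; lra.
have x01 : x0 <= x1 by apply: le_trans x10; rewrite oppr_le0 ltW.
have [|x _ hx] := @IVT R h x0 x1 0 x01 (continuous_subspaceT ch).
  by rewrite ge_min hx1 orbT le_max hx0.
exists (expR x); first exact: expR_gt0.
rewrite /powR gt_eqF ?expR_gt0// expRK.
have -> : A + B * expR (- (expR x * tau)) = expR (a * x) by apply/eqP; rewrite -subr_eq0 -hx.
by rewrite -expRD mulNr addNr expR0.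
Qed.

(** * Energy estimate for small solutions *)

Section core.
Variables (a A B tau th c : R) (u h : R -> R).
Hypotheses (a0 : 0 < a) (a1 : a <= 1) (tau0 : 0 <= tau).
Hypotheses (th0 : 0 <= th) (th1 : th <= 1) (c0 : 0 < c) (c1 : c <= 1).
Hypotheses (cu : continuous u) (uc : forall t, t <= 0 -> u t = c) (u1 : forall t, `|u t| <= 1).
Hypotheses (mh : measurable_fun setT h).
Hypothesis hu : forall t, `|h t - theta t * (A * u t + B * u (t - tau))| <=
  th * (theta t * (`|u t| + `|u (t - tau)|)).
Hypothesis uE : forall t, u t = c + convol (fker a) h t.

Definition future t : R := theta t * u t.
(** The indicator of ]0, tau], the times at which the delayed state still belongs to
the history. *)
Definition window t : R := theta t - theta (t - tau).
(** Everything in h that is not linear in [future]: the history and the remainder. *)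
Definition forcing t : R := h t - (A * future t + B * future (t - tau)).
Definition residue t : R := forcing t - B * c * window t.
Local Notation w := future.

Lemma window_cases t : window t = 0 \/ window t = 1 /\ 0 < t.
Proof.
rewrite /window /theta; have [t0|t0] := ltP 0 t; last first.
  by left; rewrite ifF ?subrr//; apply/negbTE; rewrite -leNgt subr_le0 (le_trans t0).
by case: ifP => _; [left; rewrite subrr|right; rewrite subr0].
Qed.

Lemma theta_delayed t : theta t * u (t - tau) = w (t - tau) + c * window t.
Proof.
rewrite /w /window /theta; have [t0|t0] := ltP 0 t; last first.
  by rewrite ifF ?subrr ?mul0r ?mulr0 ?addr0//; apply/negbTE; rewrite -leNgt subr_le0 (le_trans t0).
by case: ltP => d; [ring|rewrite uc//; ring].
Qed.

Lemma future_le t : `|w t| <= 1.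
Proof. by rewrite /w /theta normrM; case: ifP; rewrite ?normr1 ?normr0 ?mul1r ?mul0r. Qed.

Lemma future_causal : causal w.
Proof. by move=> t t0; rewrite /w causal_theta// mul0r. Qed.

Lemma measurable_future : measurable_fun setT w.
Proof.
apply: measurable_funM; first exact: measurable_theta.
exact: continuous_measurable_fun.
Qed.

Lemma forcing_residue t : forcing t = B * c * window t + residue t.
Proof. by rewrite /residue; ring. Qed.

Lemma residue_le t : `|residue t| <= th * (`|w t| + `|w (t - tau)| + c * window t).
Proof.
have -> : residue t = h t - theta t * (A * u t + B * u (t - tau)).
  transitivity (h t - (A * (theta t * u t) + B * (theta t * u (t - tau)))); last by ring.
  by rewrite theta_delayed /residue /forcing -/(w t); ring.
apply: (le_trans (hu t)); rewrite ler_wpM2l// mulrDr -addrA; apply: lerD.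
  by rewrite /w normrM (ger0_norm (theta_ge0 t)).
rewrite -{1}(ger0_norm (theta_ge0 t)) -normrM theta_delayed.
apply: (le_trans (ler_normD _ _)); rewrite lerD2l ger0_norm//.
by have [->|[-> _]] := window_cases t; rewrite ?mulr0 ?mulr1// ltW.
Qed.

Lemma window_ge0 t : 0 <= window t.
Proof. by have [->|[-> _]] := window_cases t. Qed.

Lemma forcing_le t : `|forcing t| <= (`|B| + 1) * (c * window t) + th * (`|w t| + `|w (t - tau)|).
Proof.
have w0 := window_ge0 t; have cw : 0 <= c * window t by rewrite mulr_ge0// ltW.
rewrite forcing_residue; apply: (le_trans (ler_normD _ _)).
have E : `|B * c * window t| = `|B| * (c * window t) by rewrite -mulrA normrM (ger0_norm cw).
have := residue_le t; rewrite E mulrDr.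
have : th * (c * window t) <= c * window t by rewrite ler_piMl.
by lra.
Qed.

Lemma forcing_bounded t : `|forcing t| <= `|B| + 3.
Proof.
apply: (le_trans (forcing_le t)).
have h1 : c * window t <= 1 by have [->|[-> _]] := window_cases t; rewrite ?mulr0 ?mulr1.
have h2 : 0 <= c * window t by rewrite mulr_ge0 ?window_ge0// ltW.
have B0 : 0 <= `|B| + 1 by rewrite ltW// ltr_wpDl.
have := ler_wpM2l B0 h1; have := future_le t; have := future_le (t - tau).
have : th * (`|w t| + `|w (t - tau)|) <= `|w t| + `|w (t - tau)| by rewrite ler_piMl// addr_ge0.
by lra.
Qed.

Lemma forcing_causal : causal forcing.
Proof.
move=> t t0; have := residue_le t; have [W|[_ /lt_geF]] := window_cases t; last by rewrite t0.
have t1 : t - tau <= 0 by rewrite subr_le0 (le_trans t0).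
rewrite forcing_residue W !mulr0 !future_causal// normr0 !addr0 mulr0 normr_le0 => /eqP ->.
by rewrite addr0.
Qed.

Lemma measurable_forcing : measurable_fun setT forcing.
Proof.
apply: measurable_funB => //; apply: measurable_funD; apply: measurable_funM;
  [exact: measurable_cst|exact: measurable_future|exact: measurable_cst|].
by apply: measurable_shift; exact: measurable_future.
Qed.

Lemma subexp_future : subexponential w.
Proof. exact: subexp_bounded future_causal measurable_future future_le. Qed.

Lemma subexp_forcing : subexponential forcing.
Proof. exact: subexp_bounded forcing_causal measurable_forcing forcing_bounded. Qed.

(** The transform of w = c theta + k * (A w + B w_tau + forcing). *)
Lemma laplace_equation s v : 0 < s ->
  (1 - (A%:C%C + B%:C%C * cexpN s v tau) * laplace (fker a) s v) * laplace w s v =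
  c%:C%C * laplace theta s v + laplace (fker a) s v * laplace forcing s v.
Proof.
move=> s0.
pose g t := A * w t + (B * w (t - tau) + forcing t).
have hE : h = g by apply/funext => t; rewrite /g /forcing; ring.
have ew := subexp_future; have ef := subexp_forcing.
have eg : subexponential g.
  apply: subexpD; first exact: subexpZ.
  by apply: subexpD => //; apply: subexpZ; exact: subexp_shift.
have ek := subexp_fker a0 a1.
have wE : w = fun t => c * theta t + convol (fker a) g t.
  apply/funext => t; have [t0|t0] := leP t 0.
    by rewrite future_causal// causal_theta// mulr0 conv_causal ?addr0//; [exact: ek.1|exact: eg.1].
  by rewrite /w /theta t0 mul1r mulr1 uE hE.
have sw := ew.2 _ s0; have sf := ef.2 _ s0; have sk := ek.2 _ s0; have sg := eg.2 _ s0.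
have st := (itg_damp_theta s0).1.
have sws := summable_damp_shift tau sw.
have e1 : laplace w s v = c%:C%C * laplace theta s v + laplace (fker a) s v * laplace g s v.
  rewrite {1}wE (laplaceD v (summable_dampZ c st) (wsummable_conv sk sg)).
  by rewrite (laplaceZ c v st) laplace_conv.
have e2 : laplace g s v = A%:C%C * laplace w s v +
    (B%:C%C * (cexpN s v tau * laplace w s v) + laplace forcing s v).
  have s1 := summable_dampZ A sw; have s2 := summable_dampZ B sws.
  rewrite (laplaceD v s1 (summable_dampD s2 sf)) (laplaceD v s2 sf).
  by rewrite (laplaceZ A v sw) (laplaceZ B v sws) (laplace_shift v tau sw).
have -> : c%:C%C * laplace theta s v = laplace w s v - laplace (fker a) s v * laplace g s v.
  by rewrite {1}e1; ring.
by rewrite e2; ring.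
Qed.

Lemma continuous_future t : t != 0 -> {for t, continuous w}.
Proof.
rewrite neq_lt => /orP[t0|t0].
  have wt : w t = 0 by apply: future_causal; exact: ltW.
  have z : (fun=> 0) @ t --> (0 : R) by exact: cvg_cst.
  rewrite /prop_for /continuous_at wt; apply: cvg_trans z; apply: near_eq_cvg; near=> r.
  apply/esym/future_causal; near: r.
  by apply: filterS (lt_nbhsl t0) => r /ltW.
have -> : {for t, continuous w} = (w @ t --> w t) by [].
have wE r : 0 < r -> w r = u r by move=> r0; rewrite /w /theta r0 mul1r.
have cut : u @ t --> u t by exact: cu.
rewrite wE//; apply: cvg_trans cut; apply: near_eq_cvg; near=> r.
by apply/esym/wE; near: r; exact: lt_nbhsr.
Unshelve. all: by end_near. Qed.

Lemma continuous_damp_future s t : t != 0 -> {for t, continuous (damp s w)}.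
Proof.
move=> t0; apply: cvgM; last exact: continuous_future.
apply: (@continuous_comp _ _ _ (fun t : R => - (s * t)) expR); last exact: continuous_expR.
by apply: cvgN; exact: continuous_scale.
Qed.

Lemma norm_damp_le s (f : R -> R) (M : R) t : 0 <= s -> causal f -> (forall t, `|f t| <= M) ->
  `|damp s f t| <= M.
Proof.
move=> s0 f0 fM; rewrite /damp normrM ger0_norm ?expR_ge0//.
have [t0|t0] := leP t 0; first by rewrite f0// normr0 mulr0; exact: le_trans (fM 0).
by apply: le_trans (fM t); rewrite ler_piMl// expRN_le1// mulr_ge0// ltW.
Qed.

Lemma norm_theta_le t : `|theta t| <= 1 :> R.
Proof. by rewrite /theta; case: ifP; rewrite ?normr1 ?normr0. Qed.

Lemma sqr_sumr_le (x y : R) : (x + y) ^+ 2 <= 2 * x ^+ 2 + 2 * y ^+ 2.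
Proof.
have -> : 2 * x ^+ 2 + 2 * y ^+ 2 = (x + y) ^+ 2 + (x - y) ^+ 2 by ring.
by rewrite lerDl sqr_ge0.
Qed.

Lemma sqr_le (x y : R) : 0 <= x -> x <= y -> x ^+ 2 <= y ^+ 2.
Proof. by move=> x0 xy; rewrite !expr2; apply: ler_pM. Qed.

Lemma forcing_sqr t : forcing t ^+ 2 <= 2 * (`|B| + 1) ^+ 2 * c ^+ 2 * theta t ^+ 2 +
  4 * th ^+ 2 * (w t ^+ 2 + w (t - tau) ^+ 2).
Proof.
set X := (`|B| + 1) * (c * window t); set Y := th * (`|w t| + `|w (t - tau)|).
have le : forcing t ^+ 2 <= (X + Y) ^+ 2.
  by rewrite -(real_normK (num_real (forcing t))); apply: sqr_le => //; exact: forcing_le.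
apply: (le_trans le); apply: (le_trans (sqr_sumr_le X Y)); apply: lerD.
  have W : window t ^+ 2 <= theta t ^+ 2.
    have [->|[-> t0]] := window_cases t; first by rewrite expr0n/= sqr_ge0.
    by rewrite /theta t0.
  have XE : 2 * X ^+ 2 = 2 * (`|B| + 1) ^+ 2 * c ^+ 2 * window t ^+ 2 by rewrite /X; ring.
  rewrite XE; apply: ler_wpM2l => //.
  by apply: mulr_ge0; [apply: mulr_ge0 => //; exact: sqr_ge0|exact: sqr_ge0].
have := ler_wpM2l (sqr_ge0 th) (sqr_sumr_le `|w t| `|w (t - tau)|).
have YE : Y ^+ 2 = th ^+ 2 * (`|w t| + `|w (t - tau)|) ^+ 2 by rewrite /Y; ring.
rewrite YE !real_normK ?num_real//.
move: (th ^+ 2) (w t ^+ 2) (w (t - tau) ^+ 2) ((`|w t| + `|w (t - tau)|) ^+ 2) => x1 x2 x3 x4.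
lra.
Qed.

Lemma energy_summable s (f : R -> R) (M : R) : 0 < s -> subexponential f ->
  (forall t, `|f t| <= M) -> summableR (fun t => damp s f t ^+ 2).
Proof.
move=> s0 ef fM; apply: (@summable_sqr _ _ M); first exact: ef.2.
by move=> t; apply: norm_damp_le => //; [exact: ltW|exact: ef.1].
Qed.

Lemma forcing_energy s : 0 < s -> energy (damp s forcing) <=
  2 * (`|B| + 1) ^+ 2 * c ^+ 2 * energy (damp s theta) + 8 * th ^+ 2 * energy (damp s w).
Proof.
move=> s0.
have q1 := energy_summable s0 subexp_forcing forcing_bounded.
have q2 := energy_summable s0 subexp_theta norm_theta_le.
have q3 := energy_summable s0 subexp_future future_le.
have q4 := summableR_shift tau q3.
set b := 2 * _ * _.
have -> : b * energy (damp s theta) + 8 * th ^+ 2 * energy (damp s w) =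
  itg (fun t => b * damp s theta t ^+ 2 +
    4 * th ^+ 2 * (damp s w t ^+ 2 + damp s w (t - tau) ^+ 2)).
  rewrite itgD; [|exact: summableRZ|by apply: summableRZ; exact: summableRD].
  rewrite (itgZ b q2) (itgZ (4 * th ^+ 2) (summableRD q3 q4)).
  rewrite itgD// (itg_shift tau (summableR_measurable q3)) -!/(energy _); ring.
apply: itg_le => // [|t].
  by apply: summableRD; [exact: summableRZ|by apply: summableRZ; exact: summableRD].
set e := expR (- (s * t)).
have e0 : 0 <= e ^+ 2 by exact: sqr_ge0.
have e1 : e ^+ 2 * w (t - tau) ^+ 2 <= damp s w (t - tau) ^+ 2.
  rewrite /damp; move: (w (t - tau)) => y.
  rewrite exprMn ler_wpM2r ?sqr_ge0// ler_pXn2r ?nnegrE ?expR_ge0//.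
  by rewrite ler_expR lerN2 ler_wpM2l ?(ltW s0)// lerBlDr lerDl.
have th20 : 0 <= 4 * th ^+ 2 by rewrite mulr_ge0// sqr_ge0.
have := ler_wpM2l e0 (forcing_sqr t); have := ler_wpM2l th20 e1.
have -> : damp s forcing t ^+ 2 = e ^+ 2 * forcing t ^+ 2 by rewrite /damp exprMn.
have -> : damp s theta t ^+ 2 = e ^+ 2 * theta t ^+ 2 by rewrite /damp exprMn.
have -> : damp s w t ^+ 2 = e ^+ 2 * w t ^+ 2 by rewrite /damp exprMn.
rewrite -/b; move: (damp s w (t - tau) ^+ 2) (e ^+ 2) (forcing t ^+ 2) (w (t - tau) ^+ 2)
  (w t ^+ 2) (theta t ^+ 2) (4 * th ^+ 2) b => x1 x2 x3 x4 x5 x6 x7 x8; lra.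
Qed.

Lemma normc_laplace_fker s v : 0 < s -> normc (laplace (fker a) s v) <= 2 * s `^ (- a).
Proof.
move=> s0; apply: (le_trans (normc_laplace v (summable_damp_fker a0 a1 s0))).
by rewrite wnormE norm_fker// itg_damp_fker.
Qed.

(** On a line where 1 - K^ is bounded away from zero the linear part is
invertible, so the size of the solution is controlled by that of the forcing,
which for small th is mostly due to the initial value. *)
Lemma future_energy s k : 0 < s -> 0 < k ->
  (forall v, k <= normc (1 - (A%:C%C + B%:C%C * cexpN s v tau) * laplace (fker a) s v)) ->
  16 * (s `^ (- a)) * th <= k ->
  k ^+ 2 * energy (damp s w) <=
  c ^+ 2 * (4 + 32 * (s `^ (- a)) ^+ 2 * (`|B| + 1) ^+ 2) * energy (damp s theta).
Proof.
move=> s0 k0 gap small.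
set Phi := 2 * s `^ (- a).
have Phi0 : 0 <= Phi by rewrite mulr_ge0// powR_ge0.
have cmp : k ^+ 2 * energy (damp s w) <= 2 * c ^+ 2 * energy (damp s theta) +
    2 * Phi ^+ 2 * energy (damp s forcing).
  have B1 : 1 <= `|B| + 3 by have := normr_ge0 B; lra.
  apply: (@energy_comparison _ _ _ _ (`|B| + 3)).
  - exact: subexp_future.2.
  - exact: subexp_theta.2.
  - exact: subexp_forcing.2.
  - move=> t; apply: le_trans B1; apply: norm_damp_le; [exact: ltW|exact: future_causal|exact: future_le].
  - move=> t; apply: le_trans B1; apply: norm_damp_le; [exact: ltW|exact: causal_theta|exact: norm_theta_le].
  - move=> t; apply: norm_damp_le; [exact: ltW|exact: forcing_causal|exact: forcing_bounded].
  - by rewrite /damp future_causal// mulr0.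
  - exact: continuous_damp_future.
  - by rewrite mulr_ge0// sqr_ge0.
  - by rewrite mulr_ge0// sqr_ge0.
  move=> v; have lE (f : R -> R) : laplace (damp s f) 0 v = laplace f s v.
    by rewrite /laplace damp0.
  rewrite !lE.
  have h1 := congr1 (@normc R) (laplace_equation v s0).
  have h2 : k * normc (laplace w s v) <=
      c * normc (laplace theta s v) + Phi * normc (laplace forcing s v).
    apply: (@le_trans _ _ (normc (1 - (A%:C%C + B%:C%C * cexpN s v tau) * laplace (fker a) s v)
      * normc (laplace w s v))); first by rewrite ler_wpM2r ?normc_ge0.
    rewrite -normcM h1; apply: (le_trans (normcD _ _)).
    rewrite !normcM normc_real (gtr0_norm c0) lerD2l ler_wpM2r ?normc_ge0//.
    exact: normc_laplace_fker.
  move: h2 (normc_ge0 (laplace w s v)).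
  move: (normc (laplace w s v)) (normc (laplace theta s v)) (normc (laplace forcing s v)) => x1 x2 x3.
  move=> h2 x10; have h3 := sqr_le (mulr_ge0 (ltW k0) x10) h2.
  have := le_trans h3 (sqr_sumr_le _ _); rewrite !exprMn; lra.
have fe := ler_wpM2l (mulr_ge0 (ler0n R 2) (sqr_ge0 Phi)) (forcing_energy s0).
have Ew : 0 <= energy (damp s w) by exact: energy_ge0.
have absorb : 2 * Phi ^+ 2 * (8 * th ^+ 2) <= k ^+ 2 / 2.
  have : (8 * Phi * th) ^+ 2 <= k ^+ 2.
    apply: sqr_le; first by rewrite mulr_ge0// mulr_ge0.
    by apply: le_trans small; rewrite /Phi; lra.
  have := sqr_ge0 (Phi * th); rewrite !exprMn; lra.
have := ler_wpM2r Ew absorb.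
have PhiE : Phi ^+ 2 = 4 * (s `^ (- a)) ^+ 2 by rewrite /Phi exprMn; ring.
move: fe cmp; rewrite PhiE.
move: (energy (damp s w)) (energy (damp s theta)) (energy (damp s forcing)) (s `^ (- a)) => x1 x2 x3 x4.
lra.
Qed.

End core.

End instability.

(** * The balance at the characteristic root *)

Section small_gain.
Context {R : realType}.
Local Notation mu := (@lebesgue_measure R).
Implicit Types (f g : R -> R) (s w t x : R) (z : R[i]).

Lemma laplace_real f s : laplace f s 0 = (itg (damp s f))%:C%C.
Proof.
apply: complexP => /=.
  by congr itg; apply/funext => t; rewrite mul0r cos0 mul1r.
apply/eqP; rewrite oppr_eq0; apply/eqP; apply: etrans itg0.
by congr itg; apply/funext => t; rewrite mul0r sin0 mul0r.
Qed.

Lemma cexpN_real s t : cexpN s 0 t = (expR (- (s * t)))%:C%C.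
Proof. by rewrite /cexpN mul0r cos0 sin0 mulr1 mulr0 oppr0. Qed.

Section core.
Variables (a A B tau th c : R) (u h : R -> R).
Hypotheses (a0 : 0 < a) (a1 : a <= 1) (tau0 : 0 <= tau).
Hypotheses (th0 : 0 <= th) (th1 : th <= 1) (c0 : 0 < c) (c1 : c <= 1).
Hypotheses (cu : continuous u) (uc : forall t, t <= 0 -> u t = c) (u1 : forall t, `|u t| <= 1).
Hypotheses (mh : measurable_fun setT h).
Hypothesis hu : forall t, `|h t - theta t * (A * u t + B * u (t - tau))| <=
  th * (theta t * (`|u t| + `|u (t - tau)|)).
Hypothesis uE : forall t, u t = c + convol (fker a) h t.
Local Notation w := (future u).
Local Notation forcing := (forcing A B tau u h).
Local Notation residue := (residue A B tau c u h).

Let ew : subexponential w := subexp_future cu u1.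
Let ef : subexponential forcing := subexp_forcing tau0 th0 th1 c0 c1 cu uc u1 mh hu.

Lemma subexp_window : subexponential (window tau : R -> R).
Proof.
have -> : window tau = fun t : R => theta t + (-1) * theta (t - tau).
  by apply/funext => t; rewrite /window mulN1r.
apply: subexpD; first exact: subexp_theta.
by apply: subexpZ; apply: subexp_shift => //; exact: subexp_theta.
Qed.

Lemma itg_damp_window s : 0 < s -> itg (damp s (window tau)) = (1 - expR (- (s * tau))) / s.
Proof.
move=> s0; have [st it] := itg_damp_theta s0.
have -> : damp s (window tau) = fun t => damp s theta t - damp s (fun t => theta (t - tau)) t.
  by apply/funext => t; rewrite /damp /window mulrBr.
rewrite itgB//; last exact: summable_damp_shift.
rewrite it damp_shift itgZ; last exact: summableR_shift.
by rewrite itg_shift ?it ?mulrBl ?mul1r//; exact: summableR_measurable.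
Qed.

Lemma subexp_residue : subexponential residue.
Proof.
have -> : residue = fun t => forcing t + (- (B * c)) * window tau t.
  by apply/funext => t; rewrite /residue mulNr.
by apply: subexpD => //; apply: subexpZ; exact: subexp_window.
Qed.

(** At the real characteristic root the factor 1 - K^ vanishes, which leaves a
balance between the initial value and the nonlinear remainder. *)
Lemma root_balance lam : 0 < lam -> lam `^ (- a) * (A + B * expR (- (lam * tau))) = 1 ->
  c * (A + B) / lam = - itg (damp lam residue).
Proof.
move=> l0 root.
have := laplace_equation a0 a1 tau0 th0 th1 c0 c1 cu uc u1 mh hu uE 0 l0.
rewrite !laplace_real cexpN_real itg_damp_fker// (itg_damp_theta l0).2.
have -> : itg (damp lam forcing) =
    B * c * ((1 - expR (- (lam * tau))) / lam) + itg (damp lam residue).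
  rewrite -itg_damp_window// -itgZ; last exact: subexp_window.2.
  rewrite -itgD; [|by apply: summableRZ; exact: subexp_window.2|exact: subexp_residue.2].
  by congr itg; apply/funext => t; rewrite /damp (forcing_residue A B tau c u h t); ring.
move: root; move: (lam `^ (- a)) (expR (- (lam * tau))) (itg (damp lam w))
  (itg (damp lam residue)) => psi e x y root.
move: (lam^-1) => l E.
have E1 : (1 - (A + B * e) * psi) * x = c * l + psi * (B * c * ((1 - e) * l) + y).
  by have := congr1 (@Re R) E; rewrite /= ?(mul0r, mulr0, addr0, add0r, subr0, oppr0).
have E2 : (A + B * e) * (c * l + psi * (B * c * ((1 - e) * l) + y)) = 0.
  by rewrite -E1 (mulrC _ psi) root subrr mul0r mulr0.
have E3 : (A + B * e) * (c * l + psi * (B * c * ((1 - e) * l) + y)) =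
   (A + B * e) * c * l + (psi * (A + B * e)) * (B * c * ((1 - e) * l) + y) by ring.
rewrite E3 root in E2; apply/eqP; rewrite -addr_eq0 -E2; apply/eqP; ring.
Qed.

(** Cauchy and Schwarz, in the form x y <= (c x^2 + y^2 / c) / 2: with this weight
both terms are of order c when the energy is of order c^2. *)
Lemma future_wnorm s lam : 0 < s -> s < lam ->
  wnorm lam w <= 2^-1 * (c * (2 * (lam - s))^-1) + 2^-1 * c^-1 * energy (damp s w).
Proof.
move=> s0 sl; have d0 : 0 < 2 * (lam - s) by rewrite mulr_gt0// subr_gt0.
have [st it] := itg_damp_theta d0.
have q3 := energy_summable s0 ew (future_le u1).
rewrite -it -!itgZ//; last exact: summableRZ.
rewrite -itgD; [|by apply: summableRZ; exact: summableRZ|exact: summableRZ].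
apply: itg_le; first exact: summableR_norm (ew.2 _ (lt_trans s0 sl)).
  by apply: summableRD; [apply: summableRZ; exact: summableRZ|exact: summableRZ].
move=> t; have [t0|t0] := leP t 0.
  by rewrite /damp ew.1// causal_theta// !mulr0 normr0 expr0n/= mulr0 addr0.
have -> : damp lam w t = expR (- ((lam - s) * t)) * damp s w t.
  by rewrite /damp mulrA -expRD; congr (expR _ * _); ring.
have -> : damp (2 * (lam - s)) theta t = expR (- ((lam - s) * t)) ^+ 2.
  by rewrite /damp /theta t0 mulr1 expr2 -expRD; congr expR; ring.
rewrite normrM ger0_norm ?expR_ge0// -(real_normK (num_real (damp s w t))).
move: (expR _) `|damp s w t| => x y.
have -> : 2^-1 * (c * x ^+ 2) + 2^-1 * c^-1 * y ^+ 2 = x * y + 2^-1 * c^-1 * (c * x - y) ^+ 2.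
  by field; rewrite gt_eqF.
by rewrite lerDl mulr_ge0 ?sqr_ge0// mulr_ge0// invr_ge0 ltW.
Qed.

Lemma residue_itg lam : 0 < lam ->
  `|itg (damp lam residue)| <= th * (2 * wnorm lam w + c / lam).
Proof.
move=> l0; have sw := ew.2 _ l0; have er := subexp_residue.2 _ l0.
have sws := summable_damp_shift tau sw; have sW := subexp_window.2 _ l0.
have n1 := summable_damp_norm sw; have n2 := summable_damp_norm sws.
have n3 := summable_dampZ c sW.
have n12 := summable_dampD n1 n2; have n123 := summable_dampD n12 n3.
apply: (le_trans (itg_norm er)).
apply: (le_trans (wnorm_le (measurable_damped (summableR_measurable er))
  (summable_dampZ th n123) _).2) => [t|].
  exact: (residue_le tau0 th0 c0 uc hu t).
rewrite (dampZ lam th) itgZ// ler_wpM2l//.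
rewrite dampD itgD// dampD itgD// -!wnormE dampZ itgZ// itg_damp_window// mulr_natl mulr2n.
apply: lerD; first by rewrite lerD2l; exact: wnorm_shift (ltW l0) tau0 sw.
rewrite ler_wpM2l ?(ltW c0)// ler_pdivrMr// mulVf ?gt_eqF// lerBlDr lerDl expR_ge0//.
Qed.

Lemma small_solution_absurd s lam k : 0 < s -> s < lam -> 0 < k ->
  lam `^ (- a) * (A + B * expR (- (lam * tau))) = 1 ->
  (forall v, k <= normc (1 - (A%:C%C + B%:C%C * cexpN s v tau) * laplace (fker a) s v)) ->
  16 * (s `^ (- a)) * th <= k ->
  th * ((2 * (lam - s))^-1 +
    (4 + 32 * (s `^ (- a)) ^+ 2 * (`|B| + 1) ^+ 2) * energy (damp s theta) / k ^+ 2 + lam^-1) <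
  (A + B) / lam -> False.
Proof.
move=> s0 sl k0 root gap small gain; have l0 : 0 < lam := lt_trans s0 sl.
have fe := future_energy a0 a1 tau0 th0 th1 c0 c1 cu uc u1 mh hu uE s0 k0 gap small.
have rb := root_balance l0 root; have ri := residue_itg l0; have fw := future_wnorm s0 sl.
move: fe gain; set C := (4 + _) * energy (damp s theta); rewrite -mulrA -/C => fe gain.
have k20 : 0 < k ^+ 2 by exact: exprn_gt0.
have e1 : energy (damp s w) <= c ^+ 2 * (C / k ^+ 2).
  by rewrite mulrA ler_pdivlMr// mulrC; exact: fe.
have fw2 : 2 * wnorm lam w <= c * (2 * (lam - s))^-1 + c * (C / k ^+ 2).
  have c10 : 0 <= c^-1 by rewrite invr_ge0 ltW.
  have := ler_wpM2l c10 e1.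
  have -> : c^-1 * (c ^+ 2 * (C / k ^+ 2)) = c * (C / k ^+ 2).
    by rewrite expr2 -mulrA mulKf// gt_eqF.
  move: fw; move: (c^-1) (wnorm lam w) (energy (damp s w)) (c * (C / k ^+ 2)) => x1 x2 x3 x4.
  move: (c * (2 * (lam - s))^-1) => x5; lra.
have := ler_norm (- itg (damp lam residue)); rewrite normrN -rb => le.
have {}le := le_trans le ri.
have : th * (2 * wnorm lam w + c / lam) <=
  th * (c * ((2 * (lam - s))^-1 + C / k ^+ 2 + lam^-1)).
  by rewrite ler_wpM2l// (mulrDr c) (mulrDr c) lerD2r.
move=> /(le_trans le); rewrite mulrCA -mulrA ler_pM2l// => /(lt_le_trans gain).
by rewrite ltxx.
Qed.

End core.

(** Perron's argument. The root lam, the line and the lower bound k on it are chosen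
before th. By [root_balance] the remainder has size c, whereas the energy estimate
bounds it by a fixed multiple of th c. *)
Theorem no_small_solution (a A B tau : R) : 0 < a -> a <= 1 -> 0 <= tau -> 0 < A + B ->
  exists th, [/\ 0 < th, th <= 1 & forall (c : R) (u h : R -> R),
    0 < c -> c <= 1 -> continuous u -> (forall t, t <= 0 -> u t = c) ->
    (forall t, `|u t| <= 1) -> measurable_fun setT h ->
    (forall t, `|h t - theta t * (A * u t + B * u (t - tau))| <=
      th * (theta t * (`|u t| + `|u (t - tau)|))) ->
    (forall t, u t = c + convol (fker a) h t) -> False].
Proof.
move=> a0 a1 tau0 AB0.
have [lam l0 root] := characteristic_root a0 a1 tau0 AB0.
have [s [s0 sl [k k0 gap]]] := zero_free_line A B a0 a1 tau0 l0.
set K := (2 * (lam - s))^-1 +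
    (4 + 32 * (s `^ (- a)) ^+ 2 * (`|B| + 1) ^+ 2) * energy (damp s theta) / k ^+ 2 + lam^-1.
have K0 : 0 < K.
  rewrite ltr_wpDl ?invr_gt0// addr_ge0//.
    by rewrite invr_ge0 mulr_ge0// subr_ge0 ltW.
  rewrite divr_ge0 ?sqr_ge0// mulr_ge0 ?energy_ge0// addr_ge0// mulr_ge0 ?sqr_ge0//.
  by rewrite mulr_ge0// sqr_ge0.
have p0 : 0 < s `^ (- a) by exact: powR_gt0.
(* t1 keeps the perturbed problem on the line invertible, t2 makes the remainder
smaller than c (A + B) / lam. *)
pose t1 := k / (16 * s `^ (- a)).
pose t2 := (A + B) / lam / (2 * K).
have t10 : 0 < t1 by rewrite divr_gt0// mulr_gt0.
have t20 : 0 < t2 by rewrite divr_gt0 ?divr_gt0// mulr_gt0.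
exists (Num.min 1 (Num.min t1 t2)); set th := Num.min _ _.
have th0 : 0 < th by rewrite /th !lt_min ltr01 t10.
have th1 : th <= 1 by rewrite /th ge_min lexx.
have tht1 : th <= t1 by rewrite /th !ge_min lexx orbT.
have tht2 : th <= t2 by rewrite /th !ge_min lexx !orbT.
split=> // c u h c0 c1 cu uc u1 mh hu uE.
apply: (small_solution_absurd a0 a1 tau0 (ltW th0) th1 c0 c1 cu uc u1 mh hu uE s0 sl k0 root gap).
  by rewrite mulrC -ler_pdivlMr// mulr_gt0.
rewrite -/K -ltr_pdivlMr//; apply: (le_lt_trans tht2).
rewrite /t2 invfM mulrA ltr_pM2r ?invr_gt0//.
by rewrite ltr_pdivrMr// ltr_pMr ?divr_gt0// ltr1n.
Qed.

End small_gain.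

(** * Instability of the equilibrium *)

Section main.
Context {R : realType}.
Local Notation mu := (@lebesgue_measure R).
Implicit Types (f g : R -> R) (s t x v : R).

Lemma C11_le (L L' : R) g d : L <= L' -> C11 L g d -> C11 L' g d.
Proof.
move=> LL [h1 h2 h3 h4]; split=> [x y|x|x y|x y].
- by apply: (le_trans (h1 x y)); rewrite ler_wpM2r// sqr_ge0.
- exact: le_trans (h2 x) LL.
- by apply: (le_trans (h3 x y)); rewrite ler_wpM2r.
- by apply: (le_trans (h4 x y)); rewrite ler_wpM2r.
Qed.

Lemma history_norm_cst (tau c : R) : 0 <= tau -> history_norm tau (fun=> c) <= `|c|.
Proof.
move=> tau0; apply: ge_sup.
  by exists `|c|; exists 0 => //; rewrite /= in_itv/= oppr_le0 tau0 lexx.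
by move=> _ [t _ <-].
Qed.

Lemma first_exit (u : R -> R) (r : R) : continuous u -> `|u 0| < r ->
  (forall t, 0 <= t -> `|u t| < r) \/
  exists T, [/\ 0 < T, r <= `|u T| & forall t, 0 <= t -> t < T -> `|u t| < r].
Proof.
move=> cu u0; pose S := [set t : R | 0 <= t /\ r <= `|u t|].
have [[t St]|S0] := pselect (S !=set0); last first.
  left=> t t0; rewrite ltNge; apply/negP => rt; apply: S0; by exists t.
right; have hS : has_inf S by split; [exists t|exists 0 => s []].
have below s : 0 <= s -> s < inf S -> `|u s| < r.
  move=> s0 sT; rewrite ltNge; apply/negP => rs.
  by have := ge_inf hS.2 (conj s0 rs : S s); rewrite leNgt sT.
have T0 : 0 <= inf S by apply: lb_le_inf; [exists t|move=> s []].
have cn : continuous (fun t => `|u t|).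
  by move=> s; apply: cvg_norm; exact: cu.
have rT : r <= `|u (inf S)|.
  rewrite leNgt; apply/negP => lt.
  have /cvgrPdist_lt /(_ _ (_ : 0 < r - `|u (inf S)|))[|d /= d0 H] := cn (inf S).
    by rewrite subr_gt0.
  have [s [s0 rs] sd] := inf_adherent d0 hS.
  have sT : inf S <= s by exact: (ge_inf hS.2 (conj s0 rs : S s)).
  have near_T : `|inf S - s| < d by rewrite ler0_norm ?subr_le0// opprB ltrBlDr addrC.
  have {}H : `| `|u (inf S)| - `|u s| | < r - `|u (inf S)| by exact: H.
  have := ler_norm (`|u s| - `|u (inf S)|); rewrite distrC; move: H rs; lra.
exists (inf S); split=> //.
by rewrite lt_neqAle T0 andbT; apply/eqP => E; move: rT; rewrite -E leNgt u0.
Qed.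

(** The solution of the truncated equation solves the original one as long as it stays
in [-r, r]. There stability confines it to half of this interval, so by continuity
it never leaves, and [no_small_solution] applies. *)
Theorem cubic_unstable (a tau xs A B B1 C1 B2 C2 : R) (F : R -> R -> R) :
  0 < a -> a <= 1 -> 0 <= tau -> 0 < A + B ->
  (forall x v, F (xs + x) (xs + v) = cubic A B1 C1 x + cubic B B2 C2 v) ->
  unstable a tau F xs.
Proof.
move=> a0 a1 tau0 AB0 FE st.
have [th [th0 th1 absurd]] := no_small_solution a0 a1 tau0 AB0.
pose M1 := cubic_modulus B1 C1; pose M2 := cubic_modulus B2 C2.
have M10 : 0 <= M1 by exact: cubic_modulus_ge0.
have M20 : 0 <= M2 by exact: cubic_modulus_ge0.
(* On this scale both truncated remainders have size at most th. *)
pose r := th / (M1 + M2 + 1).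
have D0 : 0 < M1 + M2 + 1 by rewrite ltr_wpDl// addr_ge0.
have r0 : 0 < r by rewrite divr_gt0.
have r1 : r <= 1 by rewrite /r ler_pdivrMr// mul1r (le_trans th1)// lerDr addr_ge0.
have rM : r * (M1 + M2 + 1) = th by rewrite /r divfK// gt_eqF.
have M1r : M1 * r <= th by have := mulr_ge0 M20 (ltW r0); move: rM r0; lra.
have M2r : M2 * r <= th by have := mulr_ge0 M10 (ltW r0); move: rM r0; lra.
pose g1 := truncated A B1 C1 r; pose d1 := truncated_slope A B1 C1 r.
pose g2 := truncated B B2 C2 r; pose d2 := truncated_slope B B2 C2 r.
pose L := (`|A| + 7 * M1) + (`|B| + 7 * M2).
have G1 : C11 L g1 d1.
  apply: C11_le (truncated_C11 A B1 C1 (ltW r0) r1).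
  by rewrite lerDl addr_ge0// mulr_ge0.
have G2 : C11 L g2 d2.
  apply: C11_le (truncated_C11 B B2 C2 (ltW r0) r1).
  by rewrite lerDr addr_ge0// mulr_ge0.
have [|rho rho0 stab] := st (r / 2); first by rewrite divr_gt0.
pose c := Num.min (rho / 2) (r / 2).
have c0 : 0 < c by rewrite lt_min !divr_gt0.
have crho : c < rho.
  by apply: (@le_lt_trans _ _ (rho / 2)); [rewrite ge_min lexx|rewrite ltr_pdivrMr// ltr_pMr// ltr1n].
have cr : c < r.
  by apply: (@le_lt_trans _ _ (r / 2)); [rewrite ge_min lexx orbT|rewrite ltr_pdivrMr// ltr_pMr// ltr1n].
have [m [y [m0 ay yE yP]]] := delayed_existence c a0 a1 tau0 G1 G2.
have yP1 t : prim y t = convol (fker a) (delayed_rhs tau c g1 g2 y) t by exact: (yP t).1.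
pose u := state c y.
have cu : continuous u by exact: (state_continuous m0 ay).
have uc t : t <= 0 -> u t = c by exact: (state_history c ay).
have c_norm : `|c| < r by rewrite gtr0_norm.
have FE' x v : `|x| <= r -> `|v| <= r -> F (xs + x) (xs + v) = g1 x + g2 v.
  by move=> xr vr; rewrite FE /g1 /g2 !truncated_id.
have small (T : \bar R) : (0 < T)%E ->
    (forall t, 0 <= t -> (t%:E < T)%E -> `|u t| < r) ->
    forall t, 0 <= t -> (t%:E < T)%E -> `|u t| < r / 2.
  move=> T0 ur t t0 tT.
  have sol : solution a tau F T (fun t => xs + u t).
    apply: (state_solution a0 a1 tau0 G1 G2 m0 ay yE yP1 (ltW c_norm) FE') => s s0 sT.
    by apply: ltW; exact: ur.
  have -> : u t = xs + u t - xs by ring.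
  apply: (stab (cst (xs + c)) _ _ T _ T0 sol _ t t0 tT).
  - by apply: continuous_subspaceT => s; exact: cvg_cst.
  - rewrite (_ : (fun t => _) = fun=> c).
      by apply: (le_lt_trans (history_norm_cst c tau0)); rewrite gtr0_norm.
    by apply/funext => s; rewrite /cst/=; ring.
  - by move=> s /andP[_ s0]; rewrite uc.
have ur t : `|u t| <= r.
  have [t0|/ltW t0] := leP t 0; first by rewrite uc// ltW.
  have u00 : `|u 0| < r by rewrite uc.
  have [H|[T [T0 rT H]]] := first_exit cu u00; first by apply: ltW; exact: H.
  have lt s : 0 <= s -> s < T -> `|u s| < r / 2.
    by move=> s0 sT; apply: (small T%:E); rewrite ?lte_fin.
  have cT : `|u s| @[s --> T^'-] --> `|u T|.
    by apply: cvg_at_left_filter; apply: cvg_norm; exact: cu.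
  suff : `|u T| <= r / 2 by move=> le; move: rT r0 le; lra.
  apply: (cvgr_to_le cT); near=> s; apply: ltW; apply: lt => //.
  by near: s; exact: nbhs_left_ge.
apply: (absurd c u (delayed_rhs tau c g1 g2 y)) => //.
- exact: le_trans (ltW cr) r1.
- by move=> t; exact: le_trans (ur t) r1.
- exact: measurable_damped (summableR_measurable (delayed_rhs_damp c tau0 G1 G2 m0 ay)).
- move=> t; rewrite /delayed_rhs -/u -mulrBr normrM (ger0_norm (theta_ge0 t)).
  rewrite mulrCA ler_wpM2l ?theta_ge0//.
  have -> : g1 (u t) + g2 (u (t - tau)) - (A * u t + B * u (t - tau)) =
     (g1 (u t) - A * u t) + (g2 (u (t - tau)) - B * u (t - tau)) by ring.
  apply: (le_trans (ler_normD _ _)); rewrite (mulrDr th); apply: lerD.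
    by apply: (le_trans (truncated_sub A B1 C1 (ltW r0) r1 _)); rewrite ler_wpM2r.
  by apply: (le_trans (truncated_sub B B2 C2 (ltW r0) r1 _)); rewrite ler_wpM2r.
- by move=> t; rewrite -yP1.
Unshelve. all: by end_near. Qed.

Lemma constant_equilibrium (a tau xs : R) (F : R -> R -> R) : F xs xs = 0 ->
  equilibrium a tau F xs.
Proof.
move=> F0; have d0 t : derive1 (cst xs : R -> R) t = 0.
  by rewrite derive1E derive_cst.
split.
- by apply: continuous_subspaceT => s; exact: cvg_cst.
- move=> b _ _ e e0; exists 1 => // n p q _ _ _.
  by rewrite big1// => i _; rewrite /cst/= subrr normr0.
move=> t t0 _; rewrite /caputo_defined /caputo F0; case: ifP => _.
  by split; [exact: derivable_cst|exact: d0].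
split.
  rewrite (_ : (fun s => _) = cst 0%E); first exact: integrable0.
  by apply/funext => s; rewrite d0 mulr0.
have -> : (fun s => (t - s) `^ (- a) * derive1 (cst xs) s) = cst 0.
  by apply/funext => s; rewrite d0 mulr0.
by rewrite Rintegral_cst// mul0r mulr0.
Qed.

End main.

Theorem theorem10 (R : realType) (alpha delta epsilon p q : R)
    (halpha0 : 0 < alpha) (halpha1 : alpha <= 1)
    (hepsilon : epsilon < 0) (hp : p < 0) (hdq : delta + q < 0) :
  forall tau : R, 0 <= tau ->
    equilibrium alpha tau (cubic_rhs delta epsilon p q)
      (x2star delta epsilon p q) /\
    unstable alpha tau (cubic_rhs delta epsilon p q)
      (x2star delta epsilon p q).
Proof.
move=> tau tau0; set xs := x2star delta epsilon p q.
set D := p ^+ 2 + 4 * epsilon * (delta + q).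
have ed : 0 < epsilon * (delta + q) by rewrite nmulr_rgt0.
have D0 : 0 < D by have := sqr_ge0 p; move: ed; rewrite /D; lra.
have e2 : 2 * epsilon != 0 by rewrite mulf_neq0// lt_eqF.
have root : 2 * epsilon * xs + p = Num.sqrt D.
  by rewrite /xs /x2star mulrC divfK// addrAC addNr add0r.
have xs0 : xs < 0.
  have sD : 0 < Num.sqrt D by rewrite sqrtr_gt0.
  have : 0 < xs * (2 * epsilon) by move: root sD hp; lra.
  by rewrite nmulr_lgt0// pmulr_rlt0.
have eq0 : delta + q = epsilon * xs ^+ 2 + p * xs.
  have sq : (2 * epsilon * xs + p) ^+ 2 = D by rewrite root sqr_sqrtr// ltW.
  have e4 : 4 * epsilon != 0 by rewrite mulf_neq0// lt_eqF.
  apply: (mulfI e4).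
  have -> : 4 * epsilon * (epsilon * xs ^+ 2 + p * xs) = (2 * epsilon * xs + p) ^+ 2 - p ^+ 2 by ring.
  by rewrite sq /D; ring.
have fE : delta * xs - epsilon * xs ^+ 3 - p * xs ^+ 2 + q * xs = 0.
  have -> : delta * xs - epsilon * xs ^+ 3 - p * xs ^+ 2 + q * xs =
    xs * ((delta + q) - (epsilon * xs ^+ 2 + p * xs)) by ring.
  by rewrite eq0 subrr mulr0.
split; first exact: constant_equilibrium.
apply: (@cubic_unstable _ _ _ _ (q - 2 * p * xs) (delta - 3 * epsilon * xs ^+ 2)
  (- p) 0 (- (3 * epsilon * xs)) (- epsilon)) => //.
  have -> : q - 2 * p * xs + (delta - 3 * epsilon * xs ^+ 2) = - xs * (2 * epsilon * xs + p).
    have -> : q - 2 * p * xs + (delta - 3 * epsilon * xs ^+ 2) =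
      (delta + q) - 2 * p * xs - 3 * epsilon * xs ^+ 2 by ring.
    by rewrite eq0; ring.
  by rewrite root mulr_gt0 ?oppr_gt0// sqrtr_gt0.
move=> x v; rewrite /cubic_rhs /cubic.
set rhs := RHS; transitivity ((delta * xs - epsilon * xs ^+ 3 - p * xs ^+ 2 + q * xs) + rhs).
  by rewrite /rhs; ring.
by rewrite fE add0r.
Qed.
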